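(* Let $p,q\ge1$, let $\beta\vdash q$, and let $1\le k\le\min(p,q)$. Then for every complex Hermitian positive-semidefinite matrix $A$ of order $p+q$, $$\Phi_{p,\beta,k}(A)=\sum_{\nu\vdash p+q}N^\nu_{p,\beta,k}\,d_\nu(A)\ge0,$$ and $$\sum_{\nu\vdash p+q}f^\nu N^\nu_{p,\beta,k}=0.$$
   Context: For $\lambda\vdash n$, $\chi^\lambda$ is the corresponding irreducible character of $S_n$, $f^\lambda=\chi^\lambda(1)$, and $d_\lambda(A)=\sum_{\sigma\in S_n}\chi^\lambda(\sigma)\prod_{i=1}^n a_{i,\sigma(i)}$. The content of a box $b=(i,j)$ (row $i$, column $j$) is $c(b)=j-i$. A skew shape $\nu/\beta$ is a horizontal $p$-strip if it has exactly $p$ boxes, no two in the same column. For $\nu\vdash p+q$ such that $\nu\supset\beta$ and $\nu/\beta$ is a horizontal $p$-strip, put $$P_{\nu/\beta}(z)=\prod_{b\in\nu/\beta}(z+c(b)),\qquad N^\nu_{p,\beta,k}=\frac1{(p-k)!}\sum_{j=0}^{p-k}(-1)^{p-k-j}\binom{p-k}{j}P_{\nu/\beta}(j-p+1);$$ put $N^\nu_{p,\beta,k}=0$ for all other $\nu\vdash p+q$. *)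

(* Defs.v *)
From HB Require Import structures.
From mathcomp Require Import all_boot all_order all_fingroup all_algebra.
From mathcomp Require Import mxrepresentation.
From mathcomp Require Import reals complex.

Set Implicit Arguments.
Unset Strict Implicit.
Unset Printing Implicit Defensive.

Import Order.TTheory GRing.Theory Num.Theory.
Local Open Scope ring_scope.

(* A partition of n is stored as its n row lengths, padded with zeros. *)
Definition intpartn_pred (n : nat) (t : n.-tuple 'I_n.+1) : bool :=
  let s := [seq nat_of_ord i | i <- t] in sorted geq s && (sumn s == n).

Record intpartn (n : nat) : predArgType :=
  IntPartn { intpartn_tuple : n.-tuple 'I_n.+1; _ : intpartn_pred intpartn_tuple }.

HB.instance Definition _ n := [isSub for @intpartn_tuple n].
HB.instance Definition _ n := [Finite of intpartn n by <:].

Definition rows (n : nat) (la : intpartn n) : seq nat :=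
  [seq nat_of_ord i | i <- intpartn_tuple la].

Definition row_len (n : nat) (la : intpartn n) (i : nat) : nat :=
  nth 0%N (rows la) i.

(* Young symmetrizer of the tableau of shape la filled with 0, ..., n-1 in
   reading order: x lies in row [reshape_index (rows la) x] and in column
   [reshape_offset (rows la) x].  Products of permutations are in diagrammatic
   order, [(s * t)%g x = t (s x)]. *)
Definition row_stab (n : nat) (la : intpartn n) : {set 'S_n} :=
  [set s : 'S_n | [forall x : 'I_n,
    reshape_index (rows la) (s x) == reshape_index (rows la) x]].

Definition col_stab (n : nat) (la : intpartn n) : {set 'S_n} :=
  [set s : 'S_n | [forall x : 'I_n,
    reshape_offset (rows la) (s x) == reshape_offset (rows la) x]].

Definition young_symmetrizer (F : fieldType) (n : nat) (la : intpartn n)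
    : 'rV[F]_#|[set: 'S_n]%G| :=
  \sum_(r in row_stab la) \sum_(c in col_stab la)
     (-1) ^+ odd_perm c *:
       delta_mx 0 (gring_index [set: 'S_n]%G (r * c)%g).

(* The Specht module of la: the right ideal of the group algebra F[S_n]
   generated by the Young symmetrizer. *)
Definition specht_module (F : fieldType) (n : nat) (la : intpartn n)
    : 'M[F]_#|[set: 'S_n]%G| :=
  cyclic_mx (regular_repr F [set: 'S_n]%G) (young_symmetrizer F la).

Definition specht_repr (F : fieldType) (n : nat) (la : intpartn n)
    : mx_representation F [set: 'S_n]%G (\rank (specht_module F la)) :=
  submod_repr (cyclic_mx_module (regular_repr F [set: 'S_n]%G)
                                (young_symmetrizer F la)).

Definition chi (F : fieldType) (n : nat) (la : intpartn n) (s : 'S_n) : F :=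
  \tr (specht_repr F la s).

Definition chi_degree (F : fieldType) (n : nat) (la : intpartn n) : F :=
  chi F la 1%g.

Definition immanant (F : fieldType) (n : nat) (la : intpartn n) (A : 'M[F]_n) : F :=
  \sum_(s : 'S_n) chi F la s * \prod_(i < n) A i (s i).

(* Row and column indices start at 0, which does not affect contents. *)
Definition content (n : nat) (b : 'I_n * 'I_n) : int :=
  (b.2 : nat)%:Z - (b.1 : nat)%:Z.

Definition part_sub (m n : nat) (be : intpartn m) (nu : intpartn n) : bool :=
  [forall i : 'I_m, (row_len be i <= row_len nu i)%N].

Definition skew_boxes (m n : nat) (nu : intpartn n) (be : intpartn m)
    : {set 'I_n * 'I_n} :=
  [set b : 'I_n * 'I_n | (row_len be b.1 <= b.2 < row_len nu b.1)%N].

Definition horizontal_strip (p m n : nat) (nu : intpartn n) (be : intpartn m) : bool :=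
  (#|skew_boxes nu be| == p) &&
  [forall b in skew_boxes nu be, forall b' in skew_boxes nu be,
     (b.2 == b'.2) ==> (b == b')].

Definition strip_poly (F : fieldType) (m n : nat) (nu : intpartn n) (be : intpartn m)
    (z : F) : F :=
  \prod_(b in skew_boxes nu be) (z + (content b)%:~R).

Definition strip_coef (F : fieldType) (p q k : nat) (be : intpartn q)
    (nu : intpartn (p + q)) : F :=
  if part_sub be nu && horizontal_strip p nu be then
    (((p - k)`!)%:R)^-1 *
    \sum_(0 <= j < (p - k).+1)
       (-1) ^+ (p - k - j) * ('C(p - k, j))%:R *
         strip_poly nu be (j%:R - p%:R + 1)
  else 0.

Definition Phi (F : fieldType) (p q k : nat) (be : intpartn q)
    (A : 'M[F]_(p + q)) : F :=
  \sum_(nu : intpartn (p + q)) strip_coef F k be nu * immanant nu A.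

Definition psdmx (C : numClosedFieldType) (n : nat) (A : 'M[C]_n) : Prop :=
  A \is hermsymmx /\
  forall v : 'cV[C]_n, 0 <= ((v ^t*)%sesqui *m A *m v) 0 0.

(* Main.v *)
(* Let P be the first p indices and Q the last q.  With e_beta a Young
   symmetrizer on Q and eps the sum of the permutations of P, u = e_beta eps is,
   up to a positive scalar, an idempotent whose induced character is the sum of
   the chi^nu with nu/beta a horizontal p-strip (Pieri).  The product of the
   z + J_x over all Jucys-Murphy elements J_x is central and acts on chi^nu by
   the product of the z + c(b) over the boxes b of nu.  Dividing by the analogous
   product for Q, the class function of u prod_(x in P) (z + J_x) is therefore
   the sum of the P_(nu/beta)(z) chi^nu.  On the other hand eps absorbs the
   permutations of P, which gives
     eps prod_(x in P) (z + J_x) = sum_r (z + r) ... (z + p - 1) eps T_r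
   where T_r is the sum of the involutions exchanging r points of P with r points
   of Q.  At z = j - p + 1 the r-th coefficient is a falling factorial of j, so the
   finite difference defining N^nu keeps r = k only: the sum of the N^nu chi^nu
   is, up to a positive scalar, the class function of u T_k.  It vanishes at 1,
   as T_k moves points across P and Q for k >= 1.  If A is a Gram matrix, its
   immanant is an average of terms <w, T_k w> where w is a product of a tensor on
   P and a tensor on Q; exchanging tensor factors between P and Q, each involution
   of T_k contributes a sum of squares.

   For the Pieri rule, each expected constituent occurs because an explicit
   product of symmetrizers is nonzero, and there is no room for more because the
   dimensions add up; the latter follows from the branching inequalities and the
   relation D U = U D + 1 on Young's lattice. *)

(* Put w = z + p - 1. The product (z + r) ... (z + p - 1) is the falling factorial of w of order p -
   r, and N^nu is, by Newton's formula, the coefficient of order p - k of P_(nu/beta) in the basis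
   of falling factorials of w: the shift by p - 1 in its definition makes w = j. The numbers N^nu
   and the sums T_k are thus two readings of the coefficients of one polynomial identity.

   No decomposition into irreducible modules is used. Multiplicities are ranks of maps v |-> a v b
   with a and b idempotent, hence natural numbers, and distinct characters are orthogonal because
   the Jucys-Murphy product separates shapes by their contents.

   Two obstacles shape the end. The content product of beta has zeros in z, so the division by it
   takes place among polynomials. The Young symmetrizer is in general not self-adjoint, so for
   positivity it is exchanged for the character of beta, which is self-adjoint and yields the same
   class function up to a positive factor. *)
From HB Require Import structures.
Require Import Defs.
From mathcomp Require Import all_boot all_order all_fingroup all_algebra.
From mathcomp Require Import mxrepresentation reals complex.
From mathcomp Require Import zify ring.

Set Implicit Arguments.
Unset Strict Implicit.
Unset Printing Implicit Defensive.

Import Order.TTheory GRing.Theory Num.Theory.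
Local Open Scope ring_scope.

(** * Group algebras *)

(* An alias of {ffun gT -> F}, whose own product is pointwise: here it is the
   convolution. *)
Definition galg (F : fieldType) (gT : finGroupType) := {ffun gT -> F}.

Section GroupAlgebra.
Variables (F : fieldType) (gT : finGroupType).
Implicit Types (g h : gT) (c : F).

HB.instance Definition _ := GRing.Lmodule.copy (galg F gT) {ffun gT -> F^o}.

Implicit Types (a b : galg F gT).

Definition gb g : galg F gT := [ffun h => (h == g)%:R].

Definition gmul a b : galg F gT := [ffun g => \sum_h a h * b (h^-1 * g)%g].

Lemma gmulA : associative gmul.
Proof.
move=> a b c; apply/ffunP=> g; rewrite !ffunE.
under eq_bigr => h _ do rewrite ffunE mulr_sumr.
under [RHS]eq_bigr => h _ do rewrite ffunE mulr_suml.
rewrite [RHS]exchange_big; apply: eq_bigr => h _ /=.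
rewrite [RHS](reindex_inj (mulgI h)); apply: eq_bigr => k _ /=.
by rewrite mulKg invMg mulgA mulrA.
Qed.

Lemma gmul1l : left_id (gb 1) gmul.
Proof.
move=> a; apply/ffunP=> g; rewrite ffunE (bigD1 1%g) //= big1 => [|h h1].
  by rewrite ffunE eqxx mul1r invg1 mul1g addr0.
by rewrite ffunE (negPf h1) mul0r.
Qed.

Lemma gmul1r : right_id (gb 1) gmul.
Proof.
move=> a; apply/ffunP=> g; rewrite ffunE (bigD1 g) //= big1 => [|h h1].
  by rewrite ffunE mulVg eqxx mulr1 addr0.
by rewrite ffunE -eq_mulVg1 (negPf h1) mulr0.
Qed.

Lemma gmulDl : left_distributive gmul +%R.
Proof.
move=> a b c; apply/ffunP=> g; rewrite !ffunE -big_split.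
by apply: eq_bigr => h _; rewrite ffunE mulrDl.
Qed.

Lemma gmulDr : right_distributive gmul +%R.
Proof.
move=> a b c; apply/ffunP=> g; rewrite !ffunE -big_split.
by apply: eq_bigr => h _; rewrite ffunE mulrDr.
Qed.

Lemma gb1_neq0 : gb 1 != 0.
Proof.
by apply/eqP => /ffunP/(_ 1%g)/eqP; rewrite !ffunE eqxx oner_eq0.
Qed.

HB.instance Definition _ := GRing.Zmodule_isNzRing.Build (galg F gT)
  gmulA gmul1l gmul1r gmulDl gmulDr gb1_neq0.

Lemma gscalerAl c a b : c *: (a * b) = c *: a * b.
Proof.
apply/ffunP=> g; rewrite !ffunE scaler_sumr.
by apply: eq_bigr => h _; rewrite ffunE; apply: mulrA.
Qed.

HB.instance Definition _ :=
  GRing.Lmodule_isLalgebra.Build F (galg F gT) gscalerAl.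

Lemma gscalerAr c a b : c *: (a * b) = a * (c *: b).
Proof.
apply/ffunP=> g; rewrite !ffunE scaler_sumr.
by apply: eq_bigr => h _; rewrite ffunE; apply: mulrCA.
Qed.

HB.instance Definition _ :=
  GRing.Lalgebra_isAlgebra.Build F (galg F gT) gscalerAr.

Lemma gmulE a b g : (a * b) g = \sum_h a h * b (h^-1 * g)%g.
Proof. by rewrite ffunE. Qed.

Lemma gb1 : gb 1 = 1. Proof. by []. Qed.

Lemma gbMl g a h : (gb g * a) h = a (g^-1 * h)%g.
Proof.
rewrite gmulE (bigD1 g) //= big1 => [|k kg]; rewrite ffunE ?eqxx ?mul1r ?addr0 //.
by rewrite (negPf kg) mul0r.
Qed.

Lemma gbMr g a h : (a * gb g) h = a (h * g^-1)%g.
Proof.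
rewrite gmulE (bigD1 (h * g^-1)%g) //= big1 => [|k kg]; rewrite ffunE.
  by rewrite invMg invgK mulgKV eqxx mulr1 addr0.
case: eqP => [e|]; last by rewrite mulr0.
by rewrite -e invMg invgK mulKVg eqxx in kg.
Qed.

Lemma gbM g h : gb (g * h) = gb g * gb h.
Proof. apply/ffunP=> k; rewrite gbMl !ffunE -(inj_eq (mulgI g) (g^-1 * k)%g) mulKVg. by []. Qed.

Lemma gbVK g a : gb g^-1 * (gb g * a) = a.
Proof. by rewrite mulrA -gbM mulVg gb1 mul1r. Qed.

Lemma galgE a : a = \sum_g a g *: gb g.
Proof.
apply/ffunP=> h; rewrite sum_ffunE (bigD1 h) //= big1 => [|g gh].
  by rewrite !ffunE eqxx addr0 [RHS]mulr1.
by rewrite !ffunE eq_sym (negPf gh) [LHS]mulr0.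
Qed.

Lemma galg_ind (P : galg F gT -> Prop) :
    (forall a b, P a -> P b -> P (a + b)) ->
    (forall c a, P a -> P (c *: a)) -> (forall g, P (gb g)) -> P 0 ->
  forall a, P a.
Proof.
move=> PD PZ Pg P0 a; rewrite [a]galgE.
by elim/big_ind: _ => // g _; apply: PZ.
Qed.

Lemma galg_sumE (I : Type) (r : seq I) (P : pred I) (f : I -> galg F gT) g :
  (\sum_(i <- r | P i) f i) g = \sum_(i <- r | P i) f i g.
Proof. by elim/big_rec2: _ => [|i x y _ <-]; rewrite ffunE. Qed.

Lemma galg0E g : (0 : galg F gT) g = 0. Proof. by rewrite ffunE. Qed.
Lemma galgDE a b g : (a + b) g = a g + b g. Proof. by rewrite ffunE. Qed.
Lemma galgNE a g : (- a) g = - a g. Proof. by rewrite ffunE. Qed.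
Lemma galgZE c a g : (c *: a) g = c * a g. Proof. by rewrite ffunE. Qed.

Lemma gtraceC a b : (a * b) 1%g = (b * a) 1%g.
Proof.
rewrite !gmulE (reindex_inj invg_inj); apply: eq_bigr => h _ /=.
by rewrite invgK !mulg1 mulrC.
Qed.

(** Up to the factor [#|gT|], the projection of the group algebra onto its center. *)
Definition gsym a : galg F gT := \sum_g gb g^-1 * a * gb g.

Lemma gsymE a h : gsym a h = \sum_g a (g * h * g^-1)%g.
Proof. by rewrite galg_sumE; apply: eq_bigr => g _; rewrite gbMr gbMl invgK mulgA. Qed.

Lemma gsymD a b : gsym (a + b) = gsym a + gsym b.
Proof. by rewrite -big_split; apply: eq_bigr => g _; rewrite mulrDr mulrDl. Qed.

Lemma gsymZ c a : gsym (c *: a) = c *: gsym a.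
Proof. by rewrite scaler_sumr; apply: eq_bigr => g _; rewrite -scalerAr -scalerAl. Qed.

Lemma gsym0 : gsym 0 = 0.
Proof. by rewrite /gsym big1 // => g _; rewrite mulr0 mul0r. Qed.

Lemma gsym_sum (I : Type) (r : seq I) (P : pred I) (f : I -> galg F gT) :
  gsym (\sum_(i <- r | P i) f i) = \sum_(i <- r | P i) gsym (f i).
Proof. by elim/big_rec2: _ => [|i x y _ <-]; rewrite ?gsym0 ?gsymD. Qed.

Lemma gsym_gbC a g : gb g * gsym a = gsym a * gb g.
Proof.
rewrite mulr_suml mulr_sumr (reindex_inj (mulIg g)); apply: eq_bigr => h _ /=.
by rewrite invMg !gbM !mulrA -gbM mulgV gb1 mul1r.
Qed.

Definition gcentral z := forall a, a * z = z * a.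

Lemma gcentral_gb z : (forall g, gb g * z = z * gb g) -> gcentral z.
Proof.
move=> zC; apply: galg_ind => [a b az bz|c a az|//|].
- by rewrite mulrDl mulrDr az bz.
- by rewrite -scalerAl az scalerAr.
- by rewrite mul0r mulr0.
Qed.

Lemma gsym_central a : gcentral (gsym a).
Proof. exact/gcentral_gb/gsym_gbC. Qed.

Lemma gsymMr a z : gcentral z -> gsym (a * z) = gsym a * z.
Proof.
by move=> zC; rewrite mulr_suml; apply: eq_bigr => g _; rewrite -!mulrA (zC (gb g)).
Qed.

Lemma gsymMl a z : gcentral z -> gsym (z * a) = z * gsym a.
Proof. by move=> zC; rewrite -zC gsymMr // -zC. Qed.

Lemma gsym_conj a g : gsym (gb g^-1 * a * gb g) = gsym a.
Proof.
rewrite /gsym [RHS](reindex_inj (mulgI g)); apply: eq_bigr => h _.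
by rewrite invMg !gbM !mulrA.
Qed.

Lemma gsymC a b : gsym (a * b) = gsym (b * a).
Proof.
rewrite [b]galgE mulr_sumr mulr_suml !gsym_sum; apply: eq_bigr => g _.
rewrite -scalerAr -scalerAl !gsymZ -(gsym_conj (gb g * a) g); congr (_ *: gsym _).
by rewrite gbVK.
Qed.

Lemma gtrace_gsym a b : (gsym a * b) 1%g = \sum_g (gb g^-1 * a * gb g * b) 1%g.
Proof. by rewrite mulr_suml galg_sumE. Qed.

Lemma gtrace_gsymC a b : (gsym a * b) 1%g = (a * gsym b) 1%g.
Proof.
rewrite gtrace_gsym mulr_sumr galg_sumE (reindex_inj invg_inj) /=.
by apply: eq_bigr => g _; rewrite invgK -!mulrA gtraceC !mulrA.
Qed.

Lemma gsym1 a : gsym a 1%g = #|gT|%:R * a 1%g.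
Proof.
rewrite gsymE (eq_bigr (fun=> a 1%g)) => [|g _]; last by rewrite mulg1 mulgV.
by rewrite sumr_const mulr_natl.
Qed.

(** The linear extension of inversion, without conjugation of the coefficients: it gives the adjoint
    only of elements with real coefficients. *)
Definition gstar a : galg F gT := [ffun g => a g^-1%g].

Lemma gstarM a b : gstar (a * b) = gstar b * gstar a.
Proof.
apply/ffunP=> g; rewrite ffunE !gmulE (reindex_inj (mulgI g^-1%g)) /=.
by apply: eq_bigr => h _; rewrite !ffunE mulrC !invMg !invgK mulgK.
Qed.

Lemma gstarD a b : gstar (a + b) = gstar a + gstar b.
Proof. by apply/ffunP=> g; rewrite !ffunE. Qed.

Lemma gstarZ c a : gstar (c *: a) = c *: gstar a.
Proof. by apply/ffunP=> g; rewrite !ffunE. Qed.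

Lemma gstar_sum (I : Type) (r : seq I) (P : pred I) (f : I -> galg F gT) :
  gstar (\sum_(i <- r | P i) f i) = \sum_(i <- r | P i) gstar (f i).
Proof.
elim/big_rec2: _ => [|i x y _ <-]; last by rewrite gstarD.
by apply/ffunP=> g; rewrite !ffunE.
Qed.

Lemma gstar_gb g : gstar (gb g) = gb g^-1.
Proof. by apply/ffunP=> h; rewrite !ffunE -(inj_eq invg_inj) invgK. Qed.

Lemma gstarK : involutive gstar.
Proof. by move=> a; apply/ffunP=> g; rewrite !ffunE invgK. Qed.

Lemma gsym_star a : gsym (gstar a) = gstar (gsym a).
Proof.
rewrite gstar_sum; apply: eq_bigr => g _.
by rewrite !gstarM !gstar_gb invgK !mulrA.
Qed.

End GroupAlgebra.

(** In the full-rank factorization [col_base M *m row_base M] of M, the relation forces the reversed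
    product [row_base M *m col_base M] to be the scalar k, and the trace does not see the order. *)
Lemma mxtrace_scaled_idem (F : fieldType) n (M : 'M[F]_n) k :
  M *m M = k *: M -> \tr M = k * (\rank M)%:R.
Proof.
move=> MM; have idk : row_base M *m col_base M = k%:M.
  apply: (row_full_inj (col_base_full M)); apply: (row_free_inj (row_base_free M)).
  rewrite /= [col_base M *m _]mulmxA mulmx_base -mulmxA mulmx_base MM.
  by rewrite mul_mx_scalar -scalemxAl mulmx_base.
by rewrite -[in LHS](mulmx_base M) mxtrace_mulC idk mxtrace_scalar mulr_natr.
Qed.

(* The scalar is the trace of the idempotent endomorphism v |-> a * v * b. *)
Lemma gtrace_idem_rank (F : numFieldType) (gT : finGroupType) (a b : galg F gT) :
  a * a = a -> b * b = b ->
  exists2 m : nat, (gsym a * b) 1%g = m%:R & m = 0%N -> forall g, a * gb F g * b = 0.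
Proof.
move=> aa bb; pose ev : 'I_#|gT| -> gT := enum_val.
have big_ev (V : nmodType) (f : gT -> V) : \sum_i f (ev i) = \sum_g f g.
  by rewrite [RHS](reindex ev) //; apply: onW_bij; apply: enum_val_bij.
pose M : 'M[F]_#|gT| := \matrix_(i, j) (a * gb F (ev i) * b) (ev j).
have MM : M *m M = 1 *: M.
  rewrite scale1r; apply/matrixP=> i k; rewrite !mxE.
  pose f c := (a * c * b) (ev k).
  transitivity (f (a * gb F (ev i) * b)).
    rewrite /f [in RHS](galgE (a * gb F (ev i) * b)) mulr_sumr mulr_suml galg_sumE -big_ev.
    by apply: eq_bigr => j _; rewrite !mxE -scalerAr -scalerAl galgZE.
  by rewrite /f !mulrA aa -!mulrA bb !mulrA.
exists (\rank M).
  rewrite -[RHS]mul1r -(mxtrace_scaled_idem MM) /mxtrace gtrace_gsym -big_ev.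
  by apply: eq_bigr => i _; rewrite mxE -!mulrA gbMl invgK mulg1.
move/eqP; rewrite mxrank_eq0 => /eqP M0 g; apply/ffunP=> h.
have /matrixP/(_ (enum_rank g) (enum_rank h)) := M0.
by rewrite !mxE /ev !enum_rankK => ->; rewrite ffunE.
Qed.

(** * Characters of cyclic right ideals *)

Section CyclicCharacter.
Variables (F : numFieldType) (gT : finGroupType) (e : galg F gT) (k : F).
Hypothesis eek : e * e = k *: e.

Let G := [set: gT]%G.
Let rG := regular_repr F G.
Let ev : 'I_#|G| -> gT := enum_val.
Let v : 'rV[F]_#|G| := \row_j e (ev j).
Let U := cyclic_mx rG v.
(** Left multiplication by e in the basis of group elements: it commutes with the right regular
    action, and its row space is the right ideal generated by e. *)
Let M : 'M[F]_#|G| := \matrix_(i, j) e (ev j * (ev i)^-1)%g.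

Let big_ev (V : nmodType) (f : gT -> V) : \sum_i f (ev i) = \sum_g f g.
Proof.
rewrite [RHS](reindex ev) //; apply: onW_bij.
by apply: (Bijective (g := gring_index G)); [apply: gring_valK | move=> g; apply: gring_indexK; rewrite inE].
Qed.

Let rGE s i j : rG s i j = (ev j == ev i * s)%g%:R.
Proof.
rewrite mxE !mxE /= ; congr (_%:R).
by rewrite -(inj_eq (can_inj (@gring_valK _ G))) gring_indexK // inE.
Qed.

Let vrG s : v *m rG s = \row_j e (ev j * s^-1)%g.
Proof.
apply/rowP=> j; rewrite !mxE; under eq_bigr => i _ do rewrite rGE mxE.
rewrite (big_ev (fun h => e h * (ev j == h * s)%g%:R)).
rewrite (bigD1 (ev j * s^-1)%g) //= big1 => [|h hj]; first by rewrite mulgKV eqxx mulr1 addr0.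
by case: eqP => [E|]; [rewrite E mulgK eqxx in hj | rewrite mulr0].
Qed.

Let MrG s : M *m rG s = \matrix_(i, j) e (ev j * s^-1 * (ev i)^-1)%g.
Proof.
apply/matrixP=> i j; rewrite !mxE; under eq_bigr => l _ do rewrite rGE mxE.
rewrite (big_ev (fun h => e (h * (ev i)^-1)%g * (ev j == h * s)%g%:R)).
rewrite (bigD1 (ev j * s^-1)%g) //= big1 => [|h hj]; first by rewrite mulgKV eqxx mulr1 addr0.
by case: eqP => [E|]; [rewrite E mulgK eqxx in hj | rewrite mulr0].
Qed.

Let rGM s : rG s *m M = M *m rG s.
Proof.
rewrite MrG; apply/matrixP=> i j; rewrite !mxE; under eq_bigr => l _ do rewrite rGE mxE.
rewrite (big_ev (fun h => (h == ev i * s)%g%:R * e (ev j * h^-1)%g)).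
rewrite (bigD1 (ev i * s)%g) //= big1 => [|h hj].
  by rewrite eqxx mul1r addr0 invMg mulgA.
by rewrite (negPf hj) mul0r.
Qed.

Let U_M : (U == M)%MS.
Proof.
apply/andP; split.
  apply: cyclic_mx_sub.
    by apply/mxmoduleP=> s _; rewrite -rGM submxMl.
  have -> : v = row (gring_index G 1) M.
    by apply/rowP=> j; rewrite !mxE /ev gring_indexK ?inE // invg1 mulg1.
  exact: row_sub.
apply/row_subP=> i; have -> : row i M = v *m rG (ev i) by rewrite vrG; apply/rowP=> j; rewrite !mxE.
by apply: mxmodule_trans; rewrite ?cyclic_mx_module ?cyclic_mx_id ?inE.
Qed.

Let MM : M *m M = k *: M.
Proof.
apply/matrixP=> i l; rewrite !mxE; under eq_bigr => j _ do rewrite !mxE.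
rewrite (big_ev (fun h => e (h * (ev i)^-1)%g * e (ev l * h^-1)%g)).
have /ffunP/(_ (ev l * (ev i)^-1)%g) := eek; rewrite galgZE => <-.
rewrite gmulE [LHS](reindex_inj (mulIg (ev l))) [LHS](reindex_inj invg_inj) /=.
by apply: eq_bigr => h _; rewrite invMg invgK mulKVg mulrC mulgA.
Qed.

Lemma rank_cyclic_mx : k * (\rank U)%:R = #|gT|%:R * e 1%g.
Proof.
rewrite (eqmx_rank U_M) -(mxtrace_scaled_idem MM) /mxtrace.
rewrite (eq_bigr (fun=> e 1%g)) => [|i _]; last by rewrite mxE mulgV.
by rewrite sumr_const card_ord cardsT mulr_natl.
Qed.

(** M is a coordinate map X onto U followed by the inclusion V of U. In the other order V X = k,
    because M acts as k on its own row space; hence k times the trace on U is the trace of M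
    followed by s. The inverse of s comes from the action on the right. *)
Lemma trace_cyclic_mx s :
  k * \tr (submod_repr (cyclic_mx_module rG v) s) = gsym e s^-1%g.
Proof.
have sMU : (M <= U)%MS by case/andP: U_M.
have sUM : (U <= M)%MS by case/andP: U_M.
set W := submod_repr _ s; pose X := in_submod U M; pose V := val_submod (1%:M : 'M_(\rank U)).
have XV : X *m V = M by rewrite -val_submodE in_submodK.
have VX : V *m X = k%:M.
  rewrite /X in_submodE mulmxA -in_submodE.
  have /submxP[D VD] : (V <= M)%MS by apply: submx_trans (val_submodP _) sUM.
  by rewrite VD -mulmxA MM -scalemxAr -VD linearZ /= val_submodK scalemx1.
have VrG : V *m rG s = W *m V.
  by rewrite -val_submodE -[W]mul1mx val_submodJ ?inE.
transitivity (\tr (M *m rG s)).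
  clearbody X V W; rewrite -XV -mulmxA mxtrace_mulC VrG -mulmxA VX mul_mx_scalar.
  by rewrite linearZ.
rewrite MrG gsymE /mxtrace -big_ev; apply: eq_bigr => i _.
by rewrite mxE.
Qed.

End CyclicCharacter.

(** * Jucys-Murphy elements *)

Section Fixing.
Variables (F : fieldType) (T : finType) (D : pred T).
Notation A := (galg F {perm T}).
Implicit Types a b : A.

Definition fixes (g : {perm T}) := [forall x, D x ==> (g x == x)].

Lemma fixesP (g : {perm T}) : reflect (forall x, D x -> g x = x) (fixes g).
Proof.
by apply: (iffP forallP) => [H x Dx|H x]; [apply/eqP/(implyP (H x)) | apply/implyP => /H->].
Qed.

Definition gfix a := forall g, a g != 0 -> fixes g.

Lemma gfix_gb g : fixes g -> gfix (gb F g).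
Proof. by move=> fg h; rewrite ffunE; case: (eqVneq h g) => [->|_] //; rewrite eqxx. Qed.

Lemma gfix1 : gfix 1.
Proof. by rewrite -gb1; apply/gfix_gb/fixesP => x _; rewrite perm1. Qed.

Lemma gfix0 : gfix 0.
Proof. by move=> g; rewrite galg0E eqxx. Qed.

Lemma gfixD a b : gfix a -> gfix b -> gfix (a + b).
Proof.
move=> Da Db g; rewrite galgDE; case: (eqVneq (a g) 0) => [->|/Da //].
by rewrite add0r => /Db.
Qed.

Lemma gfixZ c a : gfix a -> gfix (c *: a).
Proof. by move=> Da g; rewrite galgZE mulf_eq0 negb_or => /andP[_ /Da]. Qed.

Lemma gfix_sum (I : Type) (r : seq I) (P : pred I) (f : I -> A) :
  (forall i, P i -> gfix (f i)) -> gfix (\sum_(i <- r | P i) f i).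
Proof. by move=> H; elim/big_ind: _ => //; [apply: gfix0 | apply: gfixD]. Qed.

Lemma gfixM a b : gfix a -> gfix b -> gfix (a * b).
Proof.
move=> Da Db g; rewrite gmulE => nz.
have [h nzh] : exists h, a h * b (h^-1 * g)%g != 0.
  apply/existsP; apply: contraNT nz; rewrite negb_exists => /forallP H.
  by apply/eqP/big1 => h _; apply/eqP; have := H h; rewrite negbK.
move: nzh; rewrite mulf_eq0 negb_or => /andP[/Da/fixesP fh /Db/fixesP fg].
apply/fixesP => x Dx; have := fg x Dx; rewrite permM.
suff -> : h^-1%g x = x by [].
by apply: (@perm_inj _ h); rewrite permKV fh.
Qed.

Lemma gfix_ind (Q : A -> Prop) a :
    (forall b c, Q b -> Q c -> Q (b + c)) ->
    (forall c b, Q b -> Q (c *: b)) -> (forall g, fixes g -> Q (gb F g)) -> Q 0 ->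
  gfix a -> Q a.
Proof.
move=> QD QZ Qg Q0 Da; rewrite [a]galgE; elim/big_ind: _ => // g _.
case: (eqVneq (a g) 0) => [->|/Da/Qg]; last exact: QZ.
by rewrite scale0r.
Qed.

Lemma gfixC a b : gfix a -> (forall g, fixes g -> gb F g * b = b * gb F g) ->
  a * b = b * a.
Proof.
move=> Da bC; apply: (gfix_ind (Q := fun a => a * b = b * a)) Da => // [c d cE dE|c d dE|].
- by rewrite mulrDl mulrDr cE dE.
- by rewrite -scalerAl dE scalerAr.
- by rewrite mul0r mulr0.
Qed.

(** By cyclicity this is the coefficient of the inverse of t in [b * a], whose support fixes x. *)
Lemma gfix_trace0 a b (t : {perm T}) x : D x -> t x != x -> gfix a -> gfix b ->
  (a * gb F t * b) 1%g = 0.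
Proof.
move=> Dx tx Da Db; rewrite -mulrA gtraceC -mulrA.
have Dba := gfixM Db Da; set c := b * a in Dba *.
rewrite gbMl mulg1; apply/eqP; apply: contraTT tx => /Dba/fixesP/(_ x Dx) tx.
by rewrite negbK -[X in _ == X](permKV t) tx.
Qed.

End Fixing.

Lemma eq_gfix (F : fieldType) (T : finType) (D D' : pred T) (a : galg F {perm T}) :
  (forall x, D' x -> D x) -> gfix D a -> gfix D' a.
Proof. by move=> sub Da g /Da/fixesP H; apply/fixesP => x /sub/H. Qed.

Section JucysMurphy.
Variables (F : fieldType) (T : finType).
Notation A := (galg F {perm T}).
Notation gb := (gb F).

Definition jm (x : T) (s : seq T) : A := \sum_(d <- s) gb (tperm d x).

(** The list is read from its end: its head is the last point added, so that the Jucys-Murphy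
    element of x runs over the rest of s and over [base]. *)
Fixpoint jmprod (z : F) (base s : seq T) : A :=
  if s is x :: s' then jmprod z base s' * (z%:A + jm x (s' ++ base)) else 1.

Lemma gb_tpermC (t : {perm T}) x y : gb (tperm x y) * gb t = gb t * gb (tperm (t x) (t y)).
Proof. by rewrite -!gbM conjgC tpermJ. Qed.

Lemma tperm_conj3 (x y d : T) : d != x -> d != y -> x != y ->
  (tperm d x * tperm d y = tperm d y * tperm x y)%g.
Proof.
move=> dx dy xy; rewrite conjgC tpermJ tpermL [tperm d y x]tpermD 1?[tperm y x]tpermC //.
by rewrite eq_sym.
Qed.

Lemma jm_conj (g : {perm T}) x s : gb g * jm (g x) (map g s) = jm x s * gb g.
Proof.
rewrite /jm big_map mulr_sumr mulr_suml; apply: eq_bigr => d _.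
by rewrite gb_tpermC.
Qed.

Lemma jm_perm x s s' : perm_eq s s' -> jm x s = jm x s'.
Proof. exact: perm_big. Qed.

Lemma jm_cons x y s : jm x (y :: s) = gb (tperm y x) + jm x s.
Proof. exact: big_cons. Qed.

(** This exchange of neighbours makes the product of the z + J_x independent of the order of the
    points, which is what its centrality rests on. *)
Lemma jm_swap z x y s : uniq s -> x \notin s -> y \notin s -> x != y ->
  (z%:A + jm x s) * (z%:A + jm y (x :: s)) = (z%:A + jm y s) * (z%:A + jm x (y :: s)).
Proof.
move=> us xs ys xy; rewrite !jm_cons (tpermC y x); set t := gb (tperm x y).
(* The two elements relative to s do not commute; the terms with (x y) compensate. For each d, (d
   x)(d y) = (d y)(x y) and (d y)(d x) = (d x)(x y), while (d x) and (c y) commute for c distinct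
   from d. *)
have H : jm x s * t + jm x s * jm y s = jm y s * t + jm y s * jm x s.
  rewrite [jm y s * jm x s]mulr_sumr (eq_bigr (fun d =>
    \sum_(c <- s) gb (tperm c y) * gb (tperm d x))) => [|d _]; last by rewrite mulr_suml.
  rewrite !mulr_suml -!big_split; apply: eq_big_seq => d ds /=.
  have dx : d != x by apply: contraNneq xs => <-.
  have dy : d != y by apply: contraNneq ys => <-.
  rewrite mulr_sumr !(bigD1_seq d) //= -!gbM (tperm_conj3 dx dy xy).
  rewrite (tperm_conj3 dy dx) 1?eq_sym // (tpermC y x) !addrA; congr (_ + _).
    exact: addrC.
  rewrite big_seq_cond [RHS]big_seq_cond; apply: eq_bigr => c /andP[cs cd].
  rewrite -!gbM conjgC tpermJ ![tperm c y _]tpermD // 1?eq_sym //.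
  by apply: contraNneq xs => ->.
rewrite !(mulrDl, mulrDr) !mulr_algr !mulr_algl -!addrA; congr (_ + (_ + _)).
by rewrite !addrA -!addrA H addrCA.
Qed.

Lemma jmprod_swap z base s x y : uniq (x :: y :: s ++ base) ->
  jmprod z base (x :: y :: s) = jmprod z base (y :: x :: s).
Proof.
rewrite /= !inE !negb_or -!andbA => /and4P[xy xs ys us]; rewrite -!mulrA.
by rewrite jm_swap // eq_sym.
Qed.

Lemma jmprod_perm z base s s' : uniq (s ++ base) -> perm_eq s s' ->
  jmprod z base s = jmprod z base s'.
Proof.
have pull x s1 s2 : uniq (s1 ++ x :: s2 ++ base) ->
    jmprod z base (s1 ++ x :: s2) = jmprod z base (x :: s1 ++ s2).
  elim: s1 => [|y s1 IH] // /andP[ys us].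
  have e : perm_eq (s1 ++ x :: s2) (x :: s1 ++ s2).
    exact/permEl/(perm_catCA s1 [:: x] s2).
  rewrite -[LHS]/(jmprod z base (s1 ++ x :: s2) * (z%:A + jm y ((s1 ++ x :: s2) ++ base))).
  have e' : perm_eq ((s1 ++ x :: s2) ++ base) ((x :: s1 ++ s2) ++ base).
    by rewrite perm_cat2r.
  rewrite IH // (jm_perm _ e') -[LHS]/(jmprod z base (y :: x :: s1 ++ s2)) jmprod_swap //.
  have us' : uniq ((x :: s1 ++ s2) ++ base).
    by rewrite -(perm_uniq e') -catA; exact: us.
  have ys' : y \notin (x :: s1 ++ s2) ++ base.
    by rewrite -(perm_mem e') -catA; exact: ys.
  by apply/andP; split.
elim: s s' => [|x s IH] s' us ss'; first by move: ss'; rewrite perm_sym => /perm_nilP ->.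
have : x \in s' by rewrite -(perm_mem ss') mem_head.
move/path.splitPr=> E; case: E ss' => s1 s2 ss'.
have e : perm_eq s (s1 ++ s2).
  rewrite -(perm_cons x) (perm_trans ss') //.
  exact/permEl/(perm_catCA s1 [:: x] s2).
rewrite pull.
  rewrite /= -(IH (s1 ++ s2)) //; last by case/andP: us.
  by congr (_ * (_ + _)); apply: jm_perm; rewrite perm_cat2r.
have := us; rewrite (perm_uniq (s2 := (s1 ++ x :: s2) ++ base)) ?perm_cat2r //.
by rewrite -catA.
Qed.

Lemma jmprod_cat z s s' :
  jmprod z [::] (s ++ s') = jmprod z [::] s' * jmprod z s' s.
Proof.
by elim: s => /= [|x s ->]; rewrite ?mulr1 // cats0 mulrA.
Qed.

End JucysMurphy.

Section JMProd.
Variables (F : fieldType) (T : finType).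
Notation A := (galg F {perm T}).
Notation gb := (gb F).
Implicit Types (x y : T) (s base : seq T) (a : A) (D : pred T) (g : {perm T}).

Lemma jmprod_conj (z : F) (g : {perm T}) base s :
  gb g * jmprod z (map g base) (map g s) = jmprod z base s * gb g.
Proof.
elim: s => [|x s IH] /=; first by rewrite mulr1 mul1r.
rewrite mulrA IH -!mulrA mulrDr mulrDl -map_cat jm_conj.
by rewrite -scalerAr -scalerAl mul1r mulr1.
Qed.

(** Conjugation by g only relabels the list of all points, and the product does not depend on the
    order of that list. *)
Lemma jmprod_central (z : F) (s : seq T) : uniq s -> (forall x, x \in s) -> gcentral (jmprod z [::] s : A).
Proof.
move=> us ins; apply: gcentral_gb => g; rewrite -jmprod_conj; congr (_ * _) => /=.
apply: jmprod_perm; first by rewrite cats0.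
apply: uniq_perm => //; first by rewrite map_inj_uniq //; apply: perm_inj.
move=> x; rewrite ins; apply/esym/mapP; exists (g^-1%g x); first exact: ins.
by rewrite permKV.
Qed.

Lemma fixes_map (g : {perm T}) s : uniq s -> fixes [predC s] g -> perm_eq (map g s) s.
Proof.
move=> us /fixesP fg.
apply: uniq_perm => //; first by rewrite map_inj_uniq //; apply: perm_inj.
have sub : {subset map g s <= s}.
  move=> _ /mapP[x xs ->]; apply: contraTT xs => gxs.
  by rewrite -(perm_inj (fg _ gxs)).
by case: (uniq_min_size _ sub _); rewrite ?size_map // map_inj_uniq //; apply: perm_inj.
Qed.

Lemma jm_gfixC x s a : uniq s -> x \notin s -> gfix [predC s] a ->
  a * jm F x s = jm F x s * a.
Proof.
move=> us xs fa; apply: (gfixC fa) => g fg.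
have := jm_conj F g x s; rewrite (fixesP _ _ fg) //.
by rewrite (jm_perm _ _ (fixes_map us fg)).
Qed.

Lemma jm_gfix x s D : (forall y, D y -> y \notin x :: s) -> gfix D (jm F x s).
Proof.
move=> Ds; rewrite /jm big_seq; apply: gfix_sum => d ds; apply/gfix_gb/fixesP => y /Ds.
rewrite inE negb_or => /andP[yx ys]; rewrite tpermD // 1?eq_sym //.
by apply: contraNneq ys => ->.
Qed.

Lemma jmprod_gfix (z : F) (base s : seq T) D : (forall y, D y -> y \notin s ++ base) ->
  gfix D (jmprod z base s).
Proof.
elim: s => [|x s IH] Ds /=; first exact: gfix1.
apply: gfixM; first by apply: IH => y /Ds; rewrite inE negb_or => /andP[].
by apply: gfixD; [apply/gfixZ/gfix1 | apply: jm_gfix].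
Qed.

End JMProd.

(** * Sums over label-preserving permutations *)

Section LabelSum.
Variables (F : fieldType) (T : finType) (eps : bool) (f : T -> nat).
Notation A := (galg F {perm T}).
Notation gb := (gb F).
Implicit Types (s : seq T) (g h : {perm T}).

Definition label_stab s : {set {perm T}} :=
  [set g | fixes [predC s] g && [forall x, f (g x) == f x]].

Definition lsgn g : F := (-1) ^+ (eps && odd_perm g).

(** One definition for three uses: the row symmetrizer, the signed column sum and, with a constant
    label, the sum of all permutations of s. *)
Definition label_sum s : A := \sum_(g in label_stab s) lsgn g *: gb g.

Lemma label_stabP s g :
  reflect ((forall x, x \notin s -> g x = x) /\ (forall x, f (g x) = f x)) (g \in label_stab s).
Proof.
rewrite inE; apply: (iffP andP) => -[H1 H2]; split.
- exact: (fixesP _ _ H1).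
- by move=> x; apply/eqP/(forallP H2).
- exact/fixesP.
- by apply/forallP => x; rewrite H2.
Qed.

Lemma label_stab1 s : 1%g \in label_stab s.
Proof. by apply/label_stabP; split=> x; rewrite perm1. Qed.

Lemma label_stabM s g h : g \in label_stab s -> h \in label_stab s -> (g * h)%g \in label_stab s.
Proof.
move=> /label_stabP[g1 g2] /label_stabP[h1 h2]; apply/label_stabP.
by split=> x; [move=> xs; rewrite permM g1 ?h1 | rewrite permM h2 g2].
Qed.

Lemma label_stabV s g : (g^-1%g \in label_stab s) = (g \in label_stab s).
Proof.
suff H h : h \in label_stab s -> h^-1%g \in label_stab s.
  by apply/idP/idP => /H //; rewrite invgK.
move=> /label_stabP[h1 h2]; apply/label_stabP; split=> [x xs|x].
  by apply: (@perm_inj _ h); rewrite permKV h1.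
by rewrite -h2 permKV.
Qed.

Lemma label_stabMl s g h : g \in label_stab s -> ((g * h)%g \in label_stab s) = (h \in label_stab s).
Proof.
move=> gs; apply/idP/idP; last exact: label_stabM.
by move=> ghs; rewrite -(mulKg g h); apply: label_stabM; rewrite ?label_stabV.
Qed.

Lemma label_stab_tperm s x y : x \in s -> y \in s -> f x = f y -> tperm x y \in label_stab s.
Proof.
move=> xs ys fxy; apply/label_stabP; split=> z.
  by move=> zs; rewrite tpermD //; apply: contraNneq zs => <-.
by case: tpermP => // ->.
Qed.

Lemma lsgnM g h : lsgn (g * h)%g = lsgn g * lsgn h.
Proof. by rewrite /lsgn odd_permM; case: eps => /=; rewrite ?signr_addb ?mulr1. Qed.

Lemma lsgnV g : lsgn g^-1%g = lsgn g.
Proof. by rewrite /lsgn odd_permV. Qed.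

Lemma lsgnK g : lsgn g * lsgn g = 1.
Proof. by rewrite -signr_addb addbb. Qed.

Lemma lsgn_tperm x y : x != y -> lsgn (tperm x y) = (-1) ^+ eps.
Proof. by move=> xy; rewrite /lsgn odd_tperm xy andbT. Qed.

Lemma label_sumE s g : label_sum s g = if g \in label_stab s then lsgn g else 0.
Proof.
rewrite galg_sumE; case: ifP => gs.
  rewrite (bigD1 g) //= big1 => [|h /andP[_ hg]].
    by rewrite galgZE ffunE eqxx mulr1 addr0.
  by rewrite galgZE ffunE eq_sym (negPf hg) mulr0.
rewrite big1 // => h hs; rewrite galgZE ffunE.
by case: eqP => [e|]; [rewrite e hs in gs | rewrite mulr0].
Qed.

Lemma gb_label_sum s g : g \in label_stab s -> gb g * label_sum s = lsgn g *: label_sum s.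
Proof.
move=> gs; rewrite scaler_sumr mulr_sumr [RHS](reindex_inj (mulgI g)) /=.
apply: eq_big => [h|h _]; first by rewrite label_stabMl.
by rewrite -scalerAr -gbM scalerA lsgnM mulrA lsgnK mul1r.
Qed.

Lemma star_label_sum s : gstar (label_sum s) = label_sum s.
Proof. by apply/ffunP=> g; rewrite ffunE !label_sumE label_stabV lsgnV. Qed.

Lemma label_sum_gb s g : g \in label_stab s -> label_sum s * gb g = lsgn g *: label_sum s.
Proof.
move=> gs; rewrite -[LHS]gstarK gstarM star_label_sum gstar_gb gb_label_sum ?label_stabV //.
by rewrite gstarZ star_label_sum lsgnV.
Qed.

Lemma label_sum_gfix s : gfix [predC s] (label_sum s).
Proof. by move=> g; rewrite label_sumE; case: ifP => [|_ /eqP//]; rewrite inE => /andP[]. Qed.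

Lemma label_sum_idem s : label_sum s * label_sum s = #|label_stab s|%:R *: label_sum s.
Proof.
rewrite {1}/label_sum mulr_suml (eq_bigr (fun=> label_sum s)) => [|g gs].
  by rewrite sumr_const scaler_nat.
by rewrite -scalerAl gb_label_sum // scalerA lsgnK scale1r.
Qed.

Lemma label_sum_nil : label_sum [::] = 1.
Proof.
rewrite /label_sum (bigD1 1%g) ?label_stab1 //= big1 => [|g /andP[/label_stabP[gf _] /negP[]]].
  by rewrite /lsgn odd_perm1 andbF scale1r addr0.
by apply/eqP/permP => x; rewrite gf // perm1.
Qed.

(** Coset decomposition by the image of x: a permutation sending x to i is one that fixes x followed
    by the transposition of i and x. *)
Lemma label_sum_cons x s : uniq (x :: s) ->
  label_sum (x :: s) = label_sum s * (1 + (-1) ^+ eps *: \sum_(i <- s | f i == f x) gb (tperm i x)).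
Proof.
move=> /andP[xs us]; rewrite mulrDr mulr1 -scalerAr mulr_sumr scaler_sumr.
rewrite -big_filter big_uniq ?filter_uniq //=.
rewrite {1}/label_sum (partition_big (fun g => g x) (fun i => (i == x) || (i \in s) && (f i == f x))) /=; last first.
  move=> g /label_stabP[gf gl]; rewrite gl eqxx andbT.
  case: (boolP (g x \in x :: s)); first by rewrite inE.
  by move=> gxs; move: (gxs); rewrite inE (perm_inj (gf _ gxs)) eqxx.
rewrite (bigD1 x) ?eqxx //=; congr (_ + _).
  apply: eq_bigl => g; apply/andP/label_stabP => [[/label_stabP[gf gl] /eqP gx]|[gf gl]].
    split=> // y ys; case: (eqVneq y x) => [-> //|yx]; apply: gf.
    by rewrite inE negb_or yx.
  rewrite (gf x xs) eqxx; split=> //; apply/label_stabP; split=> // y.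
  by rewrite inE negb_or => /andP[_ /gf].
apply: eq_big => [i|i /andP[]].
  rewrite mem_filter [RHS]andbC; case: (eqVneq i x) => [->|_] /=; last by rewrite andbT.
  by rewrite (negPf xs).
move=> P ix; have {P} /andP[iS /eqP fi] : (i \in s) && (f i == f x).
  by case/orP: P ix => // ->.
rewrite mulr_suml scaler_sumr (reindex_inj (mulIg (tperm i x))) /=.
have tL : tperm i x \in label_stab (x :: s).
  by apply: label_stab_tperm => //; rewrite inE ?eqxx // iS orbT.
apply: eq_big => [g|g _]; last first.
  by rewrite gbM lsgnM lsgn_tperm // -scalerAl scalerA mulrC.
apply/andP/idP => [[H /eqP]|gs].
  rewrite permM => E; have gx : g x = x by apply: (@perm_inj _ (tperm i x)); rewrite E tpermR.
  have : g \in label_stab (x :: s) by rewrite -(mulgK (tperm i x) g) label_stabM // label_stabV.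
  case/label_stabP => gf gl; apply/label_stabP; split=> // y ys.
  case: (eqVneq y x) => [-> //|yx]; apply: gf; by rewrite inE negb_or yx.
have [gf gl] := label_stabP _ _ gs; rewrite permM (gf x xs) tpermR eqxx; split=> //.
apply: label_stabM => //; apply/label_stabP; split=> // y.
by rewrite inE negb_or => /andP[_ /gf].
Qed.

Lemma label_sum_cons_l x s : uniq (x :: s) ->
  label_sum (x :: s) = (1 + (-1) ^+ eps *: \sum_(i <- s | f i == f x) gb (tperm i x)) * label_sum s.
Proof.
move=> us; rewrite -[LHS]star_label_sum label_sum_cons // gstarM star_label_sum; congr (_ * _).
rewrite gstarD gstarZ gstar_sum -gb1 gstar_gb invg1; congr (_ + _ *: _).
by apply: eq_bigr => i _; rewrite gstar_gb tpermV.
Qed.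

End LabelSum.

(** * Young symmetrizers *)

Lemma eq_label_sum (F : fieldType) (T : finType) eps (f : T -> nat) (s s' : seq T) :
  s =i s' -> label_sum F eps f s = label_sum F eps f s'.
Proof.
move=> ss'; apply/ffunP=> g; rewrite !label_sumE; congr (if _ then _ else _).
by apply/label_stabP/label_stabP => -[H1 H2]; split=> // x; rewrite (ss', =^~ ss') => /H1.
Qed.

(** A filling of a Young diagram by the points of T, one per box, given by the two coordinates; the
    second field says that the occupied boxes form a diagram. *)
Record tableau (T : finType) (row col : T -> nat) : Prop := Tableau {
  tab_inj : forall x y, row x = row y -> col x = col y -> x = y;
  tab_down : forall x i j, (i <= row x)%N -> (j <= col x)%N ->
    exists2 y, row y = i & col y = j }.

Section Tableau.
Variables (T : finType) (row col : T -> nat).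
Hypothesis tab : tableau row col.

Section Factor.
Variable g : {perm T}.
Hypothesis gfree : forall x y, row x = row y -> col (g x) = col (g y) -> x = y.

Let A k j := [set x | (row x < k)%N && (col (g x) == j)].
Let D k j := [set x | (row x < k)%N && (col x == j)].

(** If column j continues below the first k rows, it meets each of these rows, and sending x to the
    box of its row in column j is injective by [gfree]. Otherwise column j lies within the first k
    rows, and g itself maps the first set into the second. *)
Let leAD k j : (#|A k j| <= #|D k j|)%N.
Proof.
case: (boolP [exists y, (col y == j) && (k <= row y)%N]) => [/existsP[y /andP[/eqP cy ky]]|].
  pose b x := odflt x [pick z | (row z == row x) && (col z == j)].
  have bP x : x \in A k j -> row (b x) = row x /\ col (b x) = j.
    rewrite inE => /andP[xk _]; rewrite /b; case: pickP => [z /andP[/eqP-> /eqP->] //|].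
    have [|z rz cz] := tab_down tab (x := y) (i := row x) _ (leqnn (col y)).
      by apply: leq_trans ky; apply: ltnW.
    by move=> /(_ z); rewrite rz cz cy !eqxx.
  rewrite -(card_in_imset (f := b)) => [|x x' xA x'A bb]; last first.
    have [rx _] := bP x xA; have [rx' _] := bP x' x'A.
    move: xA x'A; rewrite !inE => /andP[_ /eqP cx] /andP[_ /eqP cx'].
    by apply: gfree; [rewrite -rx -rx' bb | rewrite cx cx'].
  apply/subset_leq_card/subsetP => _ /imsetP[x xA ->].
  have [rx cx] := bP x xA; rewrite inE rx cx eqxx andbT.
  by move: xA; rewrite inE => /andP[].
move=> /existsPn nex.
rewrite -(card_imset _ (@perm_inj _ g)); apply/subset_leq_card/subsetP => _ /imsetP[x xA ->].
move: xA; rewrite !inE => /andP[_ cx]; rewrite cx andbT ltnNge.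
by have := nex (g x); rewrite cx.
Qed.

(* The pairs (row x, col (g x)) are distinct and have the same row and column
   counts as the diagram, so each column has its largest possible number of
   them among the first k rows: they are the boxes of the diagram. *)
Let eqAD k j : #|A k j| = #|D k j|.
Proof.
pose N := (maxn j (\max_x maxn (col (g x)) (col x))).+1.
have colN x : (col x < N)%N.
  by rewrite ltnS leq_max; apply/orP; right; apply: leq_trans (leq_bigmax x); apply: leq_maxr.
have sum (c : T -> nat) (cN : forall x, (c x < N)%N) :
    (\sum_(i < N) #|[set x | (row x < k) && (c x == i)]| = #|[set x | row x < k]|)%N.
  rewrite -sum1_card (partition_big (fun x => Ordinal (cN x)) xpredT) //=.
  apply: eq_bigr => i _; rewrite -sum1_card; apply: eq_bigl => x.
  by rewrite !inE.
have /leqif_sum : forall i : 'I_N, true -> (#|A k i| <= #|D k i| ?= iff (#|A k i| == #|D k i|))%N.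
  by move=> i _; split.
case=> _; rewrite (sum (fun x => col (g x))) => [|x]; last exact: colN.
rewrite (sum col) // eqxx => /esym/forallP/(_ (@Ordinal N j _))/=.
by rewrite ltnS leq_maxl => /(_ isT)/eqP.
Qed.

(** The factor r moves each x along its row to the column of [g x]. The box it needs exists because,
    by [eqAD], passing from the rows above x to those including x must add a box to that column. *)
Lemma free_factor : exists2 r, r \in label_stab row (enum T) &
  exists2 c, c \in label_stab col (enum T) & g = (r * c)%g.
Proof.
have ex x : exists y, (row y == row x) && (col y == col (g x)).
  set k := row x; set j := col (g x).
  have : A k j \proper A k.+1 j.
    apply/properP; split; first by apply/subsetP => y; rewrite !inE ltnS => /andP[/ltnW yk ->]; rewrite yk.
    by exists x; rewrite !inE ?ltnS ?leqnn ?eqxx // ltnn.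
  move/proper_card; rewrite !eqAD => lt.
  have /subsetPn[y] : ~~ (D k.+1 j \subset D k j).
    by apply: contraL lt => /subset_leq_card; rewrite -leqNgt.
  rewrite !inE ltnS => /andP[yk /eqP cy]; rewrite cy eqxx andbT -leqNgt => ky.
  by exists y; rewrite cy eqxx andbT eqn_leq yk.
pose r0 x := xchoose (ex x).
have r0P x : row (r0 x) = row x /\ col (r0 x) = col (g x).
  by have /andP[/eqP-> /eqP->] := xchooseP (ex x).
have r0I : injective r0.
  move=> x y e; have [rx cx] := r0P x; have [ry cy] := r0P y.
  by apply: gfree; [rewrite -rx -ry e | rewrite -cx -cy e].
pose r := perm r0I; exists r.
  by apply/label_stabP; split=> x; rewrite ?mem_enum // permE; case: (r0P x).
exists (r^-1 * g)%g; last by rewrite mulKVg.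
apply/label_stabP; split=> x; rewrite ?mem_enum // permM.
have [_ cx] := r0P (r^-1 x)%g; rewrite -cx.
by have -> : r0 (r^-1 x)%g = x by rewrite -(permE r0I) -/r permKV.
Qed.

End Factor.

Variable F : numFieldType.
Notation A := (galg F {perm T}).
Notation gb := (gb F).
Notation R := (label_sum F false row).
Notation C := (label_sum F true col).

Definition ysym : A := R (enum T) * C (enum T).

Lemma lsgn_false (g : {perm T}) : lsgn F false g = 1.
Proof. by []. Qed.

Lemma ysym1 : ysym 1%g = 1.
Proof.
rewrite gmulE (bigD1 1%g) //= big1 => [|g g1].
  by rewrite !label_sumE invg1 mulg1 !label_stab1 /lsgn odd_perm1 addr0 mulr1.
rewrite !label_sumE mulg1 label_stabV; case: ifP => [/label_stabP[_ gr]|_]; last by rewrite mul0r.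
case: ifP => [/label_stabP[_ gc]|_]; last by rewrite mulr0.
by case/eqP: g1; apply/permP => x; rewrite perm1; apply: (tab_inj tab).
Qed.

Definition rc_inv (a : A) :=
  (forall r, r \in label_stab row (enum T) -> gb r * a = a) /\
  (forall c, c \in label_stab col (enum T) -> a * gb c = lsgn F true c *: a).

Lemma ysym_rc_inv : rc_inv ysym.
Proof.
split=> g gs; rewrite /ysym.
  by rewrite mulrA gb_label_sum // lsgn_false scale1r.
by rewrite -mulrA label_sum_gb // scalerAr.
Qed.

(** The classical alternative for Young symmetrizers. If g brings two points of one row into one
    column, a transposition is absorbed on the left with sign + and on the right with sign -, and
    the coefficient vanishes; otherwise g = r c and the coefficient is that of 1 up to the sign of
    c. The scalar depends on g alone, which allows the comparison of a with [ysym]. *)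
Lemma rc_inv_coef g : exists x : F, forall a, rc_inv a -> a g = x * a 1%g.
Proof.
case: (boolP [exists x, exists y, [&& x != y, row x == row y & col (g x) == col (g y)]]).
  case/existsP=> x /existsP[y /and3P[xy /eqP rxy /eqP cxy]].
  exists 0 => a [aR aC]; rewrite mul0r; set t := tperm x y; set t' := tperm (g x) (g y).
  have tR : t \in label_stab row (enum T) by apply: label_stab_tperm; rewrite ?mem_enum.
  have t'C : t' \in label_stab col (enum T) by apply: label_stab_tperm; rewrite ?mem_enum.
  have E : a g = - a g.
    have := gbMl t a g; rewrite aR // tpermV conjgC tpermJ -/t' => {1}->.
    have := gbMr t' a g; rewrite aC // tpermV => <-.
    by rewrite galgZE lsgn_tperm ?mulN1r // (inj_eq perm_inj).
  by apply/eqP; rewrite -[_ == 0](mulrn_eq0 _ 2) mulr2n {1}E addNr.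
move=> nex; case: (@free_factor g) => [x y rxy cxy|r rR [c cC ->]].
  apply/eqP; apply: contraNT nex => xy; apply/existsP; exists x; apply/existsP; exists y.
  by rewrite xy rxy cxy !eqxx.
exists (lsgn F true c) => a [aR aC].
have := gbMl r^-1%g a c; rewrite aR ?label_stabV // invgK => <-.
have := gbMr c^-1%g a 1%g; rewrite mul1g invgK => <-.
by rewrite aC ?label_stabV // galgZE lsgnV.
Qed.

Lemma rc_inv_ysym a : rc_inv a -> a = a 1%g *: ysym.
Proof.
move=> aI; apply/ffunP=> g; have [x xP] := rc_inv_coef g.
by rewrite galgZE (xP _ aI) (xP _ ysym_rc_inv) ysym1 mulr1 mulrC.
Qed.

Lemma ysym_sandwich a : ysym * a * ysym = (ysym * a * ysym) 1%g *: ysym.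
Proof.
apply: rc_inv_ysym; have := ysym_rc_inv; move: ysym => e [lR rC]; split=> g gs.
  by rewrite !mulrA lR.
by rewrite -!mulrA rC // -!scalerAr.
Qed.

Lemma ysym_central z : gcentral z -> ysym * z = (ysym * z) 1%g *: ysym.
Proof.
move=> zC; apply: rc_inv_ysym; have := ysym_rc_inv; move: ysym => e [lR rC]; split=> g gs.
  by rewrite mulrA lR.
by rewrite -mulrA -zC mulrA rC // -scalerAl.
Qed.

Definition down_closed (s : seq T) := forall z y, z \in s ->
  (row y <= row z)%N -> (col y <= col z)%N -> y \in s.

Section Corner.
Variables (x : T) (s : seq T).
Hypotheses (us : uniq (x :: s)) (down : down_closed (x :: s)).
Hypothesis corner : forall y, y \in s -> ~~ ((row x <= row y) && (col x <= col y))%N.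

Let xs : x \notin s. Proof. by case/andP: us. Qed.

Let row_lt j : j \in s -> col j = col x -> (row j < row x)%N.
Proof. by move=> /corner H cj; rewrite ltnNge; move: H; rewrite cj leqnn andbT. Qed.

Let col_lt i : i \in s -> row i = row x -> (col i < col x)%N.
Proof. by move=> /corner H ri; rewrite ltnNge; move: H; rewrite ri leqnn. Qed.

Let neq_ij i j : i \in s -> row i = row x -> col j = col x -> i != j.
Proof. by move=> /col_lt H /H ci cj; apply: contraTneq ci => ->; rewrite cj ltnn. Qed.

(* The box w in the row of j and the column of i gives transpositions (j w) and
   (i w), absorbed with opposite signs by the two symmetrizers and exchanged by
   conjugation by (i j). *)
Let garnir i j : i \in s -> j \in s -> row i = row x -> col j = col x ->
  R s * gb (tperm i j) * C s = 0.
Proof.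
move=> iS jS ri cj; have rj := row_lt jS cj; have ci := col_lt iS ri.
have [w rw cw] := tab_down tab (x := x) (ltnW rj) (ltnW ci).
have wS : w \in s.
  have : w \in x :: s by apply: (down (mem_head x s)); rewrite ?rw ?cw ltnW.
  by rewrite inE => /orP[/eqP wx|//]; move: rj; rewrite -rw wx ltnn.
have iw : i != w by apply: contraTneq rj => iw; rewrite -rw -iw ri ltnn.
have jw : j != w by apply: contraTneq ci => jw; rewrite -cw -jw cj ltnn.
have E : R s * gb (tperm i j) * C s = - (R s * gb (tperm i j) * C s).
  have jwR := label_sum_gb F false (label_stab_tperm jS wS (esym rw)).
  rewrite lsgn_false scale1r in jwR.
  have iwC := gb_label_sum F true (label_stab_tperm iS wS (esym cw)).
  rewrite lsgn_tperm // scaleN1r in iwC.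
  rewrite -{1}jwR -[R s * _ * _]mulrA -gbM conjgC tpermJ tpermR tpermD //.
  by rewrite gbM mulrA -mulrA iwC mulrN.
apply/ffunP=> g; apply/eqP; move/ffunP/(_ g)/eqP: E.
by rewrite galgNE eq_sym eqNr galg0E.
Qed.

Let size_row : size [seq i <- s | row i == row x] = col x.
Proof.
rewrite -(size_map col) -(size_iota 0 (col x)); apply: perm_size; apply: uniq_perm.
- rewrite map_inj_in_uniq ?filter_uniq //; first by case/andP: us.
  move=> i j; rewrite !mem_filter => /andP[/eqP ri _] /andP[/eqP rj _].
  by apply: (tab_inj tab); rewrite ri rj.
- exact: iota_uniq.
move=> c; rewrite mem_iota add0n /=; apply/mapP/idP => [[j]|cx].
  by rewrite mem_filter => /andP[/eqP ri iS] ->; apply: col_lt.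
have [y ry cy] := tab_down tab (x := x) (leqnn _) (ltnW cx).
exists y => //; rewrite mem_filter ry eqxx /=.
have : y \in x :: s by apply: (down (mem_head x s)); rewrite ?ry ?cy // ltnW.
by rewrite inE => /orP[/eqP yx|//]; move: cx; rewrite -cy yx ltnn.
Qed.

Let size_col : size [seq i <- s | col i == col x] = row x.
Proof.
rewrite -(size_map row) -(size_iota 0 (row x)); apply: perm_size; apply: uniq_perm.
- rewrite map_inj_in_uniq ?filter_uniq //; first by case/andP: us.
  move=> i j; rewrite !mem_filter => /andP[/eqP ri _] /andP[/eqP rj _] e.
  by apply: (tab_inj tab); rewrite ?ri ?rj.
- exact: iota_uniq.
move=> c; rewrite mem_iota add0n /=; apply/mapP/idP => [[j]|cx].
  by rewrite mem_filter => /andP[/eqP ri iS] ->; apply: row_lt.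
have [y ry cy] := tab_down tab (x := x) (ltnW cx) (leqnn _).
exists y => //; rewrite mem_filter cy eqxx /=.
have : y \in x :: s by apply: (down (mem_head x s)); rewrite ?ry ?cy // ltnW.
by rewrite inE => /orP[/eqP yx|//]; move: cx; rewrite -ry yx ltnn.
Qed.

(** All factors that involve the corner x are collected in w. What surrounds w fixes x, so only the
    permutations in w that fix x contribute. *)
Let phi z (w : A) : F := (R s * w * (C s * jmprod z [::] s)) 1%g.

Let phiD z v w : phi z (v + w) = phi z v + phi z w.
Proof. by rewrite /phi mulrDr mulrDl galgDE. Qed.

Let phiZ z c w : phi z (c *: w) = c * phi z w.
Proof. by rewrite /phi -scalerAr -scalerAl galgZE. Qed.

Let phi_sum z (I : Type) (r : seq I) (P : pred I) (f : I -> A) :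
  phi z (\sum_(i <- r | P i) f i) = \sum_(i <- r | P i) phi z (f i).
Proof. by rewrite /phi mulr_sumr mulr_suml galg_sumE. Qed.

Let phi0 z (t : {perm T}) : t x != x -> phi z (gb t) = 0.
Proof.
move=> tx; apply: (gfix_trace0 (D := [predC s]) (x := x)) => //; first exact: label_sum_gfix.
by apply: gfixM; [apply: label_sum_gfix | apply: jmprod_gfix => y; rewrite cats0].
Qed.

Let phi2 z i d : i \in s -> d \in s ->
  phi z (gb (tperm i x) * gb (tperm d x)) = (i == d)%:R * phi z 1.
Proof.
move=> iS dS; case: eqVneq => [->|id]; first by rewrite -gbM tperm2 mul1r.
have ix : i != x by apply: contraNneq xs => <-.
have dx : d != x by apply: contraNneq xs => <-.
rewrite mul0r -gbM phi0 // permM tpermR tpermD //; first by rewrite eq_sym.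
by rewrite eq_sym.
Qed.

Let phi_sum2 z (P : pred T) : phi z ((\sum_(i <- s | P i) gb (tperm i x)) * jm F x s) =
  (size [seq i <- s | P i])%:R * phi z 1.
Proof.
rewrite mulr_suml phi_sum -sum1_size natr_sum mulr_suml big_filter.
rewrite big_seq_cond [RHS]big_seq_cond; apply: eq_bigr => i /andP[iS _].
rewrite mul1r mulr_sumr phi_sum (bigD1_seq i) //=; last by case/andP: us.
rewrite phi2 // eqxx mul1r big_seq_cond big1 ?addr0 // => d /andP[dS di].
by rewrite phi2 // eq_sym (negPf di) mul0r.
Qed.

(* Among the products of the transpositions through x brought by the three
   factors, only the identity and those reduced to (i j) fix x; the former give
   z, the col x row pairs and the row x column pairs, the latter vanish. *)
Lemma ysum_jm_corner z :
  (R (x :: s) * C (x :: s) * jmprod z [::] (x :: s)) 1%g =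
  (z + (col x)%:R - (row x)%:R) * (R s * C s * jmprod z [::] s) 1%g.
Proof.
rewrite label_sum_cons // label_sum_cons_l // expr0 expr1 scale1r scaleN1r /= cats0.
set a := \sum_(i <- s | row i == row x) _; set b := \sum_(i <- s | col i == col x) _.
have JY : C s * (jmprod z [::] s * (z%:A + jm F x s)) = (z%:A + jm F x s) * (C s * jmprod z [::] s).
  rewrite mulrA mulrDr mulrDl -scalerAr -scalerAl mulr1 mul1r; congr (_ + _).
  apply: jm_gfixC => //; first by case/andP: us.
  by apply: gfixM; [apply: label_sum_gfix | apply: jmprod_gfix => y; rewrite cats0].
have -> : R s * (1 + a) * ((1 - b) * C s) * (jmprod z [::] s * (z%:A + jm F x s)) =
    R s * ((1 + a) * (1 - b) * (z%:A + jm F x s)) * (C s * jmprod z [::] s).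
  by rewrite -!mulrA JY.
have phi1 : (R s * C s * jmprod z [::] s) 1%g = phi z 1 by rewrite /phi mulr1 mulrA.
rewrite phi1 -/(phi z _).
have tx i : i \in s -> tperm i x x != x.
  by move=> iS; rewrite tpermR; apply: contraNneq xs => <-.
have sum0 (P : pred T) : phi z (\sum_(i <- s | P i) gb (tperm i x)) = 0.
  by rewrite phi_sum big_seq_cond big1 // => i /andP[iS _]; rewrite phi0 ?tx.
have ab0 : phi z (a * b) = 0.
  rewrite mulr_suml phi_sum big_seq_cond big1 // => i /andP[iS /eqP ri].
  rewrite mulr_sumr phi_sum big_seq_cond big1 // => j /andP[jS /eqP cj].
  by rewrite phi2 // (negPf (neq_ij iS ri cj)) mul0r.
have abJ0 : phi z (a * b * jm F x s) = 0.
  rewrite -mulrA mulr_suml phi_sum big_seq_cond big1 // => i /andP[iS /eqP ri].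
  rewrite mulrA [gb _ * b]mulr_sumr mulr_suml phi_sum big_seq_cond big1 // => j /andP[jS /eqP cj].
  rewrite mulr_sumr phi_sum big_seq_cond big1 // => d /andP[dS _].
  have ix : i != x by apply: contraNneq xs => <-.
  have jx : j != x by apply: contraNneq xs => <-.
  have ij := neq_ij iS ri cj.
  case: (eqVneq d i) => [->|di]; last first.
    rewrite -!gbM phi0 // !permM tpermR [tperm j x i]tpermD 1?eq_sym // tpermD 1?eq_sym //.
    by rewrite eq_sym.
  rewrite -!gbM; have -> : (tperm i x * tperm j x * tperm i x = tperm i j)%g.
    rewrite -{1}(tpermV i x) -mulgA -/(conjg _ _) tpermJ tpermR tpermD //; first by rewrite tpermC.
    by rewrite eq_sym.
  by rewrite /phi mulrA garnir // mul0r galg0E.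
have aJ : phi z (a * jm F x s) = (col x)%:R * phi z 1 by rewrite phi_sum2 size_row.
have bJ : phi z (b * jm F x s) = (row x)%:R * phi z 1 by rewrite phi_sum2 size_col.
have a0 : phi z a = 0 by apply: sum0.
have b0 : phi z b = 0 by apply: sum0.
have J0 : phi z (jm F x s) = 0 by apply: (sum0 xpredT).
have phiN w : phi z (- w) = - phi z w by rewrite -scaleN1r phiZ mulN1r.
rewrite mulrDr mulr_algr phiD phiZ.
rewrite !(mulrDl, mulrDr) !mul1r !mulr1 !mulrN !mulNr !phiD !phiN.
rewrite ab0 abJ0 aJ bJ a0 b0 J0; clear; ring.
Qed.

End Corner.

Lemma ysum_jm z s : uniq s -> down_closed s ->
  (R s * C s * jmprod z [::] s) 1%g = \prod_(x <- s) (z + (col x)%:R - (row x)%:R).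
Proof.
have [n] := ubnP (size s); elim: n s => // n IH [|x0 s0]; set s := (X in size X) => sn us down.
  by rewrite !label_sum_nil !mulr1 big_nil -gb1 ffunE eqxx.
(* A box with row + col maximal has no other box weakly below and to the right of it, so it is a
   corner and its removal leaves a diagram. *)
have [x xs xmax] : exists2 x, x \in s & forall y, y \in s -> (row y + col y <= row x + col x)%N.
  by case: (arg_maxnP (P := mem s) (fun y => row y + col y)%N (mem_head x0 s0)) => x; exists x.
have sE := perm_to_rem xs; set s' := rem x s in sE *.
have mE := perm_mem sE; have us' : uniq (x :: s') by rewrite -(perm_uniq sE).
rewrite (eq_label_sum _ _ _ mE) (eq_label_sum _ _ _ mE) (jmprod_perm z _ sE) ?cats0 //.
rewrite (perm_big _ sE) big_cons /=.
have corner y : y \in s' -> ~~ ((row x <= row y) && (col x <= col y))%N.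
  move=> ys'; apply/negP => /andP[ry cy].
  have /xmax le : y \in s by rewrite mE inE ys' orbT.
  have xy : x = y by apply: (tab_inj tab); lia.
  by case/andP: us'; rewrite xy ys'.
rewrite ysum_jm_corner // ?IH //.
- by move: sn; rewrite (perm_size sE).
- by case/andP: us'.
- move=> y w ys' rw cw; have : w \in s by apply: (down y); rewrite ?mE ?inE ?ys' ?orbT.
  rewrite mE inE => /orP[/eqP wx|//].
  by have := corner y ys'; rewrite -wx rw cw.
- by move=> y w; rewrite -!mE; apply: down.
Qed.

Lemma ysym_jmprod z :
  ysym * jmprod z [::] (enum T) = \prod_x (z + (col x)%:R - (row x)%:R) *: ysym.
Proof.
rewrite ysym_central; last by apply: jmprod_central; rewrite ?enum_uniq // => x; rewrite mem_enum.
rewrite ysum_jm ?enum_uniq //; last by move=> x y _ _ _; rewrite mem_enum.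
by rewrite big_enum.
Qed.

End Tableau.

(** * Scaled primitive idempotents and their characters *)

Section Primitive.
Variables (F : numFieldType) (gT : finGroupType) (e : galg F gT).
Notation A := (galg F gT).
Implicit Types a z : A.

(** An abstract Young symmetrizer: a multiple of a primitive idempotent, normalized at 1 so that the
    factor of any multiple of e can be read off as its coefficient at 1. *)
Definition primitive_symm := e 1%g = 1 /\ forall a, e * a * e = (e * a * e) 1%g *: e.

Definition symm_scale : F := (e * e) 1%g.
Definition symm_dim : nat :=
  \rank (cyclic_mx (regular_repr F [set: gT]%G) (\row_j e (enum_val j))).
(* The character of the right ideal generated by e, read at inverses. *)
Definition symm_char : A := symm_scale^-1 *: gsym e.

Hypothesis eP : primitive_symm.

Lemma prim_idem : e * e = symm_scale *: e.
Proof. by have := eP.2 1; rewrite mulr1. Qed.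

Lemma symm_scale_dim : symm_scale * symm_dim%:R = #|gT|%:R.
Proof. by rewrite (rank_cyclic_mx prim_idem) eP.1 mulr1. Qed.

Let cardG0 : #|gT|%:R != 0 :> F.
Proof. by rewrite pnatr_eq0 -lt0n; apply/card_gt0P; exists 1%g. Qed.

Lemma symm_scale_neq0 : symm_scale != 0.
Proof. by apply: contraNneq cardG0 => k0; rewrite -symm_scale_dim k0 mul0r. Qed.

Lemma symm_dim_gt0 : (0 < symm_dim)%N.
Proof. by rewrite lt0n; apply: contraNneq cardG0 => k0; rewrite -symm_scale_dim k0 mulr0. Qed.

Lemma symm_scale_gt0 : 0 < symm_scale.
Proof.
have : 0 < symm_scale * symm_dim%:R by rewrite symm_scale_dim ltr0n; apply/card_gt0P; exists 1%g.
by rewrite pmulr_lgt0 // ltr0n symm_dim_gt0.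
Qed.

Lemma symm_charE s : \tr (submod_repr (cyclic_mx_module (regular_repr F [set: gT]%G)
   (\row_j e (enum_val j))) s) = symm_char s^-1%g.
Proof.
apply: (mulfI symm_scale_neq0); rewrite (trace_cyclic_mx prim_idem) galgZE mulrA.
by rewrite mulfV ?mul1r ?symm_scale_neq0.
Qed.

Lemma symm_char1 : symm_char 1%g = symm_dim%:R.
Proof.
by rewrite galgZE gsym1 eP.1 mulr1 -symm_scale_dim mulrA mulVf ?mul1r ?symm_scale_neq0.
Qed.

Lemma symm_char_central : gcentral symm_char.
Proof. by move=> a; rewrite -scalerAl -scalerAr (gsym_central e a). Qed.

Lemma prim_central z : gcentral z -> e * z = (e * z) 1%g *: e.
Proof.
move=> zC; apply: (scalerI symm_scale_neq0).
have E : e * z * e = symm_scale *: (e * z) by rewrite -mulrA -(zC e) mulrA prim_idem -scalerAl.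
by rewrite -E eP.2 E galgZE scalerA.
Qed.

Lemma symm_char_mul_central z : gcentral z -> symm_char * z = (e * z) 1%g *: symm_char.
Proof.
move=> zC; rewrite -scalerAl -gsymMr // prim_central // gsymZ !scalerA.
by rewrite galgZE eP.1 mulr1 mulrC.
Qed.

Lemma symm_char_central_trace z : gcentral z -> (symm_char * z) 1%g = (e * z) 1%g * symm_dim%:R.
Proof. by move=> zC; rewrite symm_char_mul_central // galgZE symm_char1. Qed.

(** The factor sought is the coefficient at 1 of [e * symm_char e]. The sandwich property turns the
    conjugate by g into [symm_scale] times [e g * e g^-1], and these products add up to the
    coefficient at 1 of [e * e], again [symm_scale]. *)
Lemma symm_char_idem : symm_char * symm_char = symm_scale *: symm_char.
Proof.
rewrite symm_char_mul_central; last exact: symm_char_central.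
congr (_ *: _); rewrite -scalerAr galgZE -gtrace_gsymC gtrace_gsym.
have eg g : (e * gb F g) 1%g = e g^-1%g by rewrite gbMr mul1g.
have eVe g : (e * gb F g^-1 * e) 1%g = symm_scale * e g.
  by rewrite gtraceC mulrA prim_idem -scalerAl galgZE eg invgK.
rewrite (eq_bigr (fun g => symm_scale * (e g * e g^-1%g))) => [|g _].
  rewrite -mulr_sumr (eq_bigr (fun g => e g * e (g^-1 * 1)%g)) => [|g _]; last by rewrite mulg1.
  by rewrite -gmulE -/symm_scale mulrA mulVf ?mul1r ?symm_scale_neq0.
by rewrite gtraceC !mulrA eP.2 -scalerAl galgZE eVe eg.
Qed.

Definition symm_idem : A := symm_scale^-1 *: symm_char.

Lemma symm_idem_idem : symm_idem * symm_idem = symm_idem.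
Proof.
rewrite /symm_idem; move: symm_char symm_char_idem => X XX.
by rewrite -scalerAl -scalerAr XX !scalerA mulfVK ?symm_scale_neq0.
Qed.

Lemma symm_idem_central : gcentral symm_idem.
Proof. by move=> a; rewrite -scalerAl -scalerAr symm_char_central. Qed.

End Primitive.

(** Inserting z between the two characters multiplies their product by two different scalars,
    according to the factor that absorbs z. *)
Lemma symm_char_orth (F : numFieldType) (gT : finGroupType) (e e' z : galg F gT) :
  primitive_symm e -> primitive_symm e' -> gcentral z ->
  (e * z) 1%g != (e' * z) 1%g -> symm_char e * symm_char e' = 0.
Proof.
move=> eP eP' zC ne.
have E1 : symm_char e * z * symm_char e' = (e * z) 1%g *: (symm_char e * symm_char e').
  by rewrite symm_char_mul_central // -scalerAl.
have E2 : symm_char e * (symm_char e' * z) = (e' * z) 1%g *: (symm_char e * symm_char e').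
  by rewrite (symm_char_mul_central eP') // -scalerAr.
move: E1 E2; rewrite -mulrA -(zC (symm_char e')); move: (symm_char e) (symm_char e') => X X' -> /eqP.
by rewrite -subr_eq0 -scalerBl scaler_eq0 subr_eq0 (negPf ne) => /eqP.
Qed.

(** * Partitions and Specht modules *)

Section Partition.
Variables (n : nat) (la : intpartn n).

Lemma size_rows : size (rows la) = n.
Proof. by rewrite size_map size_tuple. Qed.

Lemma sumn_rows : sumn (rows la) = n.
Proof. by case: la => t tP; have /andP[_ /eqP] := tP. Qed.

Lemma row_len_noninc i j : (i <= j)%N -> (row_len la j <= row_len la i)%N.
Proof.
move=> ij; rewrite /row_len; case: (ltnP j (size (rows la))) => [jn|]; last first.
  by move=> /(nth_default 0%N) ->.
have : sorted geq (rows la) by case: la => t tP; have /andP[] := tP.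
rewrite (sorted_pairwise (rev_trans leq_trans)) => /pairwiseP -/(_ 0%N).
move: ij; rewrite leq_eqVlt => /orP[/eqP -> //|ij] /(_ i j).
by rewrite !inE => /(_ _ jn ij); apply; apply: ltn_trans jn.
Qed.

Lemma row_len_default i : (n <= i)%N -> row_len la i = 0%N.
Proof. by move=> ni; rewrite /row_len nth_default // size_rows. Qed.

Lemma sum_row_len N : (n <= N)%N -> (\sum_(i < N) row_len la i = n)%N.
Proof.
move=> nN; rewrite -[RHS]sumn_rows sumnE (big_nth 0%N) size_rows big_mkord.
rewrite [RHS](big_ord_widen N (row_len la)) // [RHS]big_mkcond.
apply: eq_bigr => i _; case: ltnP => // ni; exact: row_len_default.
Qed.

Definition rowt (x : 'I_n) : nat := reshape_index (rows la) x.
Definition colt (x : 'I_n) : nat := reshape_offset (rows la) x.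

Lemma colt_lt x : (colt x < row_len la (rowt x))%N.
Proof. by apply: reshape_offsetP; rewrite sumn_rows. Qed.

Lemma rowt_lt x : (rowt x < n)%N.
Proof. by rewrite -[X in (_ < X)%N]size_rows; apply: reshape_indexP; rewrite sumn_rows. Qed.

Lemma colt_ltn x : (colt x < n)%N.
Proof.
apply: leq_trans (colt_lt x) _; rewrite -[leqRHS](sum_row_len (leqnn n)).
by rewrite (bigD1 (Ordinal (rowt_lt x))) //= leq_addr.
Qed.

Lemma tabt_inj x y : rowt x = rowt y -> colt x = colt y -> x = y.
Proof.
move=> e1 e2; apply: val_inj.
rewrite /= -[LHS](reshape_indexK (rows la)) -[RHS](reshape_indexK (rows la)).
by rewrite -/(rowt x) -/(colt x) e1 e2.
Qed.

Lemma tabt_surj i j : (j < row_len la i)%N -> exists2 x, rowt x = i & colt x = j.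
Proof.
move=> ji; have lt : (flatten_index (rows la) i j < n)%N.
  rewrite /flatten_index; suff : (sumn (take i (rows la)) + j < sumn (rows la))%N.
    by rewrite sumn_rows.
  have -> : sumn (rows la) = (sumn (take i (rows la)) + sumn (drop i (rows la)))%N.
    by rewrite -sumn_cat cat_take_drop.
  have := ji; rewrite /row_len; case: (ltnP i (size (rows la))) => [i_lt|]; last first.
    by move=> /(nth_default 0%N) ->.
  by rewrite ltn_add2l (drop_nth 0%N i_lt) /=; lia.
exists (Ordinal lt); rewrite /rowt /colt /=.
  exact: flatten_indexKl.
exact: flatten_indexKr.
Qed.

Lemma tableau_t : tableau rowt colt.
Proof.
split; first exact: tabt_inj.
move=> x i j ix jx; apply: tabt_surj; apply: leq_ltn_trans jx _.
exact: leq_trans (colt_lt x) (row_len_noninc ix).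
Qed.

(** The boxes are listed in a square of any side N >= n, so that shapes of different sizes can be
    compared inside the same type. *)
Lemma big_boxes (V : Type) (idx : V) (op : Monoid.com_law idx) N (G : nat -> nat -> V) :
  (n <= N)%N ->
  \big[op/idx]_(x : 'I_n) G (rowt x) (colt x) =
  \big[op/idx]_(b : 'I_N * 'I_N | (b.2 < row_len la b.1)%N) G b.1 b.2.
Proof.
move=> nN; have lt k : (k < n)%N -> (k < N)%N by move=> kn; apply: leq_trans nN.
pose h (x : 'I_n) := (Ordinal (lt _ (rowt_lt x)), Ordinal (lt _ (colt_ltn x))).
have hi : injective h by move=> x y [e1 e2]; apply: tabt_inj.
transitivity (\big[op/idx]_(b in codom h) G b.1 b.2).
  rewrite -big_uniq; last by rewrite map_inj_uniq ?enum_uniq.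
  by rewrite big_map enumT.
apply: eq_bigl => b; apply/codomP/idP => [[x ->]|]; first exact: colt_lt.
case: b => i j /= /tabt_surj[x xi xj]; exists x.
by rewrite /h; congr pair; apply: val_inj.
Qed.

End Partition.

Lemma intpartn_ext n (la mu : intpartn n) :
  (forall i, row_len la i = row_len mu i) -> la = mu.
Proof.
move=> E; apply/val_inj/val_inj => /=; apply: (inj_map val_inj).
apply: (@eq_from_nth _ 0%N); rewrite ?size_map ?size_tuple // => i _.
exact: E.
Qed.

Lemma intpartn_exists n (f : nat -> nat) :
  (forall i, f i.+1 <= f i)%N -> (forall i, n <= i -> f i = 0)%N ->
  (\sum_(i < n) f i = n)%N -> exists la : intpartn n, forall i, row_len la i = f i.
Proof.
move=> fn f0 sf; have fle i : (f i < n.+1)%N.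
  case: (ltnP i n) => [lt|/f0->//]; rewrite ltnS -[leqRHS]sf (bigD1 (Ordinal lt)) //=.
  exact: leq_addr.
pose t := [tuple Ordinal (fle i) | i < n].
have tE : [seq nat_of_ord i | i <- t] = mkseq f n.
  by rewrite /t /= -map_comp /mkseq -val_enum_ord -map_comp; apply: eq_map.
have tP : intpartn_pred t.
  rewrite /intpartn_pred tE; apply/andP; split; last first.
    by rewrite sumnE big_map -(big_mkord xpredT f) /index_iota subn0 in sf *; rewrite sf.
  apply/(sortedP 0%N) => i; rewrite size_mkseq => lt.
  by rewrite !nth_mkseq // ?(ltnW lt) //; apply: fn.
exists (IntPartn tP) => i; rewrite /row_len /rows /= tE.
case: (ltnP i n) => [lt|ge]; first by rewrite nth_mkseq.
by rewrite nth_default ?size_mkseq // f0.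
Qed.

Section Specht.
Variables (F : numFieldType) (n : nat) (la : intpartn n).

Definition young_symm : galg F 'S_n := ysym (rowt la) (colt la) F.

Lemma young_symm_prim : primitive_symm young_symm.
Proof. by split; [apply: ysym1; apply: tableau_t | apply: ysym_sandwich; apply: tableau_t]. Qed.

Lemma row_stabE : row_stab la =i label_stab (rowt la) (enum 'I_n).
Proof.
move=> s; rewrite inE; apply/forallP/label_stabP => [H|[_ H] x]; last exact/eqP/H.
by split=> x; [rewrite mem_enum | apply/eqP/H].
Qed.

Lemma col_stabE : col_stab la =i label_stab (colt la) (enum 'I_n).
Proof.
move=> s; rewrite inE; apply/forallP/label_stabP => [H|[_ H] x]; last exact/eqP/H.
by split=> x; [rewrite mem_enum | apply/eqP/H].
Qed.

Lemma young_symmetrizerE : young_symmetrizer F la = \row_j young_symm (enum_val j).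
Proof.
apply/rowP=> j; rewrite !mxE summxE /young_symm /ysym mulr_suml galg_sumE.
apply: eq_big => [r|r _]; first exact: row_stabE.
rewrite -scalerAl lsgn_false scale1r mulr_sumr galg_sumE summxE.
apply: eq_big => [c|c _]; first exact: col_stabE.
rewrite !mxE /= -scalerAr galgZE -gbM ffunE; congr (_ * _%:R).
by rewrite -(inj_eq enum_val_inj) gring_indexK // inE.
Qed.

Definition chi_elt : galg F 'S_n := symm_char young_symm.
Definition specht_dim : nat := symm_dim young_symm.

(** Inversion turns R C into C R, which has the same symmetrization. This removes the inverse from
    the trace formula for the character. *)
Lemma chi_elt_star : gstar chi_elt = chi_elt.
Proof. by rewrite gstarZ -gsym_star /young_symm /ysym gstarM !star_label_sum gsymC. Qed.

Lemma chi_chi_elt s : chi F la s = chi_elt s.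
Proof.
rewrite -[in RHS]chi_elt_star ffunE -(symm_charE young_symm_prim) /chi /specht_repr /specht_module.
by move: young_symmetrizerE; move: (young_symmetrizer F la) => v ->.
Qed.

End Specht.

(** * Interlacing partitions *)

Local Close Scope ring_scope.

(** For n = m + 1 this is the covering relation of Young's lattice, for n = m + p the horizontal
    p-strips; leaving both sizes free lets one relation serve for branching and for Pieri. *)
Definition interlaced m n (be : intpartn m) (nu : intpartn n) : bool :=
  [forall i : 'I_(m + n), (row_len be i <= row_len nu i) && (row_len nu i.+1 <= row_len be i)].

Lemma interlacedP m n (be : intpartn m) (nu : intpartn n) :
  reflect (forall i, row_len be i <= row_len nu i /\ row_len nu i.+1 <= row_len be i)
    (interlaced be nu).
Proof.
apply: (iffP forallP) => [H i|H i]; last by apply/andP; apply: H.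
case: (ltnP i (m + n)) => [lt|ge]; first by have /andP[] := H (Ordinal lt).
by rewrite !row_len_default //; lia.
Qed.

Lemma interlaced_eq n (be nu : intpartn n) : interlaced be nu = (be == nu).
Proof.
apply/interlacedP/eqP => [H|-> i]; last by split=> //; apply: row_len_noninc.
have /leqif_sum : forall i : 'I_n, true ->
    row_len be i <= row_len nu i ?= iff (row_len be i == row_len nu i).
  by move=> i _; split=> //; case: (H i).
case=> _; rewrite !sum_row_len // eqxx => /esym/forallP/= E.
apply: intpartn_ext => i; case: (ltnP i n) => [lt|ge]; first exact/eqP/(E (Ordinal lt)).
by rewrite !row_len_default.
Qed.

(** If row i + 1 of nu is longer than row i of be, the column of index [row_len be i] contains strip
    boxes in both rows. Conversely, two strip boxes of one column contradict interlacing at the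
    upper row. The number of boxes follows from the sizes. *)
Lemma hstripE p q (be : intpartn q) (nu : intpartn (p + q)) :
  part_sub be nu && horizontal_strip p nu be = interlaced be nu.
Proof.
have subE : part_sub be nu -> forall i, row_len be i <= row_len nu i.
  move=> /forallP H i; case: (ltnP i q) => [lt|ge]; first exact: (H (Ordinal lt)).
  by rewrite row_len_default.
apply/andP/interlacedP => [[sub /andP[_ /forallP strip]] i|H].
  split; first exact: subE.
  rewrite leqNgt; apply/negP => lt.
  have j_lt : row_len be i < p + q.
    rewrite -[leqRHS](sum_row_len nu (leqnn _)).
    case: (ltnP i.+1 (p + q)) => [i_lt|ge]; last by move: lt; rewrite [row_len nu _]row_len_default.
    by rewrite (bigD1 (Ordinal i_lt)) //=; lia.
  have i_lt : i.+1 < p + q.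
    by rewrite ltnNge; apply/negP => /(row_len_default nu) E; rewrite E in lt.
  have b1 : (Ordinal (ltnW i_lt), Ordinal j_lt) \in skew_boxes nu be.
    rewrite inE /= leqnn /=; apply: leq_trans lt _; exact: row_len_noninc.
  have b2 : (Ordinal i_lt, Ordinal j_lt) \in skew_boxes nu be.
    by rewrite inE /= lt andbT; apply: row_len_noninc.
  have := strip (Ordinal (ltnW i_lt), Ordinal j_lt); rewrite b1 /=.
  move=> /forallP/(_ (Ordinal i_lt, Ordinal j_lt)); rewrite b2 /= eqxx /=.
  by move=> /eqP[]; lia.
have sub : part_sub be nu by apply/forallP => i; case: (H i).
split=> //; apply/andP; split.
  have := big_boxes be addn (fun _ _ => 1) (leq_addl p q).
  rewrite big_const_ord iter_addn_0 mul1n sum1dep_card => bE.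
  have := big_boxes nu addn (fun _ _ => 1) (leqnn (p + q)).
  rewrite big_const_ord iter_addn_0 mul1n sum1dep_card => nE.
  set B := (X in q = #|pred_of_set X|) in bE; set N := (X in p + q = #|pred_of_set X|) in nE.
  have BN : B \subset N.
    by apply/subsetP => b; rewrite !inE => lt; apply: leq_trans lt _; case: (H b.1).
  have -> : skew_boxes nu be = N :\: B by apply/setP => b; rewrite !inE -leqNgt.
  by rewrite cardsD (setIidPr BN) -nE -bE addnK.
apply/forallP => b; apply/implyP => bS; apply/forallP => b'; apply/implyP => b'S.
apply/implyP => /eqP e; move: bS b'S; rewrite !inE e => /andP[h1 h2] /andP[h3 h4].
have key (i j : nat) : i < j -> row_len be i <= b'.2 -> b'.2 < row_len nu j -> False.
  move=> ij l1 l2; have [_ l3] := H i; have := row_len_noninc nu ij; lia.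
rewrite [b]surjective_pairing [b']surjective_pairing e xpair_eqE eqxx andbT.
by rewrite -val_eqE /=; case: ltngtP => // /key H'; exfalso; apply: H'.
Qed.

Definition cov (f g : nat -> nat) i := forall j, g j = f j + (j == i).

Lemma covP n (mu : intpartn n) (nu : intpartn n.+1) :
  (forall i, row_len mu i <= row_len nu i) ->
  exists2 i, i < n.+1 & cov (row_len mu) (row_len nu) i.
Proof.
move=> le.
have : \sum_(i < n.+1) (row_len nu i - row_len mu i) == 1.
  have := sum_row_len nu (leqnn _); have := sum_row_len mu (leqnSn n).
  have -> : \sum_(i < n.+1) row_len nu i =
      \sum_(i < n.+1) (row_len nu i - row_len mu i) + \sum_(i < n.+1) row_len mu i.
    by rewrite -big_split; apply: eq_bigr => i _ /=; rewrite subnK.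
  move: (\sum_(i < n.+1) (row_len nu i - row_len mu i)) (\sum_(i < n.+1) row_len mu i).
  by move=> S S' -> ?; apply/eqP; lia.
move=> /sum_nat_eq1[i [_ i1 i0]]; exists (val i); first exact: ltn_ord.
move=> j; case: (ltnP j n.+1) => [lt|ge]; last first.
  rewrite !row_len_default //; last exact: ltnW.
  by rewrite gtn_eqF // (leq_trans (ltn_ord i)).
case: eqVneq => [ji|ji] /=; first by have := le j; move: i1; rewrite -ji; lia.
by have := i0 (Ordinal lt) ji isT; have := le j; rewrite /=; lia.
Qed.

Lemma cov_exists n (mu : intpartn n) i :
  (forall j, j.+1 = i -> row_len mu i < row_len mu j) ->
  exists nu : intpartn n.+1, cov (row_len mu) (row_len nu) i.
Proof.
move=> Hi; have i_n : i < n.+1.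
  case: i Hi => // i /(_ i erefl); rewrite ltnS; apply: contraTltn => ni.
  by rewrite -leqNgt [row_len mu i]row_len_default.
have [||| nu nuE] := @intpartn_exists n.+1 (fun j => row_len mu j + (j == i)).
- move=> j; have := row_len_noninc mu (leqnSn j); have := Hi j.
  by case: (j.+1 =P i) => [<- /(_ erefl)|_ _]; case: (j =P _); lia.
- move=> j nj; rewrite row_len_default ?(ltnW nj) //.
  by rewrite gtn_eqF // (leq_trans i_n).
- rewrite big_split /= sum_row_len // (bigD1 (Ordinal i_n)) //= eqxx big1 => [|j ji].
    by rewrite addn0 addn1.
  by rewrite -[_ == i]/(j == Ordinal i_n) (negPf ji).
by exists nu.
Qed.

Lemma cov_pred n (nu : intpartn n.+1) i : 0 < row_len nu i -> row_len nu i.+1 < row_len nu i ->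
  exists mu : intpartn n, cov (row_len mu) (row_len nu) i.
Proof.
move=> i0 Hi; have i_n : i < n.+1.
  by rewrite ltnNge; apply/negP => /(row_len_default nu) E; rewrite E in i0.
(* The new shape must have at most n rows. Row n of nu is nonempty only when nu is a single column,
   and then its only removable box is in that row. *)
have mu0 j : n <= j -> row_len nu j - (j == i) = 0.
  move=> nj; case: (ltnP n j) => [lt|ge]; first by rewrite row_len_default.
  have {ge nj} -> : j = n by apply/eqP; rewrite eqn_leq ge.
  clear j; case: (posnP (row_len nu n)) => [->//|n0].
  have : row_len nu i <= 1.
    have := sum_row_len nu (leqnn _); rewrite (bigD1 (Ordinal i_n)) //= => E.
    have : n <= \sum_(j < n.+1 | j != Ordinal i_n) row_len nu j.
      have {1}-> : n = \sum_(j < n.+1 | j != Ordinal i_n) 1.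
        by rewrite sum1_card cardC1 card_ord.
      by apply: leq_sum => j _; apply: leq_trans n0 _; apply: row_len_noninc; rewrite -ltnS.
    rewrite -(leq_add2l (row_len nu i)) E; lia.
  case: (ltngtP n i) => [ni|ni|<-]; last by lia.
    by move: i_n; rewrite ltnS leqNgt ni.
  by have := row_len_noninc nu ni; lia.
have [||| mu muE] := @intpartn_exists n (fun j => row_len nu j - (j == i)) => //.
- move=> j; have := row_len_noninc nu (leqnSn j).
  by case: (j =P i) => [->|_]; case: eqP => _; lia.
- have : \sum_(j < n.+1) (row_len nu j - (j == i :> nat)) + 1 = n.+1.
    rewrite -[RHS](sum_row_len nu (leqnn _)) (bigD1 (Ordinal i_n)) //= eqxx.
    rewrite [RHS](bigD1 (Ordinal i_n)) //= addnAC subnK //; congr (_ + _).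
    by apply: eq_bigr => j ji; have -> : (j == i :> nat) = false := negbTE ji; rewrite subn0.
  by rewrite addn1 big_ord_recr /= mu0 // addn0 => -[].
exists mu => j; rewrite muE subnK //; by case: eqP => [->|].
Qed.

(** Recovers the row of the added box, so that covers can be counted by rows; the default 0 is
    returned only when f and g agree below K. *)
Definition first_diff K (f g : nat -> nat) : nat :=
  if [pick j : 'I_K | f j != g j] is Some j then j else 0.

Lemma first_diffP K f g i : i < K -> cov f g i -> first_diff K f g = i.
Proof.
move=> iK c; rewrite /first_diff; case: pickP => [j|/(_ (Ordinal iK))] /=.
  by rewrite c; case: (eqVneq (j : nat) i) => //= _; rewrite addn0 eqxx.
by rewrite /= c eqxx; lia.
Qed.

Lemma first_diff_lt K f g : 0 < K -> first_diff K f g < K.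
Proof. by rewrite /first_diff; case: pickP. Qed.

Section CountInter.
Variables (m n : nat) (be : intpartn m) (mu : intpartn n).
Let b := row_len be.
Let u := row_len mu.
(** Both shapes are empty from row m + n on; the margin leaves room for the shift from row i to row
    i + 1. *)
Definition ibound := (m + n).+2.
Let K := ibound.

(** Only the interlacing of the modified row lengths is required here; that these lengths form a
    partition is a consequence, drawn when the rows are matched with shapes. *)
Definition addable (i : nat) := [forall j : 'I_K, (b j <= u j + (j == i :> nat)) && (u j.+1 + (j.+1 == i) <= b j)].
Definition removable (i : nat) := (0 < b i) &&
  [forall j : 'I_K, (b j - (j == i :> nat) <= u j) && (u j.+1 <= b j - (j == i :> nat))].

Let b_def j : m <= j -> b j = 0. Proof. exact: row_len_default. Qed.
Let u_def j : n <= j -> u j = 0. Proof. exact: row_len_default. Qed.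

Let addableP i : i < K -> reflect (forall j, b j <= u j + (j == i) /\ u j.+1 + (j.+1 == i) <= b j) (addable i).
Proof.
move=> iK; apply: (iffP forallP) => [H j|H j]; last by apply/andP; apply: H.
case: (ltnP j K) => [lt|ge]; first by have /andP[] := H (Ordinal lt).
by rewrite b_def ?u_def ?gtn_eqF //; move: ge iK; rewrite /K /ibound; lia.
Qed.

Lemma removableP i : reflect (0 < b i /\ forall j, b j - (j == i) <= u j /\ u j.+1 <= b j - (j == i)) (removable i).
Proof.
apply: (iffP andP) => [[b0 /forallP H]|[b0 H]]; split=> //; last first.
  by apply/forallP => j; apply/andP; apply: H.
move=> j; case: (ltnP j K) => [lt|ge]; first by have /andP[] := H (Ordinal lt).
by rewrite b_def ?u_def //; move: ge; rewrite /K /ibound; lia.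
Qed.

(** If be and mu interlace, row i + 1 is addable to mu exactly when row i is removable from be, and
    row 0 is always addable, which gives the extra 1. If not, the added or removed box must repair
    the same defect, a row where be exceeds mu by one, and the two conditions agree row by row. *)
Let sum_up_dn : \sum_(i < K) addable i = \sum_(i < K) removable i + interlaced be mu.
Proof.
have u_non j : u j.+1 <= u j by apply: row_len_noninc.
have b_non j : b j.+1 <= b j by apply: row_len_noninc.
have bu : reflect (forall i, b i <= u i /\ u i.+1 <= b i) (interlaced be mu) by apply: interlacedP.
case: bu => [H|nH] /=.
  rewrite big_ord_recl [in RHS]big_ord_recr /= addnC; congr (_ + _).
    have -> : removable (m + n).+1 = false by rewrite /removable b_def // ltnW // ltnS leq_addr.
    rewrite addn0; apply: eq_bigr => i _; congr nat_of_bool; rewrite /bump leq0n add1n.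
    have iK : i.+1 < K by rewrite /K /ibound ltnS.
    apply/(addableP iK)/removableP => [H'|[b0 H'] j].
      split=> [|j]; last first.
        have [h1 h2] := H j; have [h3 h4] := H' j; split; first by lia.
        by move: h4; rewrite eqSS; case: (j == i) => /=; lia.
      by have [_] := H' i; rewrite eqxx addn1; apply: leq_trans.
    have [h1 h2] := H j; have [h3 h4] := H' j; split; first by lia.
    by move: h3 h4 b0; rewrite eqSS; case: eqVneq => [->|_] /=; lia.
  suff -> : addable 0 by [].
  by apply/addableP => // j; have [h1 h2] := H j; split; lia.
rewrite addn0; apply: eq_bigr => i _; congr nat_of_bool.
apply/(addableP (ltn_ord i))/removableP => [H|[b0 H]].
  have bi : b i = u i + 1.
    have [h _] := H i; rewrite eqxx in h; apply/eqP; rewrite eqn_leq h addn1 ltnNge.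
    apply/negP => le; apply: nH => j; have [h1 h2] := H j; split; last by lia.
    by move: h1; case: eqVneq => [-> //|_]; rewrite addn0.
  split=> [|j]; first by rewrite bi addn1.
  have [h1 h2] := H j; move: h1; case: eqVneq => [->|ji] /= h1; last by split; lia.
  by split; have := u_non i; lia.
have bi : b i = u i + 1.
  have [h _] := H i; rewrite eqxx /= in h.
  suff : ~ (b i <= u i) by lia.
  move=> le; apply: nH => j; have [h1 h2] := H j; split; last by lia.
  by move: h1; case: eqVneq => [-> //|_]; rewrite subn0.
move=> j; have [h1 h2] := H j; split; first by move: h1; case: (j == i); lia.
case: eqVneq => [ji|_]; last by move: h2; case: (j == i) => /=; lia.
by have := b_non j; rewrite ji bi.
Qed.

Lemma card_up : #|[pred nu : intpartn n.+1 | interlaced mu nu && interlaced be nu]| = \sum_(i < K) addable i.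
Proof.
have nK i : i < n.+1 -> i < K by rewrite /K /ibound; lia.
have picK f g : first_diff K f g < K by apply: first_diff_lt.
pose h (nu : intpartn n.+1) : 'I_K := Ordinal (picK u (row_len nu)).
have hP nu : interlaced mu nu -> cov u (row_len nu) (h nu).
  move=> /interlacedP H; have [|i /nK iK c] := @covP n mu nu; first by move=> i; case: (H i).
  by rewrite /= (first_diffP iK c).
rewrite -(card_in_imset (f := h)) => [|nu nu' /andP[/hP c _] /andP[/hP c' _] e].
  rewrite -big_mkcond sum1dep_card; apply: eq_card => i; rewrite inE.
  apply/imsetP/(addableP (ltn_ord i)) => [[nu /andP[/hP c /interlacedP H] ->] j|H].
    by rewrite -!c; apply: H.
  have [|nu c] := @cov_exists n mu i.
    move=> j ji; have [_] := H j; rewrite ji eqxx addn1 -ji => h1.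
    have [h2 _] := H j; move: h2; rewrite -ji ltn_eqF // addn0 => h2.
    exact: leq_trans h1 h2.
  have mn : interlaced mu nu.
    apply/interlacedP => j; rewrite !c; split; first exact: leq_addr.
    have [h1 h2] := H j; have := row_len_noninc mu (leqnSn j).
    move: h1 h2; rewrite -/u -/b; case: (j.+1 =P i) => [<-|_] /=; last by lia.
    by rewrite ltn_eqF //; lia.
  exists nu; last by apply: val_inj; rewrite /= (first_diffP (ltn_ord i) c).
  by rewrite inE mn; apply/interlacedP => j; rewrite !c; apply: H.
by apply: intpartn_ext => j; rewrite c c' e.
Qed.

Lemma inter_count_index :
  #|[pred nu : intpartn n.+1 | interlaced mu nu && interlaced be nu]| =
  \sum_(i < K) removable i + interlaced be mu.
Proof. by rewrite card_up sum_up_dn. Qed.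

End CountInter.

Lemma card_removable m n (be : intpartn m.+1) (mu : intpartn n) :
  #|[pred de : intpartn m | interlaced de be && interlaced de mu]| =
  \sum_(i < ibound m.+1 n) removable be mu i.
Proof.
set K := ibound _ _.
have pK f g : first_diff K f g < K by apply: first_diff_lt.
pose h (de : intpartn m) : 'I_K := Ordinal (pK (row_len de) (row_len be)).
have hP de : interlaced de be -> cov (row_len de) (row_len be) (h de).
  move=> /interlacedP H; have [|i iK c] := @covP m de be; first by move=> i; case: (H i).
  by rewrite /= (first_diffP _ c) //; move: iK; rewrite /K /ibound; lia.
have covB (f g : nat -> nat) i : cov f g i -> forall j, f j = g j - (j == i).
  by move=> c j; rewrite c addnK.
rewrite -(card_in_imset (f := h)) => [|de de' /andP[/hP c _] /andP[/hP c' _] e].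
  rewrite -big_mkcond sum1dep_card; apply: eq_card => i; rewrite inE.
  apply/imsetP/removableP => [[de /andP[/hP c /interlacedP H] ->]|[b0 H]].
    split=> [|j]; first by rewrite c eqxx addn1.
    by have := H j; rewrite (covB _ _ _ c j).
  have [|de c] := @cov_pred m be i b0.
    have [_ h1] := H i; have [h2 _] := H i.+1; move: h1 h2.
    by rewrite eqxx gtn_eqF // subn0; lia.
  have db : interlaced de be.
    apply/interlacedP => j; rewrite (covB _ _ _ c); split; first exact: leq_subr.
    have [h1 h2] := H j; have [h3 h4] := H j.+1; have := row_len_noninc be (leqnSn j).
    move: h2 h3; case: (j =P i) => [->|_] /=; last by rewrite subn0.
    by rewrite [i.+1 == i :> nat]gtn_eqF // subn0; lia.
  exists de; last by apply: val_inj; rewrite /= (first_diffP (ltn_ord i) c).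
  by rewrite inE db; apply/interlacedP => j; rewrite (covB _ _ _ c j); apply: H.
by apply: intpartn_ext => j; rewrite (covB _ _ _ c) (covB _ _ _ c') e.
Qed.

(* Adding a horizontal strip after removing a box, or conversely:
   D H_(p+1) = H_(p+1) D + H_p. *)
Lemma inter_count m n (be : intpartn m.+1) (mu : intpartn n) :
  #|[pred nu : intpartn n.+1 | interlaced mu nu && interlaced be nu]| =
  #|[pred de : intpartn m | interlaced de be && interlaced de mu]| + interlaced be mu.
Proof. by rewrite inter_count_index card_removable. Qed.

Lemma inter_count0 n (be : intpartn 0) (mu : intpartn n) :
  #|[pred nu : intpartn n.+1 | interlaced mu nu && interlaced be nu]| = interlaced be mu.
Proof.
rewrite inter_count_index big1 // => i _.
by rewrite /removable row_len_default.
Qed.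

Lemma inter_pred_exists n (nu : intpartn n.+1) : exists mu : intpartn n, interlaced mu nu.
Proof.
have [i [i0 Hi]] : exists i, 0 < row_len nu i /\ row_len nu i.+1 = 0.
  have ex : exists i, row_len nu i == 0 by exists n.+1; rewrite row_len_default.
  have nu0 : 0 < row_len nu 0.
    rewrite lt0n; apply/eqP => E; have := sum_row_len nu (leqnn _).
    rewrite big1 // => i _; apply/eqP; rewrite -leqn0 -E; exact: row_len_noninc.
  case: (ex_minnP ex) => [[|i] /eqP E min]; first by rewrite E in nu0.
  by exists i; split=> //; rewrite lt0n; apply/negP => /min; rewrite ltnn.
have [|mu c] := @cov_pred n nu i i0; first by rewrite Hi.
exists mu; apply/interlacedP => j; rewrite c; split; first exact: leq_addr.
have := c j.+1; have := row_len_noninc nu (leqnSn j); rewrite (c j) (c j.+1).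
by case: (j =P i) => [->|_]; move: (c i.+1); rewrite ?Hi; lia.
Qed.

(** * Counting dimensions on Young's lattice *)

Section Dimension.
Variable f : forall n, intpartn n -> nat.
Hypothesis f_res : forall n (nu : intpartn n.+1),
  \sum_(be : intpartn n | interlaced be nu) f be <= f nu.
Hypothesis f_ind : forall n (be : intpartn n),
  \sum_(nu : intpartn n.+1 | interlaced be nu) f nu <= n.+1 * f be.

Let sum2 n m l (be : intpartn l) :
  \sum_(nu : intpartn n | interlaced be nu) \sum_(mu : intpartn m | interlaced mu nu) f mu =
  \sum_(mu : intpartn m) #|[pred nu : intpartn n | interlaced mu nu && interlaced be nu]| * f mu.
Proof.
rewrite (exchange_big_dep xpredT) //=; apply: eq_bigr => mu _.
by rewrite sum_nat_const; congr (_ * _); apply: eq_card => nu; rewrite !inE andbC.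
Qed.

Let sum2' n m l (be : intpartn l) :
  \sum_(de : intpartn m | interlaced de be) \sum_(mu : intpartn n | interlaced de mu) f mu =
  \sum_(mu : intpartn n) #|[pred de : intpartn m | interlaced de be && interlaced de mu]| * f mu.
Proof.
rewrite (exchange_big_dep xpredT) //=; apply: eq_bigr => mu _.
by rewrite sum_nat_const; congr (_ * _); apply: eq_card => nu; rewrite !inE andbC.
Qed.

Let sum_inter_step m n (be : intpartn m.+1) :
  \sum_(nu : intpartn n.+1 | interlaced be nu) \sum_(mu : intpartn n | interlaced mu nu) f mu =
  \sum_(de : intpartn m | interlaced de be) \sum_(mu : intpartn n | interlaced de mu) f mu +
  \sum_(mu : intpartn n | interlaced be mu) f mu.
Proof.
rewrite sum2 sum2' [X in _ + X]big_mkcond -big_split; apply: eq_bigr => mu _ /=.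
by rewrite inter_count mulnDl; case: interlaced; rewrite ?mul1n.
Qed.

Let sum_inter_step0 n (be : intpartn 0) :
  \sum_(nu : intpartn n.+1 | interlaced be nu) \sum_(mu : intpartn n | interlaced mu nu) f mu =
  \sum_(mu : intpartn n | interlaced be mu) f mu.
Proof.
rewrite sum2 [RHS]big_mkcond; apply: eq_bigr => mu _ /=.
by rewrite inter_count0; case: interlaced; rewrite ?mul1n.
Qed.

Let sum_interlaced_eq n (be : intpartn n) : \sum_(mu : intpartn n | interlaced be mu) f mu = f be.
Proof.
by rewrite (big_pred1 be) // => mu; rewrite interlaced_eq eq_sym.
Qed.

(* With D and U removing and adding a box, the two inequalities are tight
   because D U = U D + 1 on Young's lattice. *)
Let f_branch_of n :
  (forall be : intpartn n, \sum_(nu : intpartn n.+1 | interlaced be nu)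
     \sum_(mu : intpartn n | interlaced mu nu) f mu = n.+1 * f be) ->
  (forall be : intpartn n, \sum_(nu : intpartn n.+1 | interlaced be nu) f nu = n.+1 * f be)
  /\ (forall nu : intpartn n.+1, f nu = \sum_(be : intpartn n | interlaced be nu) f be).
Proof.
move=> D.
have eq_all (be : intpartn n) : \sum_(nu : intpartn n.+1 | interlaced be nu) f nu = n.+1 * f be /\
    forall nu : intpartn n.+1, interlaced be nu -> \sum_(mu : intpartn n | interlaced mu nu) f mu = f nu.
  have E : \sum_(nu : intpartn n.+1 | interlaced be nu) f nu = n.+1 * f be.
    apply/eqP; rewrite eqn_leq f_ind -D; apply: leq_sum => nu _; exact: f_res.
  split=> // nu bnu.
  have /leqif_sum : forall nu : intpartn n.+1, interlaced be nu ->
      \sum_(mu : intpartn n | interlaced mu nu) f mu <= f nu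
        ?= iff (\sum_(mu : intpartn n | interlaced mu nu) f mu == f nu).
    by move=> nu' _; split=> //; apply: f_res.
  case=> _; rewrite D E eqxx => /esym/forallP/(_ nu); rewrite bnu /=.
  by move/eqP.
split=> [be|nu]; first by case: (eq_all be).
have [mu mn] := inter_pred_exists nu; have [_ /(_ nu mn) -> //] := eq_all mu.
Qed.

Let f_branch n : (forall be : intpartn n, \sum_(nu : intpartn n.+1 | interlaced be nu) f nu = n.+1 * f be)
  /\ (forall nu : intpartn n.+1, f nu = \sum_(be : intpartn n | interlaced be nu) f be).
Proof.
elim: n => [|n [IH1 IH2]]; apply: f_branch_of => be.
  by rewrite sum_inter_step0 sum_interlaced_eq mul1n.
rewrite sum_inter_step sum_interlaced_eq (eq_bigr _ (fun de _ => IH1 de)) -big_distrr /=.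
by rewrite -IH2 mulSn addnC.
Qed.

(** Induction on n. Branching replaces each [f nu] by a sum over shapes with one box less; the
    commutation of box removal with strips leaves the strips one box shorter over be and the strips
    of unchanged length over be minus a box. The two binomials add up by Pascal's rule. *)
Lemma f_pieri n p q (be : intpartn q) : n = p + q ->
  \sum_(nu : intpartn n | interlaced be nu) f nu = 'C(n, p) * f be.
Proof.
elim: n p q be => [|n IH] p q be.
  case: p => [|p]; case: q be => [|q] be // _.
  by rewrite sum_interlaced_eq bin0 mul1n.
case: p => [|p]; rewrite ?addSn ?add0n => nE.
  by case: q / nE be => be; rewrite sum_interlaced_eq bin0 mul1n.
case: nE => nE; rewrite (eq_bigr _ (fun nu _ => (f_branch n).2 nu)).
case: q be nE => [|q] be nE.
  rewrite sum_inter_step0 (IH p _ be nE) nE addn0 !binn.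
  by [].
rewrite sum_inter_step (IH p _ be nE).
have IHd (de : intpartn q) : interlaced de be -> \sum_(mu : intpartn n | interlaced de mu) f mu = 'C(n, p.+1) * f de.
  by move=> _; apply: (IH p.+1 q de); rewrite nE addnS.
by rewrite (eq_bigr _ IHd) -big_distrr /= -(f_branch q).2 -mulnDl binS.
Qed.

End Dimension.

Local Open Scope ring_scope.

(** * The Pieri rule *)

Section Disjoint.
Variables (F : fieldType) (T : finType) (D D' : pred T).
Hypothesis DD' : forall x, D x || D' x.
Notation A := (galg F {perm T}).
Implicit Types a b : A.

Lemma fixes_disjoint_comm (g h : {perm T}) : fixes D g -> fixes D' h -> (g * h = h * g)%g.
Proof.
move=> /fixesP fg /fixesP fh; apply/permP => x; rewrite !permM.
case: (boolP (D x)) => Dx.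
  rewrite (fg x Dx); case: (boolP (D (h x))) => [/fg -> //|Dhx].
  have D'hx : D' (h x) by have := DD' (h x); rewrite (negPf Dhx).
  have -> : h x = x by apply: (@perm_inj _ h); rewrite (fh _ D'hx).
  by rewrite fg.
have D'x : D' x by have := DD' x; rewrite (negPf Dx).
rewrite (fh x D'x); case: (boolP (D (g x))) => Dgx.
  have E : g x = x by apply: (@perm_inj _ g); rewrite (fg _ Dgx).
  by rewrite E (fh x D'x).
by apply: fh; have := DD' (g x); rewrite (negPf Dgx).
Qed.

Lemma gfix_disjointC a b : gfix D a -> gfix D' b -> a * b = b * a.
Proof.
move=> Da Db; apply: (gfixC Da) => g fg; apply/esym/(gfixC Db) => h fh.
by rewrite -!gbM (fixes_disjoint_comm fg fh).
Qed.

Lemma gfix_disjoint_trace a b : gfix D a -> gfix D' b -> (a * b) 1%g = a 1%g * b 1%g.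
Proof.
move=> Da Db; rewrite gmulE (bigD1 1%g) //= big1 => [|g g1].
  by rewrite invg1 mulg1 addr0.
case: (eqVneq (a g) 0) => [->|/Da/fixesP fg]; first by rewrite mul0r.
case: (eqVneq (b (g^-1 * 1)%g) 0) => [->|/Db/fixesP fh]; first by rewrite mulr0.
case/eqP: g1; apply/permP => x; rewrite perm1; have := DD' x.
case/orP => [/fg //|D'x]; apply: (@perm_inj _ g^-1%g); rewrite permK.
by rewrite -{1}(fh x D'x) mulg1.
Qed.

End Disjoint.

(** * Embedding of a smaller symmetric group *)

Section Embedding.
Variables (F : fieldType) (T T' : finType) (h : T -> T').
Hypothesis hI : injective h.
Implicit Types (s t : {perm T}).
Notation A := (galg F {perm T}).
Notation A' := (galg F {perm T'}).

Definition extf s (x : T') : T' := if [pick y | h y == x] is Some y then h (s y) else x.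

Lemma extf_h s y : extf s (h y) = h (s y).
Proof.
rewrite /extf; case: pickP => [z /eqP/hI -> //|/(_ y)].
by rewrite eqxx.
Qed.

Lemma extf_out s x : x \notin codom h -> extf s x = x.
Proof.
move=> xh; rewrite /extf; case: pickP => [z /eqP E|//].
by rewrite -E codom_f in xh.
Qed.

Lemma extf_inj s : injective (extf s).
Proof.
apply: (can_inj (g := extf s^-1)) => x; case: (boolP (x \in codom h)) => [/codomP[y ->]|xh].
  by rewrite !extf_h permK.
by rewrite !extf_out.
Qed.

Definition extp s : {perm T'} := perm (@extf_inj s).

Lemma extp_h s y : extp s (h y) = h (s y).
Proof. by rewrite permE extf_h. Qed.

Lemma extp_out s x : x \notin codom h -> extp s x = x.
Proof. by move=> xh; rewrite permE extf_out. Qed.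

Lemma extp_eq s (g : {perm T'}) :
  (forall y, g (h y) = h (s y)) -> (forall x, x \notin codom h -> g x = x) -> extp s = g.
Proof.
move=> gh gout; apply/permP => x; case: (boolP (x \in codom h)) => [/codomP[y ->]|xh].
  by rewrite extp_h gh.
by rewrite extp_out // gout.
Qed.

Lemma extpM s t : extp (s * t)%g = (extp s * extp t)%g.
Proof.
by apply: extp_eq => [y|x xh]; rewrite permM ?extp_h ?extp_out // permM.
Qed.

Lemma extp1 : extp 1%g = 1%g.
Proof. by apply: extp_eq => [y|x _]; rewrite !perm1. Qed.

Lemma extpV s : extp s^-1%g = (extp s)^-1%g.
Proof. by apply: (mulgI (extp s)); rewrite mulgV -extpM mulgV extp1. Qed.

Lemma extp_inj : injective extp.
Proof. by move=> s t E; apply/permP => y; apply: hI; rewrite -!extp_h E. Qed.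

Lemma extp_tperm x y : extp (tperm x y) = tperm (h x) (h y).
Proof.
apply: extp_eq => [z|z zh]; last first.
  by rewrite tpermD //; apply: contraNneq zh => <-; apply: codom_f.
by case: (tpermP x y z) => [->|->|/eqP zx /eqP zy]; rewrite ?tpermL ?tpermR // tpermD // (inj_eq hI) eq_sym.
Qed.

Lemma odd_extp s : odd_perm (extp s) = odd_perm s.
Proof.
have [ts -> dts] := prod_tpermP s; elim: ts dts => [|t ts IH] /=.
  by rewrite !big_nil extp1 !odd_perm1.
case/andP=> tt /IH E; rewrite !big_cons extpM !odd_permM E extp_tperm !odd_tperm.
by rewrite (inj_eq hI).
Qed.

Definition embed (a : A) : A' := \sum_s a s *: gb F (extp s).

Lemma embedD a b : embed (a + b) = embed a + embed b.
Proof. by rewrite -big_split; apply: eq_bigr => s _; rewrite galgDE scalerDl. Qed.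

Lemma embedZ c a : embed (c *: a) = c *: embed a.
Proof. by rewrite scaler_sumr; apply: eq_bigr => s _; rewrite galgZE scalerA. Qed.

Lemma embed0 : embed 0 = 0.
Proof. by rewrite -(scale0r 0) embedZ scale0r. Qed.

Lemma embed_sum (I : Type) (r : seq I) (P : pred I) (f : I -> A) :
  embed (\sum_(i <- r | P i) f i) = \sum_(i <- r | P i) embed (f i).
Proof. by elim/big_rec2: _ => [|i x y _ <-]; rewrite ?embed0 ?embedD. Qed.

Lemma embed_gb s : embed (gb F s) = gb F (extp s).
Proof.
rewrite /embed (bigD1 s) //= big1 => [|t ts]; rewrite ffunE ?eqxx ?scale1r ?addr0 //.
by rewrite (negPf ts) scale0r.
Qed.

Lemma embedM a b : embed (a * b) = embed a * embed b.
Proof.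
elim/galg_ind: a => [a a' Ea Ea'|c a Ea|s|]; last by rewrite mul0r embed0 mul0r.
- by rewrite mulrDl !embedD Ea Ea' mulrDl.
- by rewrite -scalerAl !embedZ Ea scalerAl.
elim/galg_ind: b => [b b' Eb Eb'|c b Eb|t|]; last by rewrite mulr0 embed0 mulr0.
- by rewrite mulrDr !embedD Eb Eb' mulrDr.
- by rewrite -scalerAr !embedZ Eb scalerAr.
by rewrite -gbM !embed_gb extpM gbM.
Qed.

Lemma embed1 : embed 1 = 1.
Proof. by rewrite -gb1 embed_gb extp1. Qed.

Lemma embed_coef a s : embed a (extp s) = a s.
Proof.
rewrite galg_sumE (bigD1 s) //= big1 => [|t ts]; rewrite galgZE ffunE.
  by rewrite eqxx mulr1 addr0.
by rewrite (inj_eq extp_inj) eq_sym (negPf ts) mulr0.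
Qed.

Lemma embed_trace a : embed a 1%g = a 1%g.
Proof. by rewrite -extp1 embed_coef. Qed.

Lemma embed_gfix a : gfix [predC codom h] (embed a).
Proof.
by apply: gfix_sum => s _; apply/gfixZ/gfix_gb/fixesP => x; apply: extp_out.
Qed.

Lemma embed_supp a g : embed a g != 0 -> exists2 s, a s != 0 & g = extp s.
Proof.
rewrite galg_sumE => nz.
have /existsP[s] : [exists s, a s * (g == extp s)%:R != 0].
  apply: contraNT nz => /existsPn H; rewrite big1 // => s _; rewrite galgZE ffunE.
  by apply/eqP; have := H s; rewrite negbK.
by case: (g =P extp s) => [-> |_]; [rewrite mulr1; exists s | rewrite mulr0 eqxx].
Qed.

Lemma embed_jm x (s : seq T) : embed (jm F x s) = jm F (h x) (map h s).
Proof.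
rewrite /jm big_map embed_sum; apply: eq_bigr => d _.
by rewrite embed_gb extp_tperm.
Qed.

Lemma embed_jmprod (z : F) (base s : seq T) :
  embed (jmprod z base s) = jmprod z (map h base) (map h s).
Proof.
elim: s => [|x s IH] /=; first exact: embed1.
by rewrite embedM embedD embedZ embed1 embed_jm IH map_cat.
Qed.

(** A conjugation coming from the smaller group commutes with b, so the outer symmetrization absorbs
    it; the factor counts these conjugations. *)
Lemma embed_gsym (a : A) (b : A') :
  (forall s, gb F (extp s) * b = b * gb F (extp s)) ->
  gsym (embed (gsym a) * b) = #|{perm T}|%:R *: gsym (embed a * b).
Proof.
move=> bC; rewrite embed_sum mulr_suml gsym_sum -[RHS]/(_ *: gsym (embed a * b)).
rewrite (eq_bigr (fun=> gsym (embed a * b))) ?sumr_const ?scaler_nat // => s _.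
rewrite !embedM !embed_gb extpV -!mulrA bC -[RHS](gsym_conj _ (extp s)).
by rewrite !mulrA.
Qed.

End Embedding.

Lemma label_sum_conj (F : fieldType) (T : finType) eps (f : T -> nat) (g : {perm T}) :
  gb F g * label_sum F eps f (enum T) * gb F g^-1 = label_sum F eps (f \o g) (enum T).
Proof.
apply/ffunP=> k; rewrite gbMr gbMl invgK mulgA !label_sumE.
have -> : (g^-1 * k * g = k ^ g)%g by rewrite /conjg mulgA.
have -> : (k ^ g \in label_stab f (enum T))%g = (k \in label_stab (f \o g) (enum T)).
  apply/label_stabP/label_stabP => -[_ H]; split=> [x|x]; rewrite ?mem_enum //=.
    have := H (g x); rewrite /conjg !permM permK; exact.
  by have := H (g^-1 x)%g; rewrite /= permKV /conjg !permM.
by rewrite /lsgn odd_permJ.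
Qed.

Lemma extend_rshift p q (k : 'I_q -> 'I_(p + q)) : injective k ->
  exists g : 'S_(p + q), forall y, g (rshift p y) = k y.
Proof.
move=> kI; pose D := [set x | x \notin codom k].
have cD : #|D| = p.
  have E := cardC (mem (codom k)); rewrite card_codom // !card_ord in E.
  apply: (@addnI q); rewrite [RHS]addnC; apply: etrans E; congr (q + _)%N.
  by apply: eq_card => x; rewrite !inE.
pose g0 (x : 'I_(p + q)) : 'I_(p + q) := match split x with
  | inl i => enum_val (cast_ord (esym cD) i) | inr y => k y end.
have g0D (i : 'I_p) : enum_val (cast_ord (esym cD) i) \notin codom k.
  by have := enum_valP (cast_ord (esym cD) i); rewrite inE.
have g0I : injective g0.
  move=> x y; rewrite -(splitK x) -(splitK y) /g0 !unsplitK.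
  case: (split x) => [i|i]; case: (split y) => [j|j].
  - by move=> /enum_val_inj/cast_ord_inj ->.
  - by move=> E; have := g0D i; rewrite E codom_f.
  - by move=> E; have := g0D j; rewrite -E codom_f.
  - by move/kI => ->.
exists (perm g0I) => y; rewrite permE /g0.
by rewrite -[rshift p y]/(unsplit (inr y)) unsplitK.
Qed.

Section Setup.
Variables (F : numFieldType) (p q : nat).
Notation n := (p + q)%N.
Notation A := (galg F 'S_n).

Definition left_seq : seq 'I_n := map (@lshift p q) (enum 'I_p).
Definition right_seq : seq 'I_n := map (@rshift p q) (enum 'I_q).
Definition embed_right : galg F 'S_q -> A := embed (@rshift_inj p q).
Definition sym_left : A := label_sum F false (fun=> 0%N) left_seq.

Lemma mem_left_seq x : (x \in left_seq) = (x < p)%N.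
Proof.
apply/mapP/idP => [[i _ ->] /=|xp]; first exact: ltn_ord.
by exists (Ordinal xp); rewrite ?mem_enum //; apply: val_inj.
Qed.

Lemma mem_right_seq x : (x \in right_seq) = (p <= x)%N.
Proof.
apply/mapP/idP => [[i _ ->] /=|xp]; first exact: leq_addr.
have lt : (x - p < q)%N by have := ltn_ord x; lia.
by exists (Ordinal lt); rewrite ?mem_enum //; apply: val_inj; rewrite /= subnKC.
Qed.

Lemma mem_codom_rshift x : (x \in codom (@rshift p q)) = (p <= x)%N.
Proof. by rewrite -mem_right_seq. Qed.

Lemma PQ_uniq : uniq (left_seq ++ right_seq).
Proof.
rewrite cat_uniq; apply/and3P; split.
- by rewrite map_inj_uniq ?enum_uniq //; apply: lshift_inj.
- by apply/hasPn => x; rewrite mem_right_seq mem_left_seq -leqNgt.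
- by rewrite map_inj_uniq ?enum_uniq //; apply: rshift_inj.
Qed.

Lemma PQ_perm : perm_eq (left_seq ++ right_seq) (enum 'I_n).
Proof.
apply: uniq_perm; rewrite ?PQ_uniq ?enum_uniq // => x.
by rewrite mem_enum mem_cat mem_left_seq mem_right_seq; case: ltnP.
Qed.

Lemma embed_right_gfix a : gfix [pred x : 'I_n | (x < p)%N] (embed_right a).
Proof.
apply: (@eq_gfix _ _ [predC codom (@rshift p q)]); last exact: embed_gfix.
by move=> x /=; rewrite mem_codom_rshift -ltnNge.
Qed.

Lemma sym_left_gfix : gfix [pred x : 'I_n | (p <= x)%N] sym_left.
Proof.
apply: (@eq_gfix _ _ [predC left_seq]); last exact: label_sum_gfix.
by move=> x /=; rewrite mem_left_seq -leqNgt.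
Qed.

Lemma PQ_disjoint (x : 'I_n) : [pred x : 'I_n | (x < p)%N] x || [pred x : 'I_n | (p <= x)%N] x.
Proof. by rewrite /=; case: ltnP. Qed.

Lemma embed_right_sym_leftC a : embed_right a * sym_left = sym_left * embed_right a.
Proof. exact: (gfix_disjointC PQ_disjoint (@embed_right_gfix a) sym_left_gfix). Qed.

Lemma sym_left1 : sym_left 1%g = 1.
Proof. by rewrite label_sumE label_stab1 /lsgn. Qed.

Lemma card_label_stab_P : #|label_stab (fun=> 0%N) left_seq| = p`!.
Proof.
have uP : uniq left_seq by have := PQ_uniq; rewrite cat_uniq => /andP[].
have := card_perm [set x in left_seq]; rewrite cardsE (card_uniqP uP).
rewrite size_map size_enum_ord => <-; apply: eq_card => g.
apply/label_stabP/subsetP => [[H _] x|H].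
  by rewrite !inE; apply: contraR => /H ->.
split=> // x xP; apply/eqP; apply: contraR xP => gx.
by have := H x gx; rewrite inE.
Qed.

Lemma sym_left_idem : sym_left * sym_left = (p`!)%:R *: sym_left.
Proof. by rewrite label_sum_idem card_label_stab_P. Qed.

End Setup.

Section Multiplicity.
Variables (F : numFieldType) (p q : nat) (be : intpartn q) (nu : intpartn (p + q)).
Hypothesis ib : interlaced be nu.
Notation n := (p + q)%N.

Let pos y : {x : 'I_n | rowt nu x = rowt be y /\ colt nu x = colt be y}.
Proof.
have ex : exists x : 'I_n, (rowt nu x == rowt be y) && (colt nu x == colt be y).
  have [|x rx cx] := @tabt_surj _ nu (rowt be y) (colt be y).
    apply: leq_trans (colt_lt be y) _; by case: (elimT (interlacedP be nu) ib (rowt be y)).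
  by exists x; rewrite rx cx !eqxx.
exists (xchoose ex); by have /andP[/eqP-> /eqP->] := xchooseP ex.
Qed.

(** The points of Q are placed in the boxes of be, in the same rows and columns, so that those of P
    are left with the boxes of the strip. *)
Lemma strip_placement : exists g : 'S_n,
  (forall y, rowt nu (g (rshift p y)) = rowt be y /\ colt nu (g (rshift p y)) = colt be y) /\
  (forall x x' : 'I_n, (x < p)%N -> (x' < p)%N -> colt nu (g x) = colt nu (g x') -> x = x').
Proof.
have [|g gE] := @extend_rshift p q (fun y => sval (pos y)).
  move=> y y' E; have [r c] := svalP (pos y); have [r' c'] := svalP (pos y').
  by apply: (@tabt_inj _ be); rewrite -?r -?r' -?c -?c' E.
have gP y : rowt nu (g (rshift p y)) = rowt be y /\ colt nu (g (rshift p y)) = colt be y.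
  by rewrite gE; exact: (svalP (pos y)).
exists g; split=> // x x' xp x'p cE.
(* The boxes of be are taken by Q, so the upper of two strip boxes lies beyond its row of be, hence
   by interlacing beyond every lower row of nu, and its column cannot contain the other. *)
have main (z z' : 'I_n) : (z < p)%N -> colt nu (g z) = colt nu (g z') ->
    (rowt nu (g z) < rowt nu (g z'))%N -> False.
  move=> zp c r; case: (ltnP (colt nu (g z)) (row_len be (rowt nu (g z)))) => [lt|ge].
    have [y ry cy] := tabt_surj lt; have [r' c'] := gP y.
    have E : g z = g (rshift p y) by apply: (@tabt_inj _ nu); rewrite ?r' ?c' ?ry ?cy.
    by move: zp; rewrite (perm_inj E) /= ltnNge leq_addr.
  have [_ H] := elimT (interlacedP be nu) ib (rowt nu (g z)).
  have := colt_lt nu (g z'); rewrite -c; have := row_len_noninc nu r; lia.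
case: (ltngtP (rowt nu (g x)) (rowt nu (g x'))) => [/(main _ _ xp cE)|/(main _ _ x'p (esym cE))|rE] //.
by apply: (@perm_inj _ g); apply: (@tabt_inj _ nu).
Qed.

End Multiplicity.

Lemma gmul_supp (F : fieldType) (gT : finGroupType) (a b : galg F gT) g :
  (a * b) g != 0 -> exists h, a h != 0 /\ b (h^-1 * g)%g != 0.
Proof.
rewrite gmulE => nz; have /existsP[h] : [exists h, a h * b (h^-1 * g)%g != 0].
  apply: contraNT nz => /existsPn H; rewrite big1 // => h _.
  by apply/eqP; have := H h; rewrite negbK.
by rewrite mulf_eq0 negb_or => /andP[]; exists h.
Qed.

Lemma label_sum_supp (F : fieldType) (T : finType) eps (f : T -> nat) s g :
  label_sum F eps f s g != 0 -> g \in label_stab f s.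
Proof. by rewrite label_sumE; case: ifP => // _; rewrite eqxx. Qed.

Lemma label_sum_ge0 (F : numFieldType) (T : finType) (f : T -> nat) s g :
  0 <= label_sum F false f s g.
Proof. by rewrite label_sumE; case: ifP. Qed.

Section StripElement.
Variables (F : numFieldType) (p q : nat) (be : intpartn q).

Definition strip_elt : galg F 'S_(p + q) := embed_right p (young_symm F be) * sym_left F p q.
Definition strip_scale : F := symm_scale (young_symm F be) * (p`!)%:R.

Lemma strip_scale_neq0 : strip_scale != 0.
Proof. by rewrite mulf_neq0 ?(symm_scale_neq0 (young_symm_prim F be)) // pnatr_eq0 -lt0n fact_gt0. Qed.

Lemma strip_elt_sq : strip_elt * strip_elt = strip_scale *: strip_elt.
Proof.
rewrite /strip_elt -expr2 exprMn_comm ?expr2; last exact: embed_right_sym_leftC.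
by rewrite -embedM (prim_idem (young_symm_prim F be)) embedZ sym_left_idem -scalerAl -scalerAr scalerA.
Qed.

Lemma strip_elt1 : strip_elt 1%g = 1.
Proof.
rewrite (gfix_disjoint_trace (@PQ_disjoint p q) (@embed_right_gfix _ _ _ _) (@sym_left_gfix F p q)).
by rewrite embed_trace sym_left1 mulr1 (young_symm_prim F be).1.
Qed.

End StripElement.

Section Multiplicity.
Variables (F : numFieldType) (p q : nat) (be : intpartn q) (nu : intpartn (p + q)).
Hypothesis ib : interlaced be nu.
Notation n := (p + q)%N.
Notation A := (galg F 'S_n).

(* With e_nu read on a tableau of nu extending that of be, the coefficient of the
   identity counts factorizations w s c r = 1: each fixes the boxes of be, then
   the strip boxes, one per column, so that c = 1 and no sign occurs. *)
Lemma strip_product_neq0 : exists g : 'S_n,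
  embed_right p (young_symm F be) * sym_left F p q * gb F g * gstar (young_symm F nu) != 0.
Proof.
have [g [gQ gP]] := strip_placement ib; exists g.
set row' := rowt nu \o g; set col' := colt nu \o g.
pose R' := label_sum F false row' (enum 'I_n); pose C' := label_sum F true col' (enum 'I_n).
pose Rb := label_sum F false (rowt be) (enum 'I_q); pose Cb := label_sum F true (colt be) (enum 'I_q).
have row'E y : row' (rshift p y) = rowt be y by case: (gQ y).
have col'E y : col' (rshift p y) = colt be y by case: (gQ y).
have -> : gstar (young_symm F nu) = gb F g^-1 * (C' * R') * gb F g.
  have -> : C' = gb F g * label_sum F true (colt nu) (enum 'I_n) * gb F g^-1.
    exact/esym/label_sum_conj.
  have -> : R' = gb F g * label_sum F false (rowt nu) (enum 'I_n) * gb F g^-1.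
    exact/esym/label_sum_conj.
  rewrite /young_symm /ysym gstarM !star_label_sum -!mulrA !gbVK -gbM mulVg gb1 mulr1.
  by [].
rewrite !mulrA -(mulrA _ (gb F g)) -gbM mulgV gb1 mulr1.
apply/eqP => /(congr1 (fun a => a * gb F g^-1)); rewrite mul0r -!mulrA -gbM mulgV gb1 mulr1.
(* Column permutations of be preserve the columns of the placed tableau, so [C'] absorbs [Cb] with a
   positive factor. The factors left besides [C'] then have nonnegative coefficients. *)
have CbC' : embed_right p Cb * C' = #|label_stab (colt be) (enum 'I_q)|%:R *: C'.
  rewrite /embed_right /Cb {1}/label_sum embed_sum mulr_suml -[RHS]/(_ *: C').
  rewrite (eq_bigr (fun=> C')) ?sumr_const ?scaler_nat // => c cC.
  rewrite embedZ embed_gb -scalerAl gb_label_sum.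
    rewrite scalerA; have -> : lsgn F true (extp (@rshift_inj p q) c) = lsgn F true c.
      by rewrite /lsgn odd_extp.
    by rewrite lsgnK scale1r.
  apply/label_stabP; split=> x; first by rewrite mem_enum.
  case: (boolP (x \in codom (@rshift p q))) => [/codomP[y ->]|xh]; last by rewrite extp_out.
  by rewrite extp_h !col'E; case/label_stabP: cC.
rewrite mulrA /young_symm /ysym [embed_right p _]embedM -/(embed_right p Rb) -/(embed_right p Cb) -(mulrA (embed_right p Rb)).
rewrite embed_right_sym_leftC !mulrA -(mulrA _ (embed_right p Cb)) CbC' -scalerAr -scalerAl.
set w := embed_right p Rb * sym_left F p q; move/eqP; rewrite scaler_eq0 pnatr_eq0.
rewrite -leqn0 leqNgt (_ : (0 < _)%N); last by apply/card_gt0P; exists 1%g; apply: label_stab1.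
move=> /eqP/(congr1 (fun a : A => a 1%g)); rewrite galg0E.
have -> : (w * C' * R') 1%g = (C' * (R' * w)) 1%g by rewrite -mulrA gtraceC mulrA.
have w_ge0 k : 0 <= w k.
  rewrite gmulE; apply: sumr_ge0 => h _; apply: mulr_ge0; last exact: label_sum_ge0.
  rewrite galg_sumE; apply: sumr_ge0 => s _; rewrite galgZE ffunE mulr_ge0 ?label_sum_ge0 //.
have w1 : w 1%g = 1.
  rewrite (gfix_disjoint_trace (@PQ_disjoint p q) (@embed_right_gfix _ _ _ Rb) (@sym_left_gfix F p q)).
  by rewrite embed_trace sym_left1 label_sumE label_stab1 mulr1.
have y1 : 1 <= (R' * w) 1%g.
  rewrite gmulE (bigD1 1%g) //= invg1 mulg1 w1 label_sumE label_stab1 /lsgn mulr1 lerDl.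
  by apply: sumr_ge0 => h _; rewrite mulr_ge0 // label_sum_ge0.
rewrite gmulE (bigD1 1%g) //= big1 => [|c c1].
  rewrite addr0 label_sumE label_stab1 /lsgn odd_perm1 /= mul1r invg1 mulg1 => y0.
  by move: y1; rewrite y0 ler10.
case: (eqVneq (C' c) 0) => [->|/label_sum_supp cC]; first by rewrite mul0r.
case: (eqVneq ((R' * w) (c^-1 * 1)%g) 0) => [->|]; first by rewrite mulr0.
rewrite mulg1 => /gmul_supp[r [/label_sum_supp rR]]; set k := (r^-1 * c^-1)%g.
move=> /gmul_supp[h [/embed_supp[s /label_sum_supp/label_stabP[_ sR] hs] /sym_left_gfix/fixesP tP]].
case/eqP: c1; have cE : c = (k^-1 * r^-1)%g by rewrite /k invMg !invgK mulgK.
have /label_stabP[_ rV] : r^-1%g \in label_stab row' (enum 'I_n) by rewrite label_stabV.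
have kV y : (k^-1)%g (rshift p y) = rshift p (s^-1 y)%g.
  apply: (@perm_inj _ k); rewrite permKV.
  have -> : k = (h * (h^-1 * k))%g by rewrite mulKVg.
  by rewrite permM hs extp_h permKV -hs tP //= leq_addr.
have [_ cC2] := label_stabP _ _ _ cC.
have cQ y : c (rshift p y) = rshift p y.
  apply: (@perm_inj _ g); apply: (@tabt_inj _ nu); last exact: cC2.
  rewrite -[LHS]/(row' _) -[RHS]/(row' _) {1}cE permM rV kV !row'E.
  by rewrite -[in RHS](permKV s y) sR.
apply/permP => x; rewrite perm1; case: (ltnP x p) => [xp|px].
  apply: gP => //; last exact: cC2.
  rewrite ltnNge; apply/negP; rewrite -mem_codom_rshift => /codomP[y cy].
  have := cQ y; rewrite -cy => /perm_inj cx.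
  by move: xp; rewrite -cx cy /= ltnNge leq_addr.
have : x \in codom (@rshift p q) by rewrite mem_codom_rshift.
by case/codomP => y ->.
Qed.

(** The number m is the rank of v |-> a v b for the idempotents obtained by scaling the strip
    element and the reversed Young symmetrizer; it is positive because some group element has a
    nonzero image. The reversal does not affect the character. *)
Lemma strip_mult : exists2 m, (0 < m)%N &
  (chi_elt F nu * strip_elt F p be) 1%g = strip_scale F p be * m%:R.
Proof.
set k := strip_scale F p be; set e := young_symm F nu; set u := strip_elt F p be.
have prn := young_symm_prim F nu; have prb := young_symm_prim F be.
have k0 : k != 0 := strip_scale_neq0 F p be; have uu : u * u = k *: u := strip_elt_sq F p be.
pose a := k^-1 *: u; pose b := (symm_scale e)^-1 *: gstar e.
have aa : a * a = a by rewrite -scalerAl -scalerAr uu !scalerA mulfVK.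
have bb : b * b = b.
  by rewrite -scalerAl -scalerAr -gstarM (prim_idem prn) gstarZ !scalerA mulfVK // (symm_scale_neq0 prn).
have [m mE m0] := gtrace_idem_rank aa bb; exists m.
  rewrite lt0n; apply/negP => /eqP/m0 H; have [g] := strip_product_neq0.
  have := H g; rewrite /a /b -!scalerAl -scalerAr scalerA => /eqP.
  by rewrite scaler_eq0 mulf_eq0 !invr_eq0 (negPf k0) (negPf (symm_scale_neq0 prn)) /= => ->.
rewrite -mE gtrace_gsymC /a /b gsymZ gsym_star.
have -> : gstar (gsym e) = symm_scale e *: symm_char e.
  by rewrite -[gsym e]scale1r -(mulfV (symm_scale_neq0 prn)) -scalerA -/(symm_char e) gstarZ chi_elt_star.
rewrite scalerA mulVf ?scale1r ?(symm_scale_neq0 prn) // -[k^-1 *: u * _]scalerAl [in RHS]galgZE [RHS]mulrA mulfV // mul1r.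
exact: gtraceC.
Qed.

End Multiplicity.

Lemma poly_eq_horner (F : numFieldType) (r s : {poly F}) : (forall z, r.[z] = s.[z]) -> r = s.
Proof.
move=> E; apply/eqP; rewrite -subr_eq0; apply/eqP.
apply: (@roots_geq_poly_eq0 _ _ [seq i%:R | i <- iota 0 (size (r - s))]).
- by apply/allP => _ /mapP[i _ ->]; rewrite rootE hornerD hornerN E subrr.
- by rewrite map_inj_uniq ?iota_uniq // => i j /eqP; rewrite eqr_nat => /eqP.
- by rewrite size_map size_iota.
Qed.

(** * Contents and orthogonality of characters *)

Section Contents.
Variables (F : numFieldType) (n : nat).
Implicit Types (la mu : intpartn n).

Definition content_poly la : {poly F} := \prod_(x : 'I_n) ('X - ((rowt la x)%:R - (colt la x)%:R)%:P).

Lemma content_polyE la z : (content_poly la).[z] = \prod_x (z + (colt la x)%:R - (rowt la x)%:R).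
Proof.
rewrite horner_prod; apply: eq_bigr => x _.
by rewrite hornerXsubC opprB addrA.
Qed.

Lemma content_poly_neq0 la : content_poly la != 0.
Proof. by apply/monic_neq0/monic_prod_XsubC. Qed.

Let contents la : seq F := [seq (rowt la x)%:R - (colt la x)%:R | x <- enum 'I_n].

Let diag la i j := [set b : 'I_n * 'I_n | (b.2 < row_len la b.1)%N && (b.1 + j == b.2 + i)%N].

Let count_diag la i j : count_mem (i%:R - j%:R) (contents la) = #|diag la i j|.
Proof.
rewrite count_map -size_filter -sum1_size big_filter big_enum_cond /=.
rewrite -[RHS]sum1_card (eq_bigl (fun b : 'I_n * 'I_n => (b.2 < row_len la b.1)%N && (b.1 + j == b.2 + i)%N)).
  rewrite big_mkcondr /= -(big_boxes la addn (fun r c => if (r + j == c + i)%N then 1%N else 0%N) (leqnn n)).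
  rewrite big_mkcond; apply: eq_bigr => x _.
  congr (if _ then _ else _); rewrite subr_eq addrAC eq_sym subr_eq -!natrD eqr_nat eq_sym.
  by rewrite [(i + _)%N]addnC.
by move=> b; rewrite inE.
Qed.

(** At the first row i where the shapes differ, consider the diagonal of the last box of row i of
    la. Above row i the shapes agree; at row i and below, a box of mu on that diagonal would lie at
    or beyond the column of that last box, where mu has none. So la has more boxes of that
    content. *)
Let diag_lt la mu i : (forall i', (i' < i)%N -> row_len la i' = row_len mu i') ->
  (row_len mu i < row_len la i)%N ->
  (#|diag mu i (row_len la i).-1| < #|diag la i (row_len la i).-1|)%N.
Proof.
move=> eq_lt lt; have i_n : (i < n)%N.
  by rewrite ltnNge; apply/negP => /(row_len_default la) E; rewrite E in lt.
have j_n : ((row_len la i).-1 < n)%N.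
  rewrite -[X in (_ < X)%N](sum_row_len la (leqnn n)) (bigD1 (Ordinal i_n)) //=.
  apply: leq_trans (leq_addr _ _) => /=; lia.
apply/proper_card/properP; split.
  apply/subsetP => -[r c]; rewrite !inE /= => /andP[b_mu e]; rewrite e andbT.
  case: (ltngtP r i) => [bi|bi|bi]; first by rewrite eq_lt.
    have := row_len_noninc mu (ltnW bi); move/eqP: e; lia.
  by move: b_mu; rewrite bi; move: lt; lia.
exists (Ordinal i_n, Ordinal j_n); rewrite inE /=; first by move: lt; lia.
by move: lt; lia.
Qed.

Lemma content_poly_inj : injective content_poly.
Proof.
move=> la mu E; have pE : perm_eq (contents la) (contents mu).
  have cpE ka : content_poly ka = \prod_(c <- contents ka) ('X - c%:P).
    by rewrite /contents big_map big_enum.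
  by apply: prod_XsubC_eq; rewrite -!cpE.
have cE i j : #|diag la i j| = #|diag mu i j|.
  by rewrite -!count_diag; apply/seq.permP.
apply/eqP/negPn/negP => ne.
have ex : exists i, row_len la i != row_len mu i.
  have /existsP[j] : [exists j : 'I_n, row_len la j != row_len mu j].
    apply: contraNT ne => /existsPn H; apply/eqP/intpartn_ext => i.
    case: (ltnP i n) => [lt|ge]; last by rewrite !row_len_default.
    by apply/eqP; have := H (Ordinal lt); rewrite negbK.
  by exists j.
case: (ex_minnP ex) => i ne_i min_i.
have eq_lt i' : (i' < i)%N -> row_len la i' = row_len mu i'.
  by move=> lt; apply/eqP; apply: contraTT lt => /min_i; rewrite -leqNgt.
case: (ltngtP (row_len la i) (row_len mu i)) => [lt|lt|eq_i]; last by rewrite eq_i eqxx in ne_i.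
  have := @diag_lt mu la i (fun i' l => esym (eq_lt i' l)) lt.
  by rewrite cE ltnn.
by have := @diag_lt la mu i eq_lt lt; rewrite cE ltnn.
Qed.

Definition jm_full (z : F) : galg F 'S_n := jmprod z [::] (enum 'I_n).

Lemma jm_full_central z : gcentral (jm_full z).
Proof. by apply: jmprod_central; [apply: enum_uniq | move=> x; rewrite mem_enum]. Qed.

Lemma young_symm_jm_full la z : young_symm F la * jm_full z = (content_poly la).[z] *: young_symm F la.
Proof. by rewrite content_polyE; apply: ysym_jmprod; apply: tableau_t. Qed.

Lemma young_symm_jm_full1 la z : (young_symm F la * jm_full z) 1%g = (content_poly la).[z].
Proof. by rewrite young_symm_jm_full galgZE (young_symm_prim F la).1 mulr1. Qed.

Lemma chi_elt_jm_full la z : chi_elt F la * jm_full z = (content_poly la).[z] *: chi_elt F la.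
Proof.
by rewrite /chi_elt (symm_char_mul_central (young_symm_prim F la)) ?young_symm_jm_full1 //; apply: jm_full_central.
Qed.

Lemma chi_elt_orth la mu : la != mu -> chi_elt F la * chi_elt F mu = 0.
Proof.
move=> ne; apply/eqP; apply: contraNT ne => nz; apply/eqP/content_poly_inj/poly_eq_horner => z.
apply/eqP; apply: contraNT nz => ne.
apply/eqP; apply: (symm_char_orth (young_symm_prim F la) (young_symm_prim F mu) (jm_full_central z)).
by rewrite !young_symm_jm_full1.
Qed.

Definition chi_idem la : galg F 'S_n := symm_idem (young_symm F la).

Lemma chi_idemE la : chi_idem la = (symm_scale (young_symm F la))^-1 *: chi_elt F la. Proof. by []. Qed.

Lemma chi_idem_sum_idem (P : pred (intpartn n)) :
  (\sum_(la | P la) chi_idem la) * (\sum_(la | P la) chi_idem la) = \sum_(la | P la) chi_idem la.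
Proof.
rewrite mulr_suml; apply: eq_bigr => la Pla; rewrite mulr_sumr (bigD1 la) //= big1 => [|mu /andP[_ ne]].
  by rewrite addr0; apply: symm_idem_idem (young_symm_prim F la).
by rewrite !chi_idemE -scalerAl -scalerAr chi_elt_orth ?scaler0 // eq_sym.
Qed.

Lemma chi_idem_central la : gcentral (chi_idem la).
Proof. exact: symm_idem_central. Qed.

End Contents.

Lemma idem_compl (F : fieldType) (gT : finGroupType) (a : galg F gT) :
  a * a = a -> (1 - a) * (1 - a) = 1 - a.
Proof. by move=> aa; rewrite mulrBr mulr1 [(1 - a) * a]mulrBl mul1r aa subrr subr0. Qed.

Lemma gsym_central_self (F : fieldType) (gT : finGroupType) (z : galg F gT) :
  gcentral z -> gsym z = #|gT|%:R *: z.
Proof.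
move=> zC; rewrite /gsym (eq_bigr (fun=> z)) ?sumr_const ?scaler_nat // => g _.
by rewrite zC -mulrA -gbM mulVg gb1 mulr1.
Qed.

Lemma gcentralB (F : fieldType) (gT : finGroupType) (y z : galg F gT) :
  gcentral y -> gcentral z -> gcentral (y - z).
Proof. by move=> yC zC a; rewrite mulrBl mulrBr yC zC. Qed.

Lemma gcentral_sum (F : fieldType) (gT : finGroupType) (I : Type) (r : seq I) (P : pred I)
    (f : I -> galg F gT) :
  (forall i, P i -> gcentral (f i)) -> gcentral (\sum_(i <- r | P i) f i).
Proof.
by move=> fC a; rewrite mulr_sumr mulr_suml; apply: eq_bigr => i Pi; rewrite fC.
Qed.

Section Pieri.
Variables (F : numFieldType) (p q : nat) (be : intpartn q).
Notation n := (p + q)%N.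
Notation k := (strip_scale F p be).
Notation u := (strip_elt F p be).
Let b := k^-1 *: u.
Let E : galg F 'S_n := \sum_(nu | interlaced be nu) chi_idem F nu.
Let prb := young_symm_prim F be.
Let k0 : k != 0 := strip_scale_neq0 F p be.

Let bb : b * b = b.
Proof. by rewrite -scalerAl -scalerAr strip_elt_sq !scalerA mulfVK. Qed.

Let card_S m : #|{perm 'I_m}| = m`!.
Proof. by rewrite -(card_Sn m) /=; apply: eq_card. Qed.

Let card_n : #|{perm 'I_n}|%:R = k * ('C(n, p) * specht_dim F be)%:R :> F.
Proof.
rewrite card_S -(bin_fact (leq_addr q p)) addKn !natrM -(card_S q) -(symm_scale_dim prb) -/(specht_dim F be).
rewrite /strip_scale; ring.
Qed.

(** The map v |-> v b has trace n!/K, which is C(n, p) times the dimension of be. The central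
    idempotent E cuts out of it the expected constituents, with multiplicities g; the part cut out
    by 1 - E has rank m, and m = 0 means that E acts as the identity on u. *)
Let rank_ineq : exists g : intpartn n -> nat, exists m : nat,
  [/\ forall nu, interlaced be nu -> (0 < g nu)%N /\ (chi_elt F nu * u) 1%g = k * (g nu)%:R,
    ('C(n, p) * specht_dim F be = \sum_(nu | interlaced be nu) specht_dim F nu * g nu + m)%N &
    m = 0%N -> u = E * u].
Proof.
have ex nu : exists m, interlaced be nu -> (0 < m)%N /\ (chi_elt F nu * u) 1%g = k * m%:R.
  case: (boolP (interlaced be nu)) => [ib|]; last by exists 0%N.
  by have [m m0 mE] := strip_mult F ib; exists m.
have [g gP] := fin_all_exists ex; exists g.
have [m mE m0] := gtrace_idem_rank (idem_compl (chi_idem_sum_idem F (interlaced be))) bb.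
exists m; split => //; last first.
  move=> /m0/(_ 1%g); rewrite gb1 mulr1 /b -scalerAr => /eqP.
  by rewrite scaler_eq0 invr_eq0 (negPf k0) /= mulrBl mul1r subr_eq0 => /eqP.
apply/eqP; rewrite -(eqr_nat F) natrD -mE gsym_central_self; last first.
  by apply: gcentralB => [x|]; rewrite ?mulr1 ?mul1r //; apply: gcentral_sum => nu _; apply: chi_idem_central.
rewrite -scalerAl galgZE card_n /b -scalerAr galgZE mulrACA mulfV // mul1r.
rewrite mulrBl mul1r galgDE galgNE strip_elt1 mulrBr mulr1.
suff -> : ('C(n, p) * specht_dim F be)%:R * (E * u) 1%g = (\sum_(nu | interlaced be nu) specht_dim F nu * g nu)%:R.
  by rewrite addrC subrK.
rewrite mulr_suml galg_sumE mulr_sumr natr_sum; apply: eq_bigr => nu ib.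
have [_ gE] := gP nu ib; rewrite chi_idemE -scalerAl galgZE gE.
have kn0 := symm_scale_neq0 (young_symm_prim F nu).
transitivity ((symm_scale (young_symm F nu))^-1 * #|{perm 'I_n}|%:R * (g nu)%:R); first by rewrite card_n; ring.
by rewrite -(symm_scale_dim (young_symm_prim F nu)) mulKf // natrM.
Qed.

Lemma specht_dim_ind_ineq : (\sum_(nu : intpartn n | interlaced be nu) specht_dim F nu <= 'C(n, p) * specht_dim F be)%N.
Proof.
have [g [m [gP -> _]]] := rank_ineq; apply: leq_trans (leq_addr _ _).
by apply: leq_sum => nu /gP[g0 _]; apply: leq_pmulr.
Qed.

(* Each constituent of the strip occurs, and the dimensions leave no room for a
   larger multiplicity or for another constituent. *)
Lemma strip_elt_pieri_of :
  (\sum_(nu : intpartn n | interlaced be nu) specht_dim F nu = 'C(n, p) * specht_dim F be)%N ->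
  gsym u = k *: \sum_(nu | interlaced be nu) chi_elt F nu.
Proof.
move=> dimE; have [g [m [gP gE m0]]] := rank_ineq.
have le (nu : intpartn n) : interlaced be nu -> (specht_dim F nu <= specht_dim F nu * g nu)%N.
  by move=> /gP[g0 _]; apply: leq_pmulr.
have {}m0 : u = E * u.
  apply: m0; have : (\sum_(i : intpartn n | interlaced be i) specht_dim F i <=
      \sum_(i : intpartn n | interlaced be i) specht_dim F i * g i)%N by apply: leq_sum.
  by rewrite dimE gE -[leqRHS]addn0 leq_add2l leqn0 => /eqP.
have g1 (nu : intpartn n) : interlaced be nu -> g nu = 1%N.
  move=> ib; have := leqif_sum (fun nu ib => leqif_eq (le nu ib)).
  case=> le' /esym; have -> : (\sum_(i : intpartn n | interlaced be i) specht_dim F i == \sum_(i : intpartn n | interlaced be i) specht_dim F i * g i)%N.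
    by rewrite eqn_leq le' dimE gE leq_addr.
  move/forallP/(_ nu); rewrite ib /= => /eqP e.
  apply/eqP; rewrite -(eqn_pmul2l (symm_dim_gt0 (young_symm_prim F nu))) -/(specht_dim F nu) -e muln1.
  by [].
(* Since u = E u, the symmetrization splits along the central idempotents. On each it is a scalar
   multiple of the character, and the trace, now of multiplicity 1, determines the scalar. *)
rewrite {1}m0 gsymMl; last by apply: gcentral_sum => nu _; apply: chi_idem_central.
rewrite mulr_suml scaler_sumr; apply: eq_bigr => nu ib.
have [_] := gP nu ib; rewrite (g1 nu ib) mulr1 => trE.
have pn := young_symm_prim F nu; have kn0 := symm_scale_neq0 pn.
have fn0 : (specht_dim F nu)%:R != 0 :> F by rewrite pnatr_eq0 -lt0n; apply: symm_dim_gt0 pn.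
rewrite chi_idemE -scalerAl (symm_char_mul_central pn (gsym_central u)) scalerA; congr (_ *: _).
apply: (mulfI kn0); rewrite mulVKf //; apply: (mulIf fn0).
rewrite -/(symm_char _) -(symm_char_central_trace pn (gsym_central u)).
rewrite -gtrace_gsymC gsym_central_self; last exact: symm_char_central.
by rewrite -scalerAl galgZE trE -(symm_scale_dim pn) mulrAC.
Qed.

End Pieri.

Section Restriction.
Variables (F : numFieldType) (q : nat) (nu : intpartn (1 + q)).

Let eps1 : sym_left F 1 q = 1.
Proof.
rewrite /sym_left /left_seq; have -> : enum 'I_1 = [:: ord0].
  by apply: (inj_map val_inj); rewrite val_enum_ord.
by rewrite /= label_sum_cons //= big_nil scaler0 addr0 mulr1 label_sum_nil.
Qed.

Let E : galg F 'S_(1 + q) := \sum_(be : intpartn q | interlaced be nu) embed_right 1 (chi_idem F be).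
Let pn := young_symm_prim F nu.
Let b := (symm_scale (young_symm F nu))^-1 *: young_symm F nu.

Let EE : E * E = E.
Proof. by rewrite /E -embed_sum -embedM chi_idem_sum_idem. Qed.

Let bb : b * b = b.
Proof. by rewrite -scalerAl -scalerAr (prim_idem pn) !scalerA mulfVK // (symm_scale_neq0 pn). Qed.

(** Frobenius reciprocity: by cyclicity of the trace, the positive numbers of [strip_mult] for p = 1
    are also the multiplicities in the restriction. The complement 1 - E has a natural number as
    trace on the module of nu, so the part cut out by E is no larger than the module. *)
Lemma specht_dim_res_ineq : (\sum_(be : intpartn q | interlaced be nu) specht_dim F be <= specht_dim F nu)%N.
Proof.
have [m mE _] := gtrace_idem_rank (idem_compl EE) bb.
suff [M le1 trE] : exists2 M, (\sum_(be : intpartn q | interlaced be nu) specht_dim F be <= M)%N &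
    (gsym E * b) 1%g = M%:R.
  apply: leq_trans le1 _; rewrite -(ler_nat F) -subr_ge0.
  have -> : (specht_dim F nu)%:R = (gsym 1 * b) 1%g.
    rewrite gsym_central_self; last by move=> a; rewrite mulr1 mul1r.
    rewrite -scalerAl mul1r !galgZE (young_symm_prim F nu).1 mulr1 -(symm_scale_dim pn) mulrAC mulfV ?mul1r //.
    exact: symm_scale_neq0 pn.
  move: mE; rewrite -[- E]scaleN1r gsymD gsymZ scaleN1r mulrBl galgDE galgNE trE => ->.
  exact: ler0n.
have ex (be : intpartn q) : exists m, interlaced be nu -> (0 < m)%N /\
    (gsym (embed_right 1 (chi_idem F be)) * b) 1%g = (specht_dim F be * m)%:R.
  case: (boolP (interlaced be nu)) => [ib|]; last by exists 0%N.
  have [l l0 lE] := strip_mult F ib; exists l => _; split=> //.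
  have pb := young_symm_prim F be; have kb := symm_scale_neq0 pb.
  rewrite chi_idemE /chi_elt /symm_char scalerA [embed_right _ _]embedZ gsymZ.
  have := @embed_gsym F _ _ _ (@rshift_inj 1 q) (young_symm F be) 1.
  rewrite !mulr1 => ->; last by move=> s; rewrite mulr1 mul1r.
  rewrite scalerA -scalerAl galgZE gtrace_gsymC gsymZ -/(symm_char (young_symm F nu)) gtraceC.
  move: lE; rewrite /strip_elt eps1 mulr1 => ->.
  rewrite /strip_scale -(symm_scale_dim pb) natrM -/(specht_dim F be).
  have -> : symm_scale (young_symm F be) * 1`!%:R = symm_scale (young_symm F be) by rewrite mulr1.
  move: (symm_scale _) (specht_dim F be) kb => K f K0; field; exact: K0.
have [g gP] := fin_all_exists ex.
exists (\sum_(be : intpartn q | interlaced be nu) specht_dim F be * g be)%N.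
  by apply: leq_sum => be /gP[g0 _]; apply: leq_pmulr.
rewrite gsym_sum mulr_suml galg_sumE natr_sum; apply: eq_bigr => be ib.
by have [_ <-] := gP be ib.
Qed.

End Restriction.

(** The inequalities for a single added box suffice: through [f_pieri] they give the exact dimension
    count for strips of any length. *)
Lemma strip_elt_pieri (F : numFieldType) p q (be : intpartn q) :
  gsym (strip_elt F p be) = strip_scale F p be *: \sum_(nu : intpartn (p + q) | interlaced be nu) chi_elt F nu.
Proof.
apply: strip_elt_pieri_of.
apply: (f_pieri (f := fun n => @specht_dim F n)) => // [n nu|n be']; first exact: specht_dim_res_ineq.
by have := specht_dim_ind_ineq F 1 be'; rewrite bin1.
Qed.

(** * Crossing involutions *)

Section Crossing.
Variables (F : fieldType) (T : finType) (Q : pred T).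
Notation A := (galg F {perm T}).
Notation gb := (gb F).
Implicit Types (m t : {perm T}) (D : {set T}).

(* Involutions all of whose 2-cycles join a point of D to a point of Q. *)
Definition crossing D m := [forall x, (m (m x) == x) &&
  [|| m x == x, (x \in D) && Q (m x) | Q x && (m x \in D)]].

(** When D avoids Q, each 2-cycle has exactly one point outside Q, so this is the number of
    2-cycles. *)
Definition nmoved m := #|[set x | ~~ Q x && (m x != x)]|.

Definition crossset D r := [set m | crossing D m && (nmoved m == r)].

Definition crosssum D r : A := \sum_(m in crossset D r) gb m.

Lemma crossingP D m : reflect ((forall x, m (m x) = x) /\
    forall x, m x != x -> (x \in D) && Q (m x) || Q x && (m x \in D)) (crossing D m).
Proof.
apply: (iffP forallP) => [H|[H1 H2] x].
  split=> x; have /andP[/eqP e] := H x; first by [].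
  by move=> h mx; move: h; rewrite (negPf mx).
by rewrite H1 eqxx /=; case: eqVneq => //= /H2.
Qed.

Lemma crossing_conj D m t : (forall x, Q (t x) = Q x) ->
  crossing (t @: D) (m ^ t)%g = crossing D m.
Proof.
move=> tQ; have mt x : (m ^ t)%g (t x) = t (m x) by rewrite /conjg !permM permK.
have tD x : (t x \in t @: D) = (x \in D) by rewrite mem_imset //; apply: perm_inj.
apply/crossingP/crossingP => -[H1 H2]; split=> x.
- by apply: (@perm_inj _ t); rewrite -!mt H1.
- by move=> mx; have := H2 (t x); rewrite mt (inj_eq perm_inj) !tD !tQ; apply.
- by rewrite -(permKV t x) !mt H1.
by rewrite -(permKV t x) mt (inj_eq perm_inj) !tD !tQ; apply: H2.
Qed.

Lemma nmoved_conj m t : (forall x, Q (t x) = Q x) -> nmoved (m ^ t)%g = nmoved m.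
Proof.
move=> tQ; have mt x : (m ^ t)%g (t x) = t (m x) by rewrite /conjg !permM permK.
rewrite /nmoved -[RHS](card_imset _ (@perm_inj _ t)); apply: eq_card => x.
apply/idP/imsetP => [|[y]]; rewrite !inE; last first.
  by move=> H ->; rewrite mt (inj_eq perm_inj) tQ.
rewrite -(permKV t x) mt (inj_eq perm_inj) tQ => H.
by exists ((t^-1)%g x); rewrite ?inE.
Qed.

Lemma crossing_setD1 D m w : ~~ Q w -> crossing (D :\ w) m = crossing D m && (m w == w).
Proof.
move=> Qw; apply/crossingP/andP => [[H1 H2]|[/crossingP[H1 H2] /eqP mw]].
  split; last first.
    apply/negPn/negP => mw; have := H2 w mw.
    by rewrite !inE eqxx (negPf Qw).
  apply/crossingP; split=> // x /H2; rewrite !inE.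
  by case/orP => [/andP[/andP[_ ->] ->]|/andP[-> /andP[_ ->]]] //; rewrite orbT.
split=> // x mx; rewrite !inE.
have xw : x != w by apply: contraNneq mx => ->; rewrite mw.
have mxw : m x != w by apply: contraNneq xw => e; rewrite -(H1 x) e mw.
by rewrite xw mxw /=; apply: H2.
Qed.

Lemma crossing_fix D m x : x \notin D -> ~~ Q x -> crossing D m -> m x = x.
Proof.
move=> xD xQ /crossingP[_ H]; apply/eqP/negPn/negP => /H.
by rewrite (negPf xD) (negPf xQ).
Qed.

Lemma tperm_Q w y x : ~~ Q w -> ~~ Q y -> Q (tperm w y x) = Q x.
Proof. by move=> Qw Qy; case: tpermP => // ->; rewrite (negPf Qw) (negPf Qy). Qed.

(** The role of w is handed over to the new point y, which leaves w fixed; this reindexes the terms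
    of the recursion in which w was moved. *)
Lemma crossing_conj_tperm D m w y : w \in D -> y \notin D -> ~~ Q w -> ~~ Q y ->
  crossing D m = crossing (y |: D) (m ^ tperm w y)%g && ((m ^ tperm w y)%g w == w).
Proof.
move=> wD yD Qw Qy; rewrite -crossing_setD1 //.
have <- : tperm w y @: D = (y |: D) :\ w.
  apply/setP => x; rewrite !inE; apply/imsetP/idP => [[z zD ->]|].
    case: tpermP => [_|zy|/eqP zw /eqP zy]; last by rewrite zw zD orbT.
      by rewrite eqxx andbT; apply: contraNneq yD => ->.
    by rewrite -zy zD in yD.
  case/andP => xw /orP[/eqP ->|xD]; first by exists w; rewrite ?tpermL.
  have yx : y != x by apply: contraNneq yD => ->.
  by exists x; rewrite ?tpermD // eq_sym.
by rewrite crossing_conj // => x; apply: tperm_Q.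
Qed.

Lemma nmoved_disjoint D m : (forall x, x \in D -> ~~ Q x) -> crossing D m ->
  nmoved m = #|[set x in D | m x != x]|.
Proof.
move=> DQ mD; apply: eq_card => x; rewrite !inE.
apply/andP/andP => [[Qx mx]|[xD mx]]; split=> //; last exact: DQ.
by apply: contraR mx => xD; rewrite (crossing_fix xD Qx mD).
Qed.

Lemma nmovedQ D m : (forall x, x \in D -> ~~ Q x) -> crossing D m ->
  #|[set x | Q x && (m x != x)]| = nmoved m.
Proof.
move=> DQ mD; rewrite /nmoved -[RHS](card_imset _ (@perm_inj _ m)).
have [H1 H2] := crossingP _ _ mD.
apply: eq_card => x; rewrite !inE; apply/andP/imsetP => [[Qx mx]|[y]].
  exists (m x); last by rewrite H1.
  rewrite inE H1 eq_sym mx andbT.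
  by case/orP: (H2 x mx) => /andP[]; [move=> /DQ; rewrite Qx | move=> _ /DQ].
rewrite inE => /andP[Qy my] ->; rewrite H1 eq_sym my.
by case/orP: (H2 y my) => /andP[] //; rewrite (negPf Qy).
Qed.

(** Multiplication by (a y) adds a 2-cycle to an involution that fixes both points; m fixes y
    because y is neither in D nor in Q. *)
Lemma crossing_mul_tperm D m a y : Q a -> ~~ Q y -> y \notin D ->
  crossing D m && (m a == a) =
  crossing (y |: D) (m * tperm a y)%g && ((m * tperm a y)%g y == a).
Proof.
move=> Qa Qy yD; have ay : a != y by apply: contraNneq Qy => <-.
apply/andP/andP => [[mD /eqP ma]|[mD /eqP my]].
  have my := crossing_fix yD Qy mD; have [H1 H2] := crossingP _ _ mD.
  have mta : (m * tperm a y)%g a = y by rewrite permM ma tpermL.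
  have mty : (m * tperm a y)%g y = a by rewrite permM my tpermR.
  have mt x : x != a -> x != y -> (m * tperm a y)%g x = m x.
    move=> xa xy; rewrite permM tpermD //.
      by apply: contraNneq xa => e; rewrite -(H1 x) -e ma.
    by apply: contraNneq xy => e; rewrite -(H1 x) -e my.
  split; last by rewrite mty.
  apply/crossingP; split=> x.
    case: (eqVneq x a) => [->|xa]; first by rewrite mta.
    case: (eqVneq x y) => [->|xy]; first by rewrite mty.
    rewrite mt // mt ?H1 //.
      by apply: contraNneq xa => e; rewrite -(H1 x) e ma.
    by apply: contraNneq xy => e; rewrite -(H1 x) e my.
  case: (eqVneq x a) => [->|xa]; first by rewrite mta Qa !inE eqxx orbT.
  case: (eqVneq x y) => [->|xy]; first by rewrite mty Qa !inE eqxx.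
  rewrite mt // => /H2; rewrite !inE.
  by case/orP => /andP[-> ->]; rewrite !orbT.
have [H1 H2] := crossingP _ _ mD; set t := (m * tperm a y)%g in my mD H1 H2.
have ta : t a = y by rewrite -my H1.
have mE : m = (t * tperm a y)%g by rewrite /t -mulgA tperm2 mulg1.
have m_a : m a = a by rewrite mE permM ta tpermR.
have m_y : m y = y by rewrite mE permM my tpermL.
have mt x : x != a -> x != y -> m x = t x.
  move=> xa xy; rewrite mE permM tpermD //.
    by apply: contraNneq xy => e; rewrite -(H1 x) -e ta.
  by apply: contraNneq xa => e; rewrite -(H1 x) -e my.
split; last by rewrite m_a.
apply/crossingP; split=> x.
  case: (eqVneq x a) => [->|xa]; first by rewrite !m_a.
  case: (eqVneq x y) => [->|xy]; first by rewrite !m_y.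
  rewrite mt // mt ?H1 //.
    by apply: contraNneq xy => e; rewrite -(H1 x) e ta.
  by apply: contraNneq xa => e; rewrite -(H1 x) e my.
case: (eqVneq x a) => [->|xa]; first by rewrite m_a eqxx.
case: (eqVneq x y) => [->|xy]; first by rewrite m_y eqxx.
rewrite mt // => /H2; rewrite !inE (negPf xy) /=.
case: (eqVneq (t x) y) => [e|_] //=.
by case/eqP: xa; rewrite -(H1 x) e my.
Qed.

Lemma nmoved_mul_tperm D m a y : Q a -> ~~ Q y -> y \notin D ->
  crossing D m -> m a = a -> nmoved (m * tperm a y)%g = (nmoved m).+1.
Proof.
move=> Qa Qy yD mD ma; have my := crossing_fix yD Qy mD.
have ay : a != y by apply: contraNneq Qy => <-.
have [H1 _] := crossingP _ _ mD.
rewrite /nmoved; set S := [set x | ~~ Q x && (m x != x)].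
have -> : [set x | ~~ Q x && ((m * tperm a y)%g x != x)] = y |: S.
  apply/setP => x; rewrite !inE permM.
  case: (eqVneq x y) => [->|xy] /=; first by rewrite my tpermR Qy ay.
  case: (boolP (Q x)) => //= Qx.
  have xa : x != a by apply: contraNneq Qx => ->.
  rewrite tpermD //.
    by apply: contraNneq xa => e; rewrite -(H1 x) -e ma.
  by apply: contraNneq xy => e; rewrite -(H1 x) -e my.
by rewrite cardsU1 !inE my eqxx andbF.
Qed.

Lemma crossset_split D y r : ~~ Q y -> y \notin D ->
  crosssum (y |: D) r = crosssum D r + \sum_(m in crossset (y |: D) r | m y != y) gb m.
Proof.
move=> Qy yD; rewrite /crosssum (bigID (fun m => m y == y)) /=; congr (_ + _).
apply: eq_bigl => m; rewrite !inE andbAC -crossing_setD1 //.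
by rewrite setU1K.
Qed.

End Crossing.

Definition rising (F : fieldType) (p r : nat) (z : F) : F := \prod_(r <= i < p) (z + i%:R).

Section Recursion.
Variables (F : fieldType) (T : finType) (Q : pred T).
Notation A := (galg F {perm T}).
Notation gb := (gb F).
Variable eps : A.
Hypothesis epsH : forall w y, ~~ Q w -> ~~ Q y -> eps * gb (tperm w y) = eps.

Section Step.
Variables (D : {set T}) (y : T).
Hypotheses (DQ : forall x, x \in D -> ~~ Q x) (yD : y \notin D) (Qy : ~~ Q y).

Definition crossnew r : A := \sum_(m in crossset Q (y |: D) r | m y != y) gb m.

Let fixD (m : {perm T}) := #|[set x in D | m x == x]|.

Let fixD_old m r : m \in crossset Q D r -> (fixD m + r)%N = #|D|.
Proof.
rewrite inE => /andP[mD /eqP <-]; rewrite (nmoved_disjoint DQ mD) -(cardsID [set x | m x == x] D).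
by congr (_ + _)%N; apply: eq_card => x; rewrite !inE // andbC.
Qed.

Let fixD_new m r : m \in crossset Q (y |: D) r -> m y != y -> (fixD m + r)%N = #|D|.+1.
Proof.
rewrite inE => /andP[mD /eqP <-] my.
have DQ' x : x \in y |: D -> ~~ Q x by rewrite !inE => /orP[/eqP->|/DQ].
rewrite (nmoved_disjoint DQ' mD) -(cardsID [set x | m x == x] D) -addnS; congr (_ + _)%N.
  by apply: eq_card => x; rewrite !inE.
have -> : [set x in y |: D | m x != x] = y |: (D :\: [set x | m x == x]).
  apply/setP => x; rewrite !inE; case: (eqVneq x y) => [->|_] //=; last by rewrite andbC.
by rewrite cardsU1 !inE (negPf yD) andbF.
Qed.

(* eps absorbs on its left end the transpositions of points outside Q: if m w = w
   then m (w y) = (w y) m, and otherwise m (w y) = (w y) m^(w y), where m^(w y)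
   moves y instead of w. *)
Let stepP r : \sum_(w in D) eps * crosssum F Q D r * gb (tperm w y) =
  \sum_(m in crossset Q D r) (fixD m)%:R *: (eps * gb m) +
  \sum_(m in crossset Q (y |: D) r | m y != y) (fixD m)%:R *: (eps * gb m).
Proof.
have split1 (w : T) : w \in D -> eps * crosssum F Q D r * gb (tperm w y) =
    \sum_(m in crossset Q D r | m w == w) eps * gb m +
    \sum_(m in crossset Q (y |: D) r | (m y != y) && (m w == w)) eps * gb m.
  move=> wD; have Qw := DQ wD.
  have conjE m : eps * (gb m * gb (tperm w y)) = eps * gb (m ^ tperm w y)%g.
    by rewrite -gbM conjgC gbM mulrA epsH.
  rewrite /crosssum mulr_sumr mulr_suml (bigID (fun m : {perm T} => m w == w)) /=; congr (_ + _).
    apply: eq_bigr => m; rewrite inE => /andP[/andP[mD _] /eqP mw].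
    have my := crossing_fix yD Qy mD.
    rewrite -mulrA -gbM; have -> : (m * tperm w y = tperm w y * m)%g.
      by rewrite [RHS]conjgC tpermJ mw my.
    by rewrite gbM mulrA epsH.
  rewrite [RHS](reindex_inj (conjg_inj (tperm w y))) /=; apply: eq_big => m; last first.
    by rewrite -mulrA conjE.
  rewrite !inE (crossing_conj_tperm m wD yD Qw Qy).
  have -> : nmoved Q (m ^ tperm w y)%g = nmoved Q m.
    by apply: nmoved_conj => x; apply: tperm_Q.
  have -> : ((m ^ tperm w y)%g y != y) = (m w != w).
    have -> : (m ^ tperm w y)%g y = tperm w y (m w) by rewrite /conjg !permM tpermV tpermR.
    by rewrite -[X in _ != X](tpermL w y) (inj_eq perm_inj).
  by case: (m w != w); case: (nmoved Q m == r); rewrite ?andbT ?andbF.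
rewrite (eq_bigr _ split1) big_split /=; congr (_ + _).
  rewrite (exchange_big_dep (mem (crossset Q D r))) /=; last by move=> w m _ /andP[].
  apply: eq_bigr => m mD; rewrite sumr_const -scaler_nat; congr (_%:R *: _).
  by apply: eq_card => w; move: mD; rewrite !inE => ->.
rewrite (exchange_big_dep (fun m => (m \in crossset Q (y |: D) r) && (m y != y))) /=; last first.
  by move=> w m _ /and3P[-> ->].
apply: eq_bigr => m /andP[mD my]; rewrite sumr_const -scaler_nat; congr (_%:R *: _).
by apply: eq_card => w; move: mD; rewrite !inE => ->; rewrite my.
Qed.

(* If m a = w differs from a then m (a y) = (w y) m; otherwise m (a y) has the new
   2-cycle (a y). *)
Let stepQ r : \sum_(a | Q a) eps * crosssum F Q D r * gb (tperm a y) =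
  r%:R *: (eps * crosssum F Q D r) + eps * crossnew r.+1.
Proof.
have split1 (a : T) : Q a -> eps * crosssum F Q D r * gb (tperm a y) =
    \sum_(m in crossset Q D r | m a != a) eps * gb m +
    \sum_(m in crossset Q (y |: D) r.+1 | (m y != y) && (m y == a)) eps * gb m.
  move=> Qa; have ay : a != y by apply: contraNneq Qy => <-.
  rewrite /crosssum mulr_sumr mulr_suml (bigID (fun m : {perm T} => m a != a)) /=; congr (_ + _).
    apply: eq_bigr => m; rewrite inE => /andP[/andP[mD _] ma].
    have [H1 H2] := crossingP _ _ _ mD; have my := crossing_fix yD Qy mD.
    have Qma : ~~ Q (m a).
      by case/orP: (H2 a ma) => /andP[]; [move/DQ; rewrite Qa | move=> _ /DQ].
    rewrite -mulrA -gbM; have -> : (m * tperm a y = tperm (m a) y * m)%g.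
      by rewrite [RHS]conjgC tpermJ H1 my.
    by rewrite gbM mulrA epsH.
  rewrite [RHS](reindex_inj (mulIg (tperm a y))) /=; apply: eq_big => m.
    rewrite !inE negbK andbAC (crossing_mul_tperm m Qa Qy yD).
    case: (boolP (crossing Q (y |: D) (m * tperm a y)%g)) => //= mD'.
    case: (eqVneq ((m * tperm a y)%g y) a) => my; rewrite ?andbF //= my ay !andbT.
    have /andP[mD /eqP ma] : crossing Q D m && (m a == a).
      by rewrite (crossing_mul_tperm m Qa Qy yD) mD' my eqxx.
    by rewrite (nmoved_mul_tperm Qa Qy yD mD ma) eqSS.
  by rewrite -mulrA -gbM.
rewrite (eq_bigr _ split1) big_split /=; congr (_ + _).
  rewrite (exchange_big_dep (mem (crossset Q D r))) /=; last by move=> w m _ /andP[].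
  rewrite /crosssum mulr_sumr scaler_sumr.
  apply: eq_bigr => m mD; rewrite sumr_const -scaler_nat; congr (_%:R *: _).
  have := mD; rewrite inE => /andP[mc /eqP rE]; apply: etrans (etrans (nmovedQ DQ mc) rE).
  by apply: eq_card => w; move: mD; rewrite !inE => ->.
rewrite /crossnew mulr_sumr [RHS](partition_big (fun m : {perm T} => m y) Q) /=; last first.
  move=> m /andP[]; rewrite inE => /andP[/crossingP[_ H2] _] /H2.
  by rewrite (negPf Qy) orbF => /andP[].
by apply: eq_bigr => a _; apply: eq_bigl => m; rewrite andbA.
Qed.

(** The transpositions of y with D yield an involution once for each point of D that it fixes: #|D|
    - r for one that fixes y, #|D| + 1 - r for one that moves y. Those with Q yield each old
    involution r times, once per 2-cycle, so r cancels from its coefficient, and create the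
    involutions with r + 1 cycles. *)
Lemma cross_step (z : F) (s Qs : seq T) r : uniq s -> s =i D -> uniq Qs -> Qs =i Q ->
  eps * crosssum F Q D r * (z%:A + jm F y (s ++ Qs)) =
  (z + #|D|%:R) *: (eps * crosssum F Q D r) +
  (#|D|%:R + 1 - r%:R) *: (eps * crossnew r) + eps * crossnew r.+1.
Proof.
move=> us sD uQ QsQ.
have -> : jm F y (s ++ Qs) = \sum_(w in D) gb (tperm w y) + \sum_(a | Q a) gb (tperm a y).
  rewrite /jm big_cat !big_uniq //; congr (_ + _); apply: eq_bigl => x; first exact: sD.
  exact: QsQ.
have eP := stepP r; rewrite -mulr_sumr in eP; have eQ := stepQ r; rewrite -mulr_sumr in eQ.
rewrite mulrDr mulrDr eP eQ -scalerAr mulr1.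
have -> : \sum_(m in crossset Q D r) (fixD m)%:R *: (eps * gb m) =
    (#|D|%:R - r%:R) *: (eps * crosssum F Q D r).
  rewrite mulr_sumr scaler_sumr; apply: eq_bigr => m mD; congr (_ *: _).
  by rewrite -(fixD_old mD) natrD addrK.
have -> : \sum_(m in crossset Q (y |: D) r | m y != y) (fixD m)%:R *: (eps * gb m) =
    (#|D|%:R + 1 - r%:R) *: (eps * crossnew r).
  rewrite mulr_sumr scaler_sumr; apply: eq_bigr => m /andP[mD my]; congr (_ *: _).
  by rewrite natr1 -(fixD_new mD my) natrD addrK.
rewrite !addrA; congr (_ + _); rewrite -!addrA [_ *: (eps * crossnew _) + _]addrC !addrA.
by congr (_ + _); rewrite -!scalerDl; congr (_ *: _); rewrite -addrA subrK.
Qed.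

Lemma crossnew0 : crossnew 0 = 0.
Proof.
apply: big1 => m /andP[]; rewrite inE => /andP[_]; rewrite cards_eq0 => /eqP/setP/(_ y).
by rewrite !inE Qy /= => /negbFE/eqP ->; rewrite eqxx.
Qed.

End Step.

Lemma crosssum_gt (D : {set T}) r : (forall x, x \in D -> ~~ Q x) -> (#|D| < r)%N -> crosssum F Q D r = 0.
Proof.
move=> DQ lt; apply: big1 => m; rewrite inE => /andP[mD /eqP mr]; move: lt.
rewrite -mr (nmoved_disjoint DQ mD) ltnNge subset_leq_card //.
by apply/subsetP => x; rewrite inE => /andP[].
Qed.

Lemma crosssum00 : crosssum F Q set0 0 = 1.
Proof.
rewrite /crosssum (big_pred1 1%g) ?gb1 // => m; apply/idP/eqP => [|->].
  rewrite inE => /andP[mD _]; apply/permP => x; rewrite perm1.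
  have [_ H] := crossingP _ _ _ mD; apply/eqP/negPn/negP => /H.
  by rewrite !inE andbF.
rewrite inE; apply/andP; split; first by apply/crossingP; split=> x; rewrite ?perm1 ?eqxx.
by rewrite cards_eq0; apply/eqP/setP => x; rewrite !inE perm1 eqxx andbF.
Qed.

Lemma risingS p r (z : F) : (r <= p)%N -> rising p.+1 r z = rising p r z * (z + p%:R).
Proof. by move=> rp; rewrite /rising big_nat_recr. Qed.

Lemma rising_rec p r (z : F) : (r < p)%N -> rising p r z = (z + r%:R) * rising p r.+1 z.
Proof. by move=> rp; rewrite /rising big_ltn. Qed.

Lemma rising_ge p r (z : F) : (p <= r)%N -> rising p r z = 1.
Proof. by move=> rp; rewrite /rising big_geq. Qed.

Lemma cross_expansion (z : F) (s Qs : seq T) : uniq s -> (forall x, x \in s -> ~~ Q x) ->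
    uniq Qs -> Qs =i Q ->
  eps * jmprod z Qs s =
  \sum_(r < (size s).+1) rising (size s) r z *: (eps * crosssum F Q [set x in s] r).
Proof.
move=> us sQ uQ QsQ; elim: s us sQ => [|y s IH] /= us sQ.
  rewrite big_ord1 /= rising_ge // scale1r; congr (_ * _).
  by rewrite -crosssum00; congr crosssum; apply/setP => x; rewrite !inE.
have [ys us'] := andP us; have Qy : ~~ Q y by apply: sQ; rewrite mem_head.
have sQ' x : x \in s -> ~~ Q x by move=> xs; apply: sQ; rewrite inE xs orbT.
set D := [set x in s]; have DQ x : x \in D -> ~~ Q x by rewrite inE; apply: sQ'.
have yD : y \notin D by rewrite inE.
have sD : s =i D by move=> x; rewrite inE.
have cD : #|D| = size s by rewrite cardsE; apply/card_uniqP.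
have -> : [set x in y :: s] = y |: D by apply/setP => x; rewrite !inE.
rewrite mulrA IH // mulr_suml; set p := size s.
have step r : rising p r z *: (eps * crosssum F Q D r) * (z%:A + jm F y (s ++ Qs)) =
    (rising p r z * (z + p%:R)) *: (eps * crosssum F Q D r) +
    ((rising p r z * (p%:R + 1 - r%:R)) *: (eps * crossnew D y r) +
     rising p r z *: (eps * crossnew D y r.+1)).
  rewrite -scalerAl (cross_step DQ yD Qy z r us' sD uQ QsQ) cD -/p !scalerDr !scalerA.
  by rewrite -addrA.
rewrite (eq_bigr _ (fun (r : 'I_p.+1) _ => step r)) !big_split /=.
have spl r : rising p.+1 r z *: (eps * crosssum F Q (y |: D) r) =
    rising p.+1 r z *: (eps * crosssum F Q D r) + rising p.+1 r z *: (eps * crossnew D y r).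
  by rewrite (crossset_split F r Qy yD) mulrDr scalerDr.
rewrite [RHS](eq_bigr _ (fun (r : 'I_p.+2) _ => spl r)) big_split /=; congr (_ + _).
  rewrite [RHS]big_ord_recr /= crosssum_gt ?cD // mulr0 scaler0 addr0.
  by apply: eq_bigr => r _; rewrite risingS // -ltnS.
rewrite [RHS]big_ord_recl /= (crossnew0 D Qy) mulr0 scaler0 add0r.
(* Shift of the index by one: the term r = 0 is empty since no involution without 2-cycles moves y,
   and the new term r = p carries the factor p - r = 0. *)
have -> : \sum_(r < p.+1) (rising p r z * (p%:R + 1 - r%:R)) *: (eps * crossnew D y r) =
   \sum_(r < p.+1) (rising p r.+1 z * (p%:R - r%:R)) *: (eps * crossnew D y r.+1).
  rewrite big_ord_recl /= (crossnew0 D Qy) mulr0 scaler0 add0r [RHS]big_ord_recr /= subrr mulr0 scale0r addr0.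
  apply: eq_bigr => r _; rewrite /bump leq0n add1n; congr ((_ * _) *: _).
  by rewrite -natr1 opprD addrACA subrr addr0.
rewrite -big_split; apply: eq_bigr => -[r rp] _ /=; rewrite /bump leq0n add1n -scalerDl; congr (_ *: _).
move: rp; rewrite ltnS leq_eqVlt => /orP[/eqP ->|rp].
  by rewrite subrr mulr0 add0r !rising_ge.
(* After extraction of [rising p r.+1 z], the two coefficients add up as (p - r) + (z + r) = z +
   p. *)
rewrite risingS // (rising_rec _ rp); ring.
Qed.

End Recursion.

(** * The strip identity *)

Section FiniteDifference.
Variable F : numFieldType.

(** At z = j - p + 1 the factors z + i with p - l <= i < p run from j - l + 1 to j, and one of them
    is 0 when j < l. *)
Lemma rising_ffact p l j : (l <= p)%N ->
  rising p (p - l) (j%:R - p%:R + 1 : F) = (j ^_ l)%:R.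
Proof.
elim: l => [|l IH] lp; first by rewrite subn0 rising_ge.
rewrite rising_rec; last by lia.
have -> : (p - l.+1).+1 = (p - l)%N by lia.
rewrite (IH (ltnW lp)).
rewrite ffactnSr.
rewrite [in RHS]natrM.
rewrite [RHS]mulrC.
case: (ltnP j l) => [lt|le]; first by rewrite ffact_small // !mulr0.
congr (_ * _); rewrite natrB // natrB //= -natr1; ring.
Qed.

(** The M-th finite difference at 0 of a falling factorial. The identity C(M, j) j^_l = M^_l C(M -
    l, j - l) reduces it to the binomial expansion of (1 - 1)^(M - l). *)
Lemma sum_alt_ffact M l :
  \sum_(0 <= j < M.+1) (-1) ^+ (M - j) * 'C(M, j)%:R * (j ^_ l)%:R = (M`! * (l == M))%:R :> F.
Proof.
case: (ltnP M l) => [Ml|lM].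
  rewrite gtn_eqF // muln0 big_nat big1 // => j /andP[_]; rewrite ltnS => jM.
  by rewrite ffact_small ?mulr0 // (leq_ltn_trans jM).
rewrite (big_cat_nat (n := l)) //= ?(leqW lM) // big_nat big1 ?add0r => [|j /andP[_ jl]]; last first.
  by rewrite ffact_small ?mulr0.
have E j : (l <= j <= M)%N -> ('C(M, j) * j ^_ l = M ^_ l * 'C(M - l, j - l))%N.
  move=> /andP[lj jM]; apply/eqP; rewrite -(eqn_pmul2r (fact_gt0 (j - l))).
  rewrite -mulnA ffact_fact // -(eqn_pmul2r (fact_gt0 (M - j))) -mulnA bin_fact //.
  rewrite -!mulnA; have -> : (M - j = M - l - (j - l))%N by lia.
  by rewrite bin_fact ?ffact_fact // leq_sub2r.
transitivity (\sum_(0 <= i < (M - l).+1) (M ^_ l)%:R * ((-1) ^+ (M - l - i) * 'C(M - l, i)%:R) : F).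
  rewrite -{1}[l]add0n big_addn -subSn //.
  apply: eq_big_nat => i /andP[_ iM]; rewrite -mulrA -natrM E; last by lia.
  rewrite addnK natrM mulrCA; congr (_ * (_ ^+ _ * _)); lia.
rewrite -mulr_sumr big_mkord.
have := exprDn (-1 : F) 1 (M - l); rewrite addNr => e.
have -> : \sum_(i < (M - l).+1) (-1) ^+ (M - l - i) * 'C(M - l, i)%:R = 0 ^+ (M - l) :> F.
  by rewrite e; apply: eq_bigr => i _; rewrite expr1n mulr1 mulr_natr.
case: eqVneq => [->|ne]; first by rewrite subnn expr0 mulr1 muln1 ffactnn.
by rewrite expr0n subn_eq0 leqNgt ltn_neqAle ne lM mulr0 muln0.
Qed.

Lemma rising_difference p k r : (r <= p)%N -> (k <= p)%N ->
  ((p - k)`!%:R)^-1 * \sum_(0 <= j < (p - k).+1)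
     (-1) ^+ (p - k - j) * 'C(p - k, j)%:R * rising p r (j%:R - p%:R + 1) = (r == k)%:R :> F.
Proof.
move=> rp kp; have -> : r = (p - (p - r))%N by lia.
under eq_bigr => j _ do rewrite rising_ffact ?leq_subr //.
rewrite sum_alt_ffact natrM mulKf ?pnatr_eq0 -?lt0n ?fact_gt0 //; congr (_%:R); congr nat_of_bool.
by apply/eqP/eqP; lia.
Qed.

End FiniteDifference.

Section Strip.
Variables (F : numFieldType) (p q : nat) (be : intpartn q).
Notation n := (p + q)%N.
Notation u := (strip_elt F p be).
Notation K := (strip_scale F p be).

Definition Tcross r : galg F 'S_n :=
  crosssum F [pred x : 'I_n | (p <= x)%N] [set x in left_seq p q] r.

Lemma sym_left_tperm (w y : 'I_n) : ~~ (p <= w)%N -> ~~ (p <= y)%N -> sym_left F p q * gb F (tperm w y) = sym_left F p q.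
Proof.
rewrite -!ltnNge => wp yp; rewrite label_sum_gb ?scale1r //.
by apply: label_stab_tperm; rewrite ?mem_left_seq.
Qed.

(** The points of Q are added first: their factors act on the Young symmetrizer by the contents of
    be, while those of P run over the other points of P and all of Q, and expand by
    [cross_expansion]. *)
Lemma strip_elt_jm_full z : u * jm_full n z =
  (content_poly F be).[z] *: \sum_(r < p.+1) rising p r z *: (u * Tcross r).
Proof.
have -> : jm_full n z = embed_right p (jm_full q z) * jmprod z (right_seq p q) (left_seq p q).
  rewrite /jm_full /embed_right embed_jmprod -/(right_seq p q) /= -jmprod_cat.
  by apply/esym/jmprod_perm; rewrite ?cats0 ?PQ_uniq ?PQ_perm.
have uP : uniq (left_seq p q) by have := PQ_uniq p q; rewrite cat_uniq => /andP[].
have uQ : uniq (right_seq p q) by have := PQ_uniq p q; rewrite cat_uniq => /and3P[].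
rewrite /strip_elt mulrA -(mulrA _ (sym_left F p q)) -embed_right_sym_leftC mulrA -embedM young_symm_jm_full embedZ.
rewrite -!mulrA (cross_expansion (Q := [pred x : 'I_n | (p <= x)%N])) //.
- rewrite -scalerAl mulr_sumr size_map size_enum_ord; congr (_ *: _).
  by apply: eq_bigr => r _; rewrite -scalerAr mulrA.
- by move=> w y; apply: sym_left_tperm.
- by move=> x; rewrite mem_left_seq -ltnNge.
- by move=> x; rewrite mem_right_seq.
Qed.

Lemma content_poly_strip (nu : intpartn n) z : interlaced be nu ->
  (content_poly F nu).[z] = (content_poly F be).[z] * strip_poly nu be z.
Proof.
move=> /interlacedP ib; rewrite !content_polyE.
pose G i j := z + (j%:R - i%:R) : F.
have cE m (la : intpartn m) : (m <= n)%N -> \prod_x (z + (colt la x)%:R - (rowt la x)%:R) =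
    \prod_(b : 'I_n * 'I_n | (b.2 < row_len la b.1)%N) G b.1 b.2.
  move=> mn; rewrite -(big_boxes la _ G mn); apply: eq_bigr => x _.
  by rewrite /G addrA.
rewrite (cE _ nu (leqnn n)) (cE _ be (leq_addl p q)).
rewrite (bigID (fun b : 'I_n * 'I_n => (b.2 < row_len be b.1)%N)) /=; congr (_ * _).
  apply: eq_bigl => b; rewrite andb_idl // => lt; apply: leq_trans lt _.
  by case: (ib b.1).
rewrite /strip_poly; apply: eq_big => b; first by rewrite inE andbC -leqNgt.
by rewrite /G /content rmorphB /= -!pmulrn.
Qed.

Lemma strip_identity z :
  \sum_(r < p.+1) rising p r z *: gsym (u * Tcross r) =
  K *: \sum_(nu : intpartn n | interlaced be nu) strip_poly nu be z *: chi_elt F nu.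
Proof.
have E y : (content_poly F be).[y] *: \sum_(r < p.+1) rising p r y *: gsym (u * Tcross r) =
    (content_poly F be).[y] *: (K *: \sum_(nu : intpartn n | interlaced be nu) strip_poly nu be y *: chi_elt F nu).
  transitivity (gsym (u * jm_full n y)).
    rewrite strip_elt_jm_full gsymZ gsym_sum; congr (_ *: _).
    by apply: eq_bigr => r _; rewrite gsymZ.
  rewrite gsymMr; last exact: jm_full_central.
  rewrite strip_elt_pieri; move: (strip_scale F p be) => K'.
  rewrite -scalerAl [RHS]scalerA [_ * K']mulrC -[RHS]scalerA; congr (_ *: _).
  rewrite mulr_suml scaler_sumr; apply: eq_bigr => nu ib.
  by rewrite chi_elt_jm_full (content_poly_strip _ ib) [RHS]scalerA.
apply/ffunP=> g.
(* At a zero of the content polynomial of be, [E] says nothing. The coefficients at g of both sides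
   are therefore made polynomials in z, among which this nonzero factor cancels. *)
pose L := \sum_(r < p.+1) (\prod_(r <= i < p) ('X + (i%:R)%:P)) * (gsym (u * Tcross r) g)%:P.
pose M := \sum_(nu : intpartn n | interlaced be nu)
  (\prod_(b in skew_boxes nu be) ('X + ((content b)%:~R)%:P)) * (K * chi_elt F nu g)%:P.
have LE y : L.[y] = (\sum_(r < p.+1) rising p r y *: gsym (u * Tcross r)) g.
  rewrite horner_sum galg_sumE; apply: eq_bigr => r _.
  rewrite hornerM hornerC galgZE horner_prod; congr (_ * _).
  by apply: eq_bigr => i _; rewrite hornerD hornerX hornerC.
have ME y : M.[y] = (K *: \sum_(nu : intpartn n | interlaced be nu) strip_poly nu be y *: chi_elt F nu) g.
  rewrite horner_sum galgZE galg_sumE mulr_sumr; apply: eq_bigr => nu _.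
  rewrite hornerM hornerC galgZE horner_prod mulrCA; congr (_ * (_ * _)).
  by apply: eq_bigr => i _; rewrite hornerD hornerX hornerC.
rewrite -LE -ME; suff -> : L = M by [].
apply: (mulfI (content_poly_neq0 F be)); apply: poly_eq_horner => y.
by rewrite !hornerM LE ME -!galgZE E.
Qed.

Lemma strip_coef_sum k : (k <= p)%N ->
  gsym (u * Tcross k) = K *: \sum_(nu : intpartn n) strip_coef F k be nu *: chi_elt F nu.
Proof.
move=> kp; pose c j : F := (-1) ^+ (p - k - j) * 'C(p - k, j)%:R.
pose zz j : F := j%:R - p%:R + 1.
have -> : \sum_(nu : intpartn n) strip_coef F k be nu *: chi_elt F nu =
    ((p - k)`!%:R)^-1 *: \sum_(0 <= j < (p - k).+1) c j *:
      \sum_(nu : intpartn n | interlaced be nu) strip_poly nu be (zz j) *: chi_elt F nu.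
  rewrite (bigID (fun nu => interlaced be nu)) /= [X in _ + X]big1 ?addr0; last first.
    by move=> nu nib; rewrite /strip_coef hstripE (negPf nib) scale0r.
  under [in RHS]eq_bigr => j _ do rewrite scaler_sumr.
  rewrite exchange_big scaler_sumr; apply: eq_bigr => nu ib.
  rewrite /strip_coef hstripE ib -scalerA scaler_suml; congr (_ *: _).
  by apply: eq_bigr => j _; rewrite [RHS]scalerA.
rewrite scalerA [K * _]mulrC -scalerA scaler_sumr.
under eq_bigr => j _ do rewrite scalerA [K * _]mulrC -scalerA -strip_identity scaler_sumr.
rewrite exchange_big /= scaler_sumr.
have term (r : nat) (X : galg F 'S_n) : (r <= p)%N -> ((p - k)`!%:R)^-1 *:
    \sum_(0 <= j < (p - k).+1) c j *: (rising p r (zz j) *: X) = (r == k)%:R *: X.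
  move=> rp; rewrite -(rising_difference F rp kp) -scalerA scaler_suml; congr (_ *: _).
  by apply: eq_bigr => j _; rewrite scalerA.
rewrite (eq_bigr (fun r : 'I_p.+1 => (r == k :> nat)%:R *: gsym (u * Tcross r))) => [|r _].
  rewrite (bigD1 (Ordinal (kp : (k < p.+1)%N))) //= big1 => [|r rk].
    by rewrite eqxx scale1r addr0.
  by rewrite -[(r : nat) == k]/(r == Ordinal (kp : (k < p.+1)%N)) (negPf rk) scale0r.
by apply: term; rewrite -ltnS.
Qed.

End Strip.

(** * Positivity *)

Lemma psdmx_gram (C : numClosedFieldType) n (A : 'M[C]_n) : psdmx A ->
  exists B : 'M[C]_n, forall i j, A i j = \sum_l (B l i)^* * B l j.
Proof.
case=> Ah Apos; have := hermitian_normalmx Ah; move/orthomx_spectralP.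
set P := spectralmx A; set D := spectral_diag A => AE.
have Pu : P \is unitarymx := spectral_unitarymx A.
rewrite (invmx_unitary Pu) in AE.
(* The eigenvalue is the value of the form at the i-th column of the adjoint of the unitary matrix
   P. *)
have D0 i : 0 <= D 0 i.
  have := Apos ((P^t*)%sesqui *m delta_mx i 0).
  rewrite AE trmx_mul map_mxM trmxCK !mulmxA !mulmxtVK //.
  rewrite mul_mx_diag !mxE (bigD1 i) //= big1 => [|j ji]; rewrite !mxE.
    by rewrite !eqxx conjC1 mul1r mulr1 addr0.
  by rewrite (negPf ji) mulr0.
exists (\matrix_(l, i) (sqrtC (D 0 l) * P l i)) => i j.
rewrite {1}AE -mulmxA !mxE; apply: eq_bigr => l _.
have s0 : 0 <= sqrtC (D 0 l) by rewrite sqrtC_ge0.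
by rewrite mul_diag_mx !mxE rmorphM /= (geC0_conj s0) mulrACA -expr2 sqrtCK mulrCA.
Qed.

(** * Permutations acting on tensors *)

Section Tensor.
Variables (C : numClosedFieldType) (T : finType).
Notation idx := {ffun T -> T}.
Notation A := (galg C {perm T}).
Implicit Types (w : idx -> C) (f : idx) (s : {perm T}) (a b : A).

Definition permf f s : idx := [ffun x => f (s x)].

Lemma permfM f s t : permf (permf f t) s = permf f (s * t).
Proof. by apply/ffunP => x; rewrite !ffunE permM. Qed.

Lemma permf1 f : permf f 1 = f.
Proof. by apply/ffunP => x; rewrite ffunE perm1. Qed.

Lemma permf_inj s : injective (permf^~ s).
Proof.
by apply: (can_inj (g := permf^~ s^-1%g)) => f; rewrite permfM mulVg permf1.
Qed.

(** A function on [idx] is a tensor in the T-fold power of the space C^T: T serves both as the set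
    of positions and as the basis, and permutations move the positions. *)
Definition act a w : idx -> C := fun f => \sum_s a s * w (permf f s^-1%g).

Definition ip w w' : C := \sum_f (w f)^* * w' f.

Lemma actM a b w f : act (a * b) w f = act a (act b w) f.
Proof.
rewrite /act; under eq_bigr => s _ do rewrite gmulE mulr_suml.
rewrite exchange_big; apply: eq_bigr => t _ /=.
rewrite mulr_sumr (reindex_inj (mulgI t)); apply: eq_bigr => s _ /=.
by rewrite mulKg permfM invMg mulrA.
Qed.

Lemma act_gb s w f : act (gb C s) w f = w (permf f s^-1%g).
Proof.
rewrite /act (bigD1 s) //= big1 => [|t ts]; rewrite ffunE ?eqxx ?mul1r ?addr0 //.
by rewrite (negPf ts) mul0r.
Qed.

Lemma act_sum (I : Type) (r : seq I) (Pr : pred I) (a : I -> A) w f :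
  act (\sum_(i <- r | Pr i) a i) w f = \sum_(i <- r | Pr i) act (a i) w f.
Proof.
rewrite /act exchange_big; apply: eq_bigr => s _ /=.
by rewrite galg_sumE mulr_suml.
Qed.

Lemma actZ c a w f : act (c *: a) w f = c * act a w f.
Proof. by rewrite mulr_sumr; apply: eq_bigr => s _; rewrite galgZE mulrA. Qed.

Lemma eq_act a w w' : w =1 w' -> act a w =1 act a w'.
Proof. by move=> E f; apply: eq_bigr => s _; rewrite E. Qed.

Lemma eq_ip w1 w1' w2 w2' : w1 =1 w1' -> w2 =1 w2' -> ip w1 w2 = ip w1' w2'.
Proof. by move=> E E'; apply: eq_bigr => f _; rewrite E E'. Qed.

Lemma ip_adj a w w' : (forall s, (a s^-1%g)^* = a s) -> ip (act a w) w' = ip w (act a w').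
Proof.
move=> aH; rewrite /ip /act.
under eq_bigr => f _ do rewrite rmorph_sum mulr_suml.
rewrite exchange_big /= (reindex_inj invg_inj) /=.
under [RHS]eq_bigr => f _ do rewrite mulr_sumr.
rewrite [RHS]exchange_big; apply: eq_bigr => s _ /=.
rewrite (reindex_inj (@permf_inj s^-1%g)); apply: eq_bigr => f _ /=.
by rewrite invgK permfM mulgV permf1 rmorphM /= aH -mulrA mulrCA.
Qed.

Lemma ip_conj s a w : ip w (act (gb C s^-1 * a * gb C s) w) = ip (act (gb C s) w) (act a (act (gb C s) w)).
Proof.
rewrite /ip [RHS](reindex_inj (@permf_inj s)); apply: eq_bigr => f _ /=.
by rewrite -mulrA actM !act_gb invgK permfM mulVg permf1 actM.
Qed.

Lemma ipZ c w w' : ip w (fun f => c * w' f) = c * ip w w'.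
Proof. by rewrite mulr_sumr; apply: eq_bigr => f _; rewrite mulrCA. Qed.

Lemma ip_sum (I : Type) (r : seq I) (Pr : pred I) w (w' : I -> idx -> C) :
  ip w (fun f => \sum_(i <- r | Pr i) w' i f) = \sum_(i <- r | Pr i) ip w (w' i).
Proof. by rewrite /ip exchange_big; apply: eq_bigr => f _; rewrite mulr_sumr. Qed.

Definition dep (D : pred T) w := forall f f' : idx, (forall x, D x -> f x = f' x) -> w f = w f'.

Lemma dep_act (D D' : pred T) a w : (forall x, D x || D' x) -> (forall x, ~~ (D x && D' x)) ->
  gfix D' a -> dep D w -> dep D (act a w).
Proof.
move=> DD' disj Da dw f f' ff'; apply: eq_bigr => s _.
case: (eqVneq (a s) 0) => [->|/Da/fixesP fs]; first by rewrite !mul0r.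
congr (_ * _); apply: dw => x Dx; rewrite !ffunE; apply: ff'.
have := DD' (s^-1 x)%g; case/orP => // D'x.
have e : s^-1%g x = x by rewrite -[RHS](permKV s) fs.
by have := disj x; rewrite Dx -e D'x.
Qed.

Lemma act_mul_dep (D : pred T) a w w' : gfix D a -> dep D w' ->
  act a (fun f => w f * w' f) =1 (fun f => act a w f * w' f).
Proof.
move=> Da dw f; rewrite /act mulr_suml; apply: eq_bigr => s _.
case: (eqVneq (a s) 0) => [->|/Da/fixesP fs]; first by rewrite !mul0r.
rewrite mulrA; congr (_ * _); apply: dw => x Dx; rewrite ffunE.
by congr (f _); apply: (@perm_inj _ s); rewrite permKV fs.
Qed.

Section CrossPositive.
Variables (Q : pred T) (m : {perm T}).
Hypothesis mQ : crossing Q [set x | ~~ Q x] m.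
Variables (wP wQ : idx -> C).
Hypotheses (dP : dep [predC Q] wP) (dQ : dep Q wQ).

Let mm x : m (m x) = x. Proof. by case: (crossingP _ _ _ mQ) => H _. Qed.

Let Qm x : m x != x -> Q (m x) = ~~ Q x.
Proof.
move=> mx; have [_ H] := crossingP _ _ _ mQ; have := H x mx.
by rewrite !inE; case: (Q x); case: (Q (m x)).
Qed.

Let S := [pred f : idx | permf f m == f].
(** Away from the fixed points of m the value x is a placeholder, so that [res f] records exactly
    the restriction of f to these points. *)
Let res (f : idx) : idx := [ffun x => if m x == x then f x else x].
(* f is encoded by two m-invariant functions agreeing on the fixed points of m;
   this turns the sum into a sum of squares over the common restriction. *)
Let phi (f : idx) : idx * idx :=
  ([ffun x => if Q x then f (m x) else f x], [ffun x => if Q x then f x else f (m x)]).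
Let psi (ff : idx * idx) : idx := [ffun x => if Q x then ff.2 x else ff.1 x].
Let G (f : idx) := (wP f)^* * wQ (permf f m).

Let phiK f : psi (phi f) = f.
Proof. by apply/ffunP => x; rewrite !ffunE; case: (Q x). Qed.

Let phiS f : (phi f).1 \in S /\ (phi f).2 \in S.
Proof.
split; rewrite inE; apply/eqP/ffunP => x; rewrite !ffunE mm.
  by case: (eqVneq (m x) x) => [->//|/Qm ->]; case: (Q x).
by case: (eqVneq (m x) x) => [->//|/Qm ->]; case: (Q x).
Qed.

Let phi_res f : res (phi f).1 = res (phi f).2.
Proof.
apply/ffunP => x; rewrite !ffunE; case: eqP => // mx.
by rewrite mx; case: (Q x).
Qed.

Let psiK ff : ff.1 \in S -> ff.2 \in S -> res ff.1 = res ff.2 -> phi (psi ff) = ff.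
Proof.
case: ff => f1 f2; rewrite !inE /= => /eqP/ffunP S1 /eqP/ffunP S2 /ffunP R.
have S1' x : f1 (m x) = f1 x by have := S1 x; rewrite ffunE.
have S2' x : f2 (m x) = f2 x by have := S2 x; rewrite ffunE.
have R' x : m x = x -> f1 x = f2 x by move=> mx; have := R x; rewrite !ffunE mx eqxx.
congr pair; apply/ffunP => x; rewrite !ffunE /=.
  case: (boolP (Q x)) => [Qx|] //.
  by case: (eqVneq (m x) x) => [e|/Qm ->]; [rewrite e Qx (R' x e) | rewrite Qx /= S1'].
case: (boolP (Q x)) => [|/negPf Qx] //.
by case: (eqVneq (m x) x) => [e|/Qm ->]; [rewrite e Qx (R' x e) | rewrite Qx /= S2'].
Qed.

Let G1 f : G f = G (phi f).1.
Proof.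
congr (_^* * _); first by apply: dP => x /negPf Qx; rewrite ffunE -[Q x]/(x \in Q) Qx.
by apply: dQ => x Qx; have := (phiS f).1; rewrite inE => /eqP ->; rewrite !ffunE Qx.
Qed.

Let G2 f : G (permf f m) = G (phi f).2.
Proof.
congr (_^* * _); first by apply: dP => x /negPf Qx; rewrite !ffunE -[Q x]/(x \in Q) Qx.
apply: dQ => x Qx; have := (phiS f).2; rewrite inE => /eqP ->.
by rewrite !ffunE Qx mm.
Qed.

(** Regrouping the four factors, the term of f is [G f] times the conjugate of [G (permf f m)].
    Under [phi] these become values of G at two m-invariant functions, bound to each other only by
    their common restriction h; for each h the sum is a number times its conjugate. *)
Lemma cross_positive : 0 <= ip (fun f => wP f * wQ f) (act (gb C m) (fun f => wP f * wQ f)).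
Proof.
have mV : m^-1%g = m by apply/permP => x; apply: (@perm_inj _ m); rewrite permKV mm.
have -> : ip (fun f => wP f * wQ f) (act (gb C m) (fun f => wP f * wQ f)) =
    \sum_f G f * (G (permf f m))^*.
  apply: eq_bigr => f _; rewrite act_gb mV /G !rmorphM /= conjCK permfM.
  have -> : (m * m)%g = 1%g by apply/permP => x; rewrite permM mm perm1.
  by rewrite permf1; ring.
rewrite (eq_bigr (fun f => G (phi f).1 * (G (phi f).2)^*)) => [|f _]; last by rewrite G1 G2.
have -> : \sum_f G (phi f).1 * (G (phi f).2)^* =
    \sum_(ff : idx * idx | [&& ff.1 \in S, ff.2 \in S & res ff.1 == res ff.2]) G ff.1 * (G ff.2)^*.
  rewrite (reindex_onto phi psi) /=; last first.
    by move=> ff /and3P[S1 S2 /eqP R]; apply: psiK.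
  apply: eq_bigl => f; have [-> ->] := phiS f.
  by rewrite phi_res phiK !eqxx.
rewrite (partition_big (fun ff : idx * idx => res ff.1) xpredT) //=.
apply: sumr_ge0 => h _.
have -> : \sum_(ff : idx * idx | [&& ff.1 \in S, ff.2 \in S & res ff.1 == res ff.2] && (res ff.1 == h))
    G ff.1 * (G ff.2)^* =
  (\sum_(f | (f \in S) && (res f == h)) G f) * (\sum_(f | (f \in S) && (res f == h)) G f)^*.
  rewrite rmorph_sum mulr_suml; under [RHS]eq_bigr => f _ do rewrite mulr_sumr.
  rewrite pair_big_dep /=; apply: eq_bigl => -[f1 f2] /=.
  case: (f1 \in S); rewrite ?andbF //=; case: (f2 \in S); rewrite ?andbF //=.
  by case: (eqVneq (res f1) h) => [->|]; rewrite ?andbF ?andbT // eq_sym.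
exact: mul_conjC_ge0.
Qed.

End CrossPositive.
End Tensor.

Lemma fixes_stable (T : finType) (D : pred T) (g : {perm T}) : fixes D g -> forall x, D (g x) = D x.
Proof.
move=> /fixesP fg x; apply/idP/idP => [Dgx|Dx]; last by rewrite fg.
by have <- : g x = x by apply: (@perm_inj _ g); rewrite fg.
Qed.

Lemma crosssum_comm (F : fieldType) (T : finType) (Q : pred T) r (g : {perm T}) :
  (forall x, Q (g x) = Q x) ->
  gb F g * crosssum F Q [set x | ~~ Q x] r = crosssum F Q [set x | ~~ Q x] r * gb F g.
Proof.
move=> gQ; rewrite mulr_sumr mulr_suml (reindex_inj (conjg_inj g)) /=; apply: eq_big => m.
  rewrite !inE nmoved_conj // -[in RHS](crossing_conj _ _ gQ); congr (crossing _ _ _ && _).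
  apply/setP => x; rewrite inE; apply/idP/imsetP => [Qx|[y]]; last by rewrite inE => Qy ->; rewrite gQ.
  by exists (g^-1 x)%g; rewrite ?permKV // inE -gQ permKV.
by rewrite -!gbM -conjgC.
Qed.

Section Real.
Variables (F : numFieldType).

Definition greal (gT : finGroupType) (a : galg F gT) := forall g, a g \is Num.real.

Lemma grealM (gT : finGroupType) (a b : galg F gT) : greal a -> greal b -> greal (a * b).
Proof. by move=> ra rb g; rewrite gmulE rpred_sum // => h _; rewrite rpredM ?ra ?rb. Qed.

Lemma greal_label_sum (T : finType) eps (f : T -> nat) s : greal (label_sum F eps f s).
Proof.
move=> g; rewrite label_sumE; case: ifP => _; last exact: real0.
by rewrite /lsgn rpredX // rpredN real1.
Qed.

Lemma greal_gsym (gT : finGroupType) (a : galg F gT) : greal a -> greal (gsym a).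
Proof. by move=> ra g; rewrite gsymE rpred_sum. Qed.

Lemma greal_chi_elt n (la : intpartn n) : greal (chi_elt F la).
Proof.
have ry : greal (young_symm F la) by apply: grealM; apply: greal_label_sum.
move=> g; rewrite galgZE rpredM ?rpredV //; first exact: (grealM ry ry).
exact: greal_gsym.
Qed.

Lemma greal_embed (T T' : finType) (h : T -> T') (hI : injective h) (a : galg F {perm T}) :
  greal a -> greal (embed hI a).
Proof.
move=> ra g; rewrite galg_sumE rpred_sum // => s _; rewrite galgZE ffunE rpredM //.
exact: realn.
Qed.

End Real.

Lemma gstar_embed (F : fieldType) (T T' : finType) (h : T -> T') (hI : injective h)
  (a : galg F {perm T}) : gstar (embed hI a) = embed hI (gstar a).
Proof.
rewrite gstar_sum /embed (reindex_inj invg_inj) /=; apply: eq_bigr => s _.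
by rewrite gstarZ gstar_gb extpV invgK ffunE.
Qed.

Section Vanish.
Variables (F : numFieldType) (p q : nat) (be : intpartn q).
Notation n := (p + q)%N.

Lemma Pset : [set x in left_seq p q] = [set x | ~~ [pred x : 'I_n | (p <= x)%N] x].
Proof. by apply/setP => x; rewrite !inE mem_left_seq -ltnNge. Qed.

Lemma strip_elt_Tcross1 k : (0 < k)%N -> (strip_elt F p be * Tcross F p q k) 1%g = 0.
Proof.
move=> k0; rewrite mulr_sumr galg_sumE big1 // => m; rewrite inE => /andP[mc /eqP mk].
rewrite gbMr mul1g; apply/eqP/negPn/negP => /gmul_supp[h [/embed_right_gfix/fixesP hP /sym_left_gfix tQ]].
have tst := fixes_stable tQ; set t := (h^-1 * m^-1)%g in tQ tst.
have mV : m^-1%g = (h * t)%g by rewrite /t mulKVg.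
have [mm H] := crossingP _ _ _ mc.
have mE : m = m^-1%g by apply/permP => x; apply: (@perm_inj _ m); rewrite permKV mm.
have [x] : exists x, x \in [set x | ~~ [pred x : 'I_n | (p <= x)%N] x && (m x != x)].
  by apply/card_gt0P; rewrite -/(nmoved _ _) mk.
rewrite inE /= -ltnNge => /andP[xp mx].
have Qx : (p <= x)%N = false by rewrite leqNgt xp.
have := H x mx; rewrite /= Qx /= orbF => /andP[_].
have -> : m x = t x by rewrite mE mV permM hP.
by have /= -> := tst x; rewrite Qx.
Qed.

End Vanish.

Definition pure_tensor (C : numClosedFieldType) m (b : 'I_m -> 'I_m -> C)
    (f : {ffun 'I_m -> 'I_m}) : C := \prod_i b i (f i).

Section Positive.
Variables (C : numClosedFieldType) (p q : nat) (be : intpartn q).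
Notation n := (p + q)%N.
Let Q := [pred x : 'I_n | (p <= x)%N].
Let P := [pred x : 'I_n | (x < p)%N].
Let X := embed_right p (chi_elt C be).
(** A self-adjoint substitute for the strip element: the character of be is real and invariant under
    inversion, and it commutes with [sym_left]. *)
Let x := X * sym_left C p q.
Let kb := symm_scale (young_symm C be).
Let pb := young_symm_prim C be.

Lemma strip_sq : x * x = (kb * (p`!)%:R) *: x.
Proof.
rewrite /x -expr2 exprMn_comm ?expr2; last exact: embed_right_sym_leftC.
by rewrite /X -embedM (symm_char_idem pb) embedZ sym_left_idem -scalerAl -scalerAr scalerA.
Qed.

Lemma strip_herm s : (x s^-1%g)^* = x s.
Proof.
have rx : greal x by apply: grealM; [apply/greal_embed/greal_chi_elt | apply: greal_label_sum].
rewrite (CrealP (rx _)); have sx : gstar x = x by rewrite gstarM star_label_sum gstar_embed chi_elt_star -embed_right_sym_leftC.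
by rewrite -[in RHS]sx [RHS]ffunE.
Qed.

Variable k : nat.
Let T := Tcross C p q k.

Let TQ (g : 'S_n) : (forall y, Q (g y) = Q y) -> gb C g * T = T * gb C g.
Proof. by move=> gQ; rewrite /T /Tcross Pset; apply: crosssum_comm. Qed.

Let TX a : embed_right p a * T = T * embed_right p a.
Proof.
apply: (gfixC (@embed_right_gfix _ _ _ a)) => g /fixes_stable gP; apply: TQ => y.
by have := gP y; rewrite /= !ltnNge => /(congr1 negb); rewrite !negbK.
Qed.

Let Teps : sym_left C p q * T = T * sym_left C p q.
Proof. by apply: (gfixC (@sym_left_gfix C p q)) => g /fixes_stable gP; apply: TQ. Qed.

Let xT : x * T = T * x.
Proof. by rewrite /x -mulrA Teps !mulrA TX. Qed.

(** As x is self-adjoint, commutes with T and satisfies x x = c x with c > 0, the value is c^-1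
    times the value of T at the tensor x V. That tensor is again a product of a tensor on P and one
    on Q, because the two factors of x act on separate positions. *)
Lemma strip_product_positive (b : 'I_n -> 'I_n -> C) :
  0 <= ip (pure_tensor b) (act (x * T) (pure_tensor b)).
Proof.
set V := pure_tensor b; pose c := kb * (p`!)%:R.
have c0 : 0 < c by rewrite mulr_gt0 ?(symm_scale_gt0 pb) // ltr0n fact_gt0.
pose VP (f : {ffun 'I_n -> 'I_n}) := \prod_(y | P y) b y (f y).
pose VQ (f : {ffun 'I_n -> 'I_n}) := \prod_(y | Q y) b y (f y).
have VPQ : V =1 (fun f => VP f * VQ f).
  move=> f; rewrite /V /pure_tensor (bigID P); congr (_ * _); apply: eq_bigl => y.
  by rewrite /= -leqNgt.
have dVP : dep P VP by move=> f f' ff'; apply: eq_bigr => y Py; rewrite ff'.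
have dVQ : dep Q VQ by move=> f f' ff'; apply: eq_bigr => y Qy; rewrite ff'.
pose wP := act (sym_left C p q) VP; pose wQ := act X VQ; pose w f := wP f * wQ f.
have PQ y : P y || Q y by apply: PQ_disjoint.
have QP y : Q y || P y by rewrite orbC.
have dwP : dep P wP.
  apply: dep_act (@sym_left_gfix C p q) dVP; first exact: PQ.
  by move=> y; rewrite /=; case: ltnP.
have dwQ : dep Q wQ.
  apply: dep_act (@embed_right_gfix _ _ _ _) dVQ; first exact: QP.
  by move=> y; rewrite /=; case: ltnP.
have xV : act x V =1 w.
  move=> f; rewrite /x actM.
  have E1 : act (sym_left C p q) V =1 (fun f => VQ f * wP f).
    move=> f'; rewrite (eq_act _ VPQ) (act_mul_dep VP (@sym_left_gfix C p q) dVQ).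
    exact: mulrC.
  by rewrite (eq_act _ E1) (act_mul_dep VQ (@embed_right_gfix _ _ _ _) dwP) mulrC.
have xTE : x * T = c^-1 *: (x * (T * x)).
  by rewrite -xT mulrA strip_sq -scalerAl scalerA mulVf ?scale1r // gt_eqF.
have -> : ip V (act (x * T) V) = c^-1 * ip w (act T w).
  rewrite xTE -ipZ; transitivity (c^-1 * ip V (act (x * (T * x)) V)).
    by rewrite -ipZ; apply: eq_ip => // f; rewrite actZ.
  rewrite ipZ; congr (_ * _).
  transitivity (ip V (act x (act T (act x V)))).
    apply: eq_ip => // f; rewrite actM; apply: eq_act => f'; exact: actM.
  rewrite -ip_adj; last exact: strip_herm.
  by apply: eq_ip => // f; apply: eq_act.
rewrite mulr_ge0 ?invr_ge0 ?(ltW c0) //.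
have -> : ip w (act T w) = \sum_(m in crossset Q [set x in left_seq p q] k) ip w (act (gb C m) w).
  rewrite -ip_sum; apply: eq_ip => // f; exact: act_sum.
apply: sumr_ge0 => m; rewrite Pset inE => /andP[mc _].
apply: (cross_positive mc) => //.
by move=> f f' ff'; apply: dwP => y Py; apply: ff'; rewrite inE /= -ltnNge.
Qed.

Definition Imm m (y : galg C 'S_m) (A : 'M[C]_m) := \sum_s y s * \prod_i A i (s i).

Lemma ImmZ m c (y : galg C 'S_m) A : Imm (c *: y) A = c * Imm y A.
Proof. by rewrite mulr_sumr; apply: eq_bigr => s _; rewrite galgZE mulrA. Qed.

Lemma Imm_sum m (I : Type) (r : seq I) (Pr : pred I) (y : I -> galg C 'S_m) A :
  Imm (\sum_(i <- r | Pr i) y i) A = \sum_(i <- r | Pr i) Imm (y i) A.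
Proof.
rewrite /Imm exchange_big; apply: eq_bigr => s _ /=.
by rewrite galg_sumE mulr_suml.
Qed.

(** The entry [A i j] is the inner product of columns i and j of B, so the product of the
    [A i (s i)] is the inner product of V, the tensor product of the columns, with its image under
    s. *)
Lemma Imm_gram m (y : galg C 'S_m) (A B : 'M[C]_m) :
  (forall i j, A i j = \sum_l (B l i)^* * B l j) ->
  let V := pure_tensor (fun i l => B l i) in Imm y A = ip V (act y V).
Proof.
move=> AB /=; rewrite /ip /act /pure_tensor; under [RHS]eq_bigr => f _ do rewrite mulr_sumr.
rewrite exchange_big; apply: eq_bigr => s _ /=.
under eq_bigr => i _ do rewrite AB.
rewrite bigA_distr_bigA mulr_sumr; apply: eq_bigr => f _ /=.
rewrite big_split /= rmorph_prod mulrCA; congr (_ * (_ * _)).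
rewrite (reindex_inj (@perm_inj _ s^-1%g)); apply: eq_bigr => i _ /=.
by rewrite ffunE permKV.
Qed.

(** Conjugation by g amounts to permuting the columns of B, which gives another pure tensor. *)
Lemma Imm_gsym_ge0 A : psdmx A -> 0 <= Imm (gsym (x * T)) A.
Proof.
move=> /psdmx_gram[B AB]; rewrite /gsym Imm_sum; apply: sumr_ge0 => g _.
rewrite (Imm_gram _ AB) ip_conj.
have E : act (gb C g) (pure_tensor (fun i l => B l i)) =1 pure_tensor (fun y l => B l (g y)).
  move=> f; rewrite act_gb /pure_tensor (reindex_inj (@perm_inj _ g)); apply: eq_bigr => i _.
  by rewrite ffunE permK.
rewrite (eq_ip E (eq_act _ E)); exact: strip_product_positive.
Qed.

(** Averaging the Young symmetrizer over the permutations of Q produces the character of be. The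
    average is invisible to the outer symmetrization, since [sym_left] and T commute with these
    permutations. *)
Lemma gsym_strip : gsym (strip_elt C p be * T) = (kb / (q`!)%:R) *: gsym (x * T).
Proof.
have q0 : (q`!)%:R != 0 :> C by rewrite pnatr_eq0 -lt0n fact_gt0.
have H : gsym (embed_right p (gsym (young_symm C be)) * (sym_left C p q * T)) =
    #|{perm 'I_q}|%:R *: gsym (embed_right p (young_symm C be) * (sym_left C p q * T)).
  apply: embed_gsym => s; rewrite -embed_gb -/(embed_right p _) mulrA embed_right_sym_leftC -!mulrA; congr (_ * _).
  exact: TX.
have gE : gsym (young_symm C be) = kb *: chi_elt C be.
  by rewrite /chi_elt /symm_char scalerA mulfV ?scale1r // (symm_scale_neq0 pb).
rewrite gE [embed_right _ (_ *: _)]embedZ -scalerAl gsymZ !mulrA in H.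
have cS : #|{perm 'I_q}| = q`! by rewrite -(card_Sn q) /=; apply: eq_card.
rewrite cS in H.
by rewrite mulrC -scalerA H scalerA mulVf // scale1r.
Qed.

End Positive.

Theorem theorem4p2 (R : realType) (p q k : nat) (beta : intpartn q)
    (hp : (1 <= p)%N) (hq : (1 <= q)%N) (hk : (1 <= k <= minn p q)%N) :
  (forall A : 'M[R[i]]_(p + q), psdmx A -> 0 <= Phi k beta A) /\
  \sum_(nu : intpartn (p + q)) chi_degree R[i] nu * strip_coef R[i] k beta nu = 0.
Proof.
have /andP[k1 kpq] := hk; have kp : (k <= p)%N by apply: leq_trans kpq (geq_minl _ _).
have K0 : strip_scale R[i] p beta != 0 := strip_scale_neq0 _ _ _.
have pb := young_symm_prim R[i] beta.
have sumE : \sum_(nu : intpartn (p + q)) strip_coef R[i] k beta nu *: chi_elt R[i] nu =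
    (strip_scale R[i] p beta)^-1 *: gsym (strip_elt R[i] p beta * Tcross R[i] p q k).
  by rewrite strip_coef_sum // scalerA mulVf // scale1r.
split=> [A Apsd|].
  have -> : Phi k beta A = Imm (\sum_(nu : intpartn (p + q)) strip_coef R[i] k beta nu *: chi_elt R[i] nu) A.
    rewrite Imm_sum; apply: eq_bigr => nu _; rewrite ImmZ; congr (_ * _).
    by apply: eq_bigr => s _; rewrite chi_chi_elt.
  rewrite sumE gsym_strip !ImmZ !mulr_ge0 ?invr_ge0 ?ler0n //; last exact: Imm_gsym_ge0.
    by rewrite mulr_ge0 ?ler0n // ltW // (symm_scale_gt0 pb).
  exact: ltW (symm_scale_gt0 pb).
transitivity ((\sum_(nu : intpartn (p + q)) strip_coef R[i] k beta nu *: chi_elt R[i] nu) 1%g).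
  by rewrite galg_sumE; apply: eq_bigr => nu _; rewrite galgZE mulrC /chi_degree chi_chi_elt.
by rewrite sumE galgZE gsym1 strip_elt_Tcross1 // !mulr0.
Qed.
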